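(* For the WTC-GF $p(y\hat y z\mid x)$ with finite alphabets, the secret key capacity satisfies $$\mathrm{C}_{kf}\ \ge\ \max_{p\in\mathcal P_{I_1}:\ I(V;X,\hat Y\mid U,Y)\le I(U;Y)}\Big[I(V;Y\mid U,T)-I(V;Z\mid U,T)+\big|\,I(U;Y)-\max\{I(Q;Y),\,I(V;X,\hat Y\mid U,Y)\}-I(U;Z\mid Q)-I(U;T\mid Q,Z)\,\big|^+\Big],$$ where $|a|^+=\max\{a,0\}$ and $\mathcal P_{I_1}$ is the set of all joint distributions of the form $$p(q,u,x,v,t,y,\hat y,z)=p(q,u)\,p(x\mid u)\,p(y,\hat y,z\mid x)\,p(t\mid v)\,p(v\mid u,x,\hat y)$$ with $Q,U,T,V$ auxiliary random variables on finite alphabets.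
   Context: Wiretap channel with generalized feedback (WTC-GF): finite alphabets $\mathcal X,\mathcal Y,\hat{\mathcal Y},\mathcal Z$ and a conditional distribution $p(y,\hat y,z\mid x)$; Alice sends $X_i$, Bob observes $Y_i$, Eve observes $Z_i$, and Alice receives the feedback $\hat Y_i$, with memorylessness $p(y_i,\hat y_i,z_i\mid x^i,y^{i-1},\hat y^{i-1},z^{i-1})=p(y_i,\hat y_i,z_i\mid x_i)$ for all $i\in[1:n]$. A $(2^{nR_k},n)$ secret key (SK) code consists of a source of local randomness $R_r$ at the encoder, encoding functions $X_i=\varphi_i(R_r,\hat Y^{i-1})$, a key $K=\psi_a(R_r,\hat Y^n)\in[1:2^{nR_k}]$ generated by Alice, and a key estimate $\hat K=\psi_b(Y^n)$ generated by Bob. A secret key rate $R_k$ is achievable if for every $\epsilon>0$ and all sufficiently large $n$ there is a $(2^{nR_k},n)$ SK code with $\Pr[\hat K\ne K]\le\epsilon$, $\frac1n I(K;Z^n)\le\epsilon$, and $\frac1n\big(nR_k-H(K)\big)\le\epsilon$. The secret key capacity $\mathrm{C}_{kf}$ is the supremum of achievable SK rates. *)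

(* Defs.v *)
From mathcomp Require Import all_boot.
From Stdlib Require Import Reals.
Set Implicit Arguments. Unset Strict Implicit. Unset Printing Implicit Defensive.

Definition sumR (T : finType) (f : T -> R) : R := \big[Rplus/0%R]_(t : T) f t.

Definition is_dist (T : finType) (p : T -> R) : Prop :=
  (forall t, (0 <= p t)%R) /\ sumR p = 1%R.

Definition pmf_of (O T : finType) (P : O -> R) (A : O -> T) (a : T) : R :=
  \big[Rplus/0%R]_(o : O | A o == a) P o.

Definition xlog2x (p : R) : R := if Rlt_dec 0 p then (p * (ln p / ln 2))%R else 0%R.

Definition ent (O T : finType) (P : O -> R) (A : O -> T) : R :=
  (- sumR (fun a => xlog2x (pmf_of P A a)))%R.

Definition cmi (O TA TB TC : finType) (P : O -> R)
  (A : O -> TA) (B : O -> TB) (C : O -> TC) : R :=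
  (ent P (fun o => (A o, C o)) + ent P (fun o => (B o, C o))
   - ent P (fun o => (A o, B o, C o)) - ent P C)%R.

Definition mi (O TA TB : finType) (P : O -> R) (A : O -> TA) (B : O -> TB) : R :=
  cmi P A B (fun _ => tt).

Definition pos_part (a : R) : R := Rmax a 0.

(** key alphabet size |[1 : 2^{n R}]| = floor (2^{n R}) *)
Definition keyM (n : nat) (Rk : R) : nat :=
  Z.to_nat (Int_part (Rpower 2 (INR n * Rk))).

(** feedback history yh^{i-1} (the first i feedback symbols, 0-indexed i) *)
Definition fb_hist (Y Yh Z : finType) (n : nat)
  (w : {ffun 'I_n -> Y * Yh * Z}) (i : 'I_n) : seq Yh :=
  take i [seq (w j).1.2 | j <- enum 'I_n].

Definition code_pmf (X Y Yh Z : finType) (W : X -> Y * Yh * Z -> R) (n : nat)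
  (Rr : finType) (pr : Rr -> R) (phi : 'I_n -> Rr -> seq Yh -> X)
  (o : Rr * {ffun 'I_n -> Y * Yh * Z}) : R :=
  (pr o.1 * \big[Rmult/1%R]_(i : 'I_n) W (phi i o.1 (fb_hist o.2 i)) (o.2 i))%R.

Definition Yseq (Y Yh Z : finType) (n : nat) (w : {ffun 'I_n -> Y * Yh * Z})
  : {ffun 'I_n -> Y} := [ffun i => (w i).1.1].
Definition Yhseq (Y Yh Z : finType) (n : nat) (w : {ffun 'I_n -> Y * Yh * Z})
  : {ffun 'I_n -> Yh} := [ffun i => (w i).1.2].
Definition Zseq (Y Yh Z : finType) (n : nat) (w : {ffun 'I_n -> Y * Yh * Z})
  : {ffun 'I_n -> Z} := [ffun i => (w i).2].

(** A (2^{nRk}, n) SK code with error, leakage and uniformity all <= eps.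
    Local randomness R_r is a finite-valued random variable with pmf pr;
    X_i = phi_i(R_r, Yh^{i-1}); K = psia(R_r, Yh^n); Khat = psib(Y^n). *)
Definition good_SK_code (X Y Yh Z : finType) (W : X -> Y * Yh * Z -> R)
  (Rk : R) (n : nat) (eps : R) : Prop :=
  exists (Rr : finType) (pr : Rr -> R) (phi : 'I_n -> Rr -> seq Yh -> X)
         (psia : Rr -> {ffun 'I_n -> Yh} -> 'I_(keyM n Rk))
         (psib : {ffun 'I_n -> Y} -> 'I_(keyM n Rk)),
    is_dist pr /\
    let P := code_pmf W pr phi in
    let K := fun o : Rr * {ffun 'I_n -> Y * Yh * Z} => psia o.1 (Yhseq o.2) in
    let Kh := fun o : Rr * {ffun 'I_n -> Y * Yh * Z} => psib (Yseq o.2) in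
    let Zn := fun o : Rr * {ffun 'I_n -> Y * Yh * Z} => Zseq o.2 in
    (sumR (fun o => if K o != Kh o then P o else 0) <= eps)%R /\
    (mi P K Zn / INR n <= eps)%R /\
    ((INR n * Rk - ent P K) / INR n <= eps)%R.

Definition SK_achievable (X Y Yh Z : finType) (W : X -> Y * Yh * Z -> R)
  (Rk : R) : Prop :=
  forall eps : R, (0 < eps)%R ->
    exists N : nat, forall n : nat, (N <= n)%N -> good_SK_code W Rk n eps.

Definition Omega1 (Q U X Y Yh Z V T : finType) : finType :=
  (Q * U * X * (Y * Yh * Z) * V * T)%type.

Definition joint1 (Q U X Y Yh Z V T : finType) (W : X -> Y * Yh * Z -> R)
  (pQU : Q * U -> R) (pXgU : U -> X -> R) (pVg : U * X * Yh -> V -> R)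
  (pTgV : V -> T -> R) (o : Omega1 Q U X Y Yh Z V T) : R :=
  let '(q, u, x, yyz, v, t) := o in
  (pQU (q, u) * pXgU u x * W x yyz * pTgV v t * pVg (u, x, yyz.1.2) v)%R.

(* Main.v *)
Require Import Defs.
From Stdlib Require Import Reals.
From Stdlib Require Lra.
From mathcomp Require Import all_boot all_order all_algebra.
From mathcomp Require Import reals Rstruct.
From mathcomp Require Import ring lra zify.

(** Instead of typical-set codebooks, the proof starts from n i.i.d. copies of the
    joint distribution and random hashes of the sequences Q, U, T, V. By the
    leftover hash lemma, hashes of small rate are nearly uniform and nearly
    independent of the side information; by Slepian-Wolf decoding, Bob recovers
    each sequence from his observation and a hash of large enough rate.

    Hashes that are nearly independent of the other variables may be fixed in
    advance as common randomness, and the encoders then sample from the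
    conditional laws given these values. The remaining hash of (T, V), of rate
    I(V;X,Yh|U,Y), depends on the feedback: it is masked by a uniform shift and
    imposed as a hash value of (Q, U) in the next block, from which Bob recovers
    it. The key of a block is hashed from U and V at rate
    I(U;Y) - max(I(Q;Y), I(V;X,Yh|U,Y)) - I(U;Z|Q) - I(U;T|Q,Z) and
    I(V;Y|U,T) - I(V;Z|U,T), respectively.

    This needs strict inequalities, obtained by perturbing the auxiliary
    variables: Q reveals U with some probability, and (V, T) is erased with some
    probability. Only I(U;Y) = 0 escapes; then I(V;X,Yh|U,Y) = 0, so that the part
    of (X, Yh) that determines the law of V given U is a function of (U, Y)
    known to both users, and a hash of it is a key. *)

Set Implicit Arguments. Unset Strict Implicit. Unset Printing Implicit Defensive.
Import Order.TTheory GRing.Theory Num.Theory.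
Delimit Scope ring_scope with R.
Delimit Scope nat_scope with N.
Local Open Scope ring_scope.

(** * Total variation and random hashing *)

(** [V] exists only after the feedback of its block, so what Bob misses about (V,T) must travel in
    the next block. The hash carried by a block is decoded from that block alone: errors do not
    propagate, and the uniform shift turns the chain of blocks into independent ones.

    Error and secrecy have to be controlled together while the law is being changed. Everything is
    therefore measured in L1 distance, which obeys triangle inequalities; entropies of actual codes
    appear only in the last conversion. The leakage is divided by [n] while [lg #|K|] is linear in
    [n], so deviations need only become small, at no particular speed, and Chebyshev's inequality
    suffices. The number of blocks is fixed first, by the target accuracy, and the block length
    grows afterwards. The key of the last block is lost, since no block carries its bin index.

    Eve is granted [Q^n] and [T^n] in the analysis of the key from [U], and also [U^n] for the key
    from [V]; this is where the conditionings in the rate formula come from. *)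

Section Law.
Variable R : realFieldType.
Implicit Types O T TA TB TC TK TH : finType.

Lemma sum_pair T T' (F : T * T' -> R) : \sum_t F t = \sum_a \sum_b F (a, b).
Proof. by rewrite pair_big; apply: eq_bigr => -[]. Qed.

Definition law O T (P : O -> R) (A : O -> T) (a : T) : R := \sum_(o | A o == a) P o.

Lemma law_ge0 O T (P : O -> R) (A : O -> T) a :
  (forall o, 0 <= P o) -> 0 <= law P A a.
Proof. by move=> hP; apply: sumr_ge0. Qed.

Lemma sum_law O T (P : O -> R) (A : O -> T) (f : T -> R) :
  \sum_a law P A a * f a = \sum_o P o * f (A o).
Proof.
rewrite [RHS](partition_big A predT) //=; apply: eq_bigr => a _.
by rewrite /law mulr_suml; apply: eq_bigr => o /eqP ->.
Qed.

Lemma law_total O T (P : O -> R) (A : O -> T) : \sum_a law P A a = \sum_o P o.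
Proof.
have := sum_law P A (fun=> 1).
rewrite (eq_bigr _ (fun a _ => mulr1 _)) => ->; exact: (eq_bigr _ (fun a _ => mulr1 _)).
Qed.

Lemma eq_law O T (P P' : O -> R) (A A' : O -> T) : P =1 P' -> A =1 A' -> law P A =1 law P' A'.
Proof. by move=> hP hA a; apply: eq_big => [o|o _]; rewrite ?hA ?hP. Qed.

Lemma law_comp O T T' (P : O -> R) (A : O -> T) (phi : T -> T') c :
  law P (phi \o A) c = \sum_(a | phi a == c) law P A a.
Proof.
rewrite /law (partition_big A (fun a => phi a == c)) //=.
apply: eq_bigr => a /eqP hc; apply: eq_bigl => o.
by case: (eqVneq (A o) a) => [->|]; rewrite ?hc ?eqxx ?andbF.
Qed.

Lemma law_fst O T T' (P : O -> R) (A : O -> T) (B : O -> T') b :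
  \sum_a law P (fun o => (A o, B o)) (a, b) = law P B b.
Proof.
rewrite /law [RHS](partition_big A predT) //=; apply: eq_bigr => a _.
by apply: eq_bigl => o; rewrite xpair_eqE andbC.
Qed.

Lemma law_pair_le O T T' (P : O -> R) (A : O -> T) (B : O -> T') a b :
  (forall o, 0 <= P o) -> law P (fun o => (A o, B o)) (a, b) <= law P B b.
Proof.
move=> hP; rewrite -[leRHS](law_fst P A) (bigD1 a) //= lerDl.
by apply: sumr_ge0 => *; apply: law_ge0.
Qed.

Lemma law_push O O' T (P : O -> R) (P' : O' -> R) (h : O' -> O) (A : O -> T) :
  (forall o, law P' h o = P o) -> law P' (A \o h) =1 law P A.
Proof. by move=> hP a; rewrite law_comp; apply: eq_bigr. Qed.

Lemma ler_norm_fiber T T' (phi : T -> T') (x : T -> R) :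
  \sum_c `|\sum_(a | phi a == c) x a| <= \sum_a `|x a|.
Proof.
rewrite [leRHS](partition_big phi predT) //=.
by apply: ler_sum => c _; apply: ler_norm_sum.
Qed.

Lemma law_L1 O T (P P' : O -> R) (A : O -> T) :
  \sum_a `|law P A a - law P' A a| <= \sum_o `|P o - P' o|.
Proof.
apply: le_trans (ler_norm_fiber A (fun o => P o - P' o)).
by rewrite le_eqVlt; apply/orP; left; apply/eqP; apply: eq_bigr => a _; rewrite sumrB.
Qed.

(* Measures at once the secrecy of [K] from [B] and the uniformity of [K]. *)
Definition dev O TK TB (P : O -> R) (K : O -> TK) (B : O -> TB) : R :=
  \sum_k \sum_b `|law P (fun o => (K o, B o)) (k, b) - law P B b / #|TK|%:R|.

Lemma eq_dev O TK TB (P P' : O -> R) (K K' : O -> TK) (B B' : O -> TB) :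
  P =1 P' -> K =1 K' -> B =1 B' -> dev P K B = dev P' K' B'.
Proof.
move=> hP hK hB; apply: eq_bigr => k _; apply: eq_bigr => b _.
congr (`|_ - _ / _|); first by apply: eq_law => // o; rewrite hK hB.
exact: eq_law.
Qed.

Lemma dev_ge0 O TK TB (P : O -> R) (K : O -> TK) (B : O -> TB) : 0 <= dev P K B.
Proof. by apply: sumr_ge0 => k _; apply: sumr_ge0. Qed.

Lemma dev_push O O' TK TB (P : O -> R) (P' : O' -> R) (h : O' -> O)
    (K : O -> TK) (B : O -> TB) :
  (forall o, law P' h o = P o) -> dev P' (K \o h) (B \o h) = dev P K B.
Proof.
move=> hP; apply: eq_bigr => k _; apply: eq_bigr => b _.
rewrite (law_push B hP); congr (`|_ - _ |).
by rewrite -(law_push (fun o => (K o, B o)) hP); apply: eq_law.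
Qed.

Lemma dev_coarse O TK TB TC (P : O -> R) (K : O -> TK) (B : O -> TB) (phi : TB -> TC) :
  dev P K (phi \o B) <= dev P K B.
Proof.
apply: ler_sum => k _.
apply: le_trans (ler_norm_fiber phi _); apply: ler_sum => c _.
rewrite sumrB -mulr_suml law_comp -/(comp _ _).
have -> : law P (fun o => (K o, (phi \o B) o)) (k, c)
   = \sum_(a | phi a == c) law P (fun o => (K o, B o)) (k, a); last by [].
rewrite /law (partition_big B (fun a => phi a == c)) /=; last first.
  by move=> o; rewrite xpair_eqE => /andP[].
apply: eq_bigr => a /eqP hc; apply: eq_bigl => o; rewrite !xpair_eqE.
by case: (eqVneq (B o) a) => [->|]; rewrite ?hc ?eqxx ?andbF ?andbT.
Qed.

Lemma dev_coarse_eq O TK TB TC (P : O -> R) (K : O -> TK) (B : O -> TB) (C : O -> TC)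
    (phi : TB -> TC) : (forall o, C o = phi (B o)) -> dev P K C <= dev P K B.
Proof. by move=> h; rewrite -(eq_dev (P:=P) (K:=K) (B:=phi \o B)) ?dev_coarse // => o; rewrite /= h. Qed.

(** The factor 2 pays for the change of the joint law and for the change of the reference law
    [law P B b / #|TK|%:R]. *)
Lemma dev_L1 O TK TB (P P' : O -> R) (K : O -> TK) (B : O -> TB) :
  (0 < #|TK|)%N ->
  dev P' K B <= dev P K B + 2 * \sum_o `|P o - P' o|.
Proof.
move=> hK.
have h1 : \sum_k \sum_b `|law P (fun o => (K o, B o)) (k, b) - law P' (fun o => (K o, B o)) (k, b)|
   <= \sum_o `|P o - P' o|.
  by rewrite pair_big /=; apply: le_trans (law_L1 _ _ (fun o => (K o, B o))); rewrite (eq_bigr (fun p => `|law P (fun o => (K o, B o)) p - law P' (fun o => (K o, B o)) p|)) // => -[].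
have h2 : \sum_(k : TK) \sum_b `|law P B b / #|TK|%:R - law P' B b / #|TK|%:R|
   <= \sum_o `|P o - P' o|.
  rewrite sumr_const -[_ *+ _]mulr_natl mulr_sumr.
  apply: le_trans (law_L1 _ _ B); apply: ler_sum => b _.
  rewrite -mulrBl normrM [`|_^-1|]ger0_norm ?invr_ge0 ?ler0n // mulrCA mulfV ?mulr1 //.
  by rewrite pnatr_eq0 -lt0n.
rewrite mulr_natl mulr2n; apply: le_trans (lerD (lexx _) (lerD h1 h2)).
rewrite -!big_split /=; apply: ler_sum => k _.
rewrite -!big_split /=; apply: ler_sum => b _.
set a := law _ _ _; set a' := law _ _ (k, b); set c := _ / _; set c' := _ / _.
have -> : a - c = (a' - c') - (a' - a) + (c' - c) by ring.
apply: le_trans (ler_normD _ _) _; rewrite addrA [`|c' - c|]distrC lerD2r.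
by apply: le_trans (ler_normB _ _) _.
Qed.

End Law.

Section Dev.
Variable R : realFieldType.
Implicit Types O T TA TB TC TK TH : finType.

(** Triangle inequality through the hybrid law in which only [K2] has been made uniform. *)
Lemma dev_chain O TA TK TB (P : O -> R) (K1 : O -> TA) (K2 : O -> TK) (B : O -> TB) :
  dev P (fun o => (K1 o, K2 o)) B <=
  dev P K2 (fun o => (K1 o, B o)) + dev P K1 B.
Proof.
rewrite /dev; set r := fun k1 k2 b => law P (fun o => (K2 o, (K1 o, B o))) (k2, (k1, b)).
set q := fun k1 b => law P (fun o => (K1 o, B o)) (k1, b).
have hr k1 k2 b : law P (fun o => ((K1 o, K2 o), B o)) ((k1, k2), b) = r k1 k2 b.
  by apply: eq_bigl => o; rewrite !xpair_eqE andbCA andbA.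
rewrite -(pair_bigA _ (fun k1 k2 => \sum_b `|law P (fun o => ((K1 o, K2 o), B o)) ((k1, k2), b) - law P B b / #|{: TA * TK}|%:R|)) /=.
set N : R := #|TK|%:R; set M : R := #|TA|%:R.
have hNM : #|{: TA * TK}|%:R = M * N :> R by rewrite card_prod natrM.
rewrite [X in _ <= X + _](eq_bigr (fun k2 => \sum_k1 \sum_b `|r k1 k2 b - q k1 b / N|)); last first.
  by move=> k2 _; rewrite -(pair_bigA _ (fun k1 b => `|r k1 k2 b - q k1 b / N|)).
rewrite [X in _ <= X + _]exchange_big /= -big_split /=.
apply: ler_sum => k1 _.
have h k2 b : `|r k1 k2 b - law P B b / (M * N)| <=
   `|r k1 k2 b - q k1 b / N| + `|q k1 b - law P B b / M| / N.
  rewrite -[X in _ <= _ + _ / X]ger0_norm ?ler0n // -normf_div.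
  apply: le_trans (ler_normD _ _); rewrite le_eqVlt; apply/orP; left; apply/eqP.
  by congr (`|_|); rewrite invfM; ring.
apply: (@le_trans _ _ (\sum_k2 \sum_b (`|r k1 k2 b - q k1 b / N| + `|q k1 b - law P B b / M| / N))).
  by apply: ler_sum => k2 _; apply: ler_sum => b _; rewrite hr hNM; exact: h.
rewrite (eq_bigr _ (fun k2 _ => big_split _ _ _ _ _)) big_split /= lerD2l.
rewrite sumr_const -mulr_suml -mulr_natr.
have [->|hk] := eqVneq #|TK| 0%N.
  by rewrite mulr0; apply: sumr_ge0.
by rewrite mulfVK ?pnatr_eq0.
Qed.

(** The reference law, that of [(H, B)] with an independent uniform key, is itself no further from
    uniform on [TK * TH] than the law of [(K, H)] is; hence the factor 2. *)
Lemma dev_cond O TK TH TB (P : O -> R) (K : O -> TK) (H : O -> TH) (B : O -> TB) :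
  (0 < #|TK|)%N ->
  dev P K (fun o => (H o, B o)) <= 2 * dev P (fun o => (K o, H o)) B.
Proof.
move=> hK; rewrite /dev.
set r := fun k h b => law P (fun o => ((K o, H o), B o)) ((k, h), b).
set q := fun h b => law P (fun o => (H o, B o)) (h, b).
set N : R := #|TK|%:R; set M : R := #|TH|%:R.
have hN : N != 0 by rewrite pnatr_eq0 -lt0n.
have hr k h b : law P (fun o => (K o, (H o, B o))) (k, (h, b)) = r k h b.
  by apply: eq_bigl => o; rewrite !xpair_eqE andbA.
have hNM : #|{: TK * TH}|%:R = N * M :> R by rewrite card_prod natrM.
have hq h b : q h b = \sum_k r k h b.
  by rewrite /q -(law_fst P K); apply: eq_bigr => k _; rewrite hr.
rewrite -(pair_bigA _ (fun k h => \sum_b `|law P (fun o => ((K o, H o), B o)) ((k, h), b) - law P B b / #|{: TK * TH}|%:R|)) /=.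
rewrite hNM mulr_natl mulr2n.
set D := (X in _ <= X + _).
have hD : \sum_(k : TK) \sum_h \sum_b `|law P B b / M / N - q h b / N| <= D.
  apply: (@le_trans _ _ (\sum_(k : TK) (N^-1 * D))); last first.
    by rewrite sumr_const -mulr_natl mulrA mulfV // mul1r.
  apply: ler_sum => k _.
  have -> : D = \sum_h \sum_b \sum_k `|r k h b - law P B b / (N * M)|.
    rewrite /D [LHS]exchange_big /=; apply: eq_bigr => h _; exact: exchange_big.
  rewrite mulr_sumr; apply: ler_sum => h _; rewrite mulr_sumr; apply: ler_sum => b _.
  rewrite -mulrBl normrM mulrC [`|_^-1|]ger0_norm ?invr_ge0 ?ler0n //.
  apply: ler_wpM2l; first by rewrite invr_ge0 ler0n.
  rewrite distrC hq; have -> : law P B b / M = \sum_(k : TK) law P B b / (N * M).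
    by rewrite sumr_const -mulr_natl -/N invfM mulrCA [N * _]mulrA mulfV // mul1r.
  by rewrite -sumrB; apply: ler_norm_sum.
apply: le_trans (lerD (lexx _) hD).
rewrite -big_split /=; apply: ler_sum => k _.
rewrite -(pair_bigA _ (fun h b => `|law P (fun o => (K o, (H o, B o))) (k, (h, b)) - law P (fun o => (H o, B o)) (h, b) / N|)) /=.
rewrite -big_split /=; apply: ler_sum => h _.
rewrite -big_split /=; apply: ler_sum => b _.
rewrite hr -/(q h b) -/(r k h b); apply: le_trans (ler_normD _ _).
rewrite le_eqVlt; apply/orP; left; apply/eqP; congr (`|_|).
by rewrite invfM; ring.
Qed.

(** The second layer is hashed against [C], which contains the whole first layer, so the chain rule
    makes all four hashes jointly uniform given [B]. The public ones [H1], [H2] then move to Eve's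
    side by [dev_cond]. *)
Lemma dev_two_layers O TA TA' TK TK' TB TC (P : O -> R) (H1 : O -> TA) (K1 : O -> TK)
    (H2 : O -> TA') (K2 : O -> TK') (B : O -> TB) (C : O -> TC) (phi : TC -> TA * TK * TB) :
  (0 < #|{: TK * TK'}|)%N ->
  (forall o, phi (C o) = (H1 o, K1 o, B o)) ->
  dev P (fun o => (K1 o, K2 o)) (fun o => (H1 o, H2 o, B o)) <=
  2 * (dev P (fun o => (H1 o, K1 o)) B + dev P (fun o => (H2 o, K2 o)) C).
Proof.
move=> hK hphi.
apply: le_trans (dev_cond P (fun o => (K1 o, K2 o)) (fun o => (H1 o, H2 o)) B hK) _.
rewrite ler_pM2l ?ltr0n //.
have -> : dev P (fun o => ((K1 o, K2 o), (H1 o, H2 o))) B =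
          dev P (fun o => ((H1 o, K1 o), (H2 o, K2 o))) B.
  rewrite /dev.
  rewrite (reindex (fun x : (TA * TK) * (TA' * TK') => ((x.1.2, x.2.2), (x.1.1, x.2.1)))) /=; last first.
    by exists (fun x : (TK * TK') * (TA * TA') => ((x.2.1, x.1.1), (x.2.2, x.1.2))) => -[[? ?] [? ?]] _.
  apply: eq_bigr => -[[h1 k1] [h2 k2]] _ /=; apply: eq_bigr => b _.
  congr (`|_ - _ / _|); last by rewrite !card_prod; rewrite mulnACA [(#|TK| * _)%N]mulnC [(#|TK'| * _)%N]mulnC.
  by apply: eq_bigl => o; rewrite !xpair_eqE; do 4! case: (_ == _).
apply: le_trans (dev_chain _ _ _ _) _; rewrite addrC lerD2l.
by apply: (@dev_coarse_eq _ _ _ _ _ P (fun o => (H2 o, K2 o)) C _ (fun c => let '(h, k, b) := phi c in ((h, k), b))) => o; rewrite hphi.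
Qed.

End Dev.

Section Hash.
Variable R : realFieldType.
Implicit Types O T TA TB TC TK TH : finType.

Definition avg T (f : T -> R) : R := (\sum_t f t) / #|T|%:R.

Lemma eq_avg T (f g : T -> R) : f =1 g -> avg f = avg g.
Proof. by move=> h; rewrite /avg (eq_bigr g). Qed.

Lemma avg_le T (f g : T -> R) : (forall t, f t <= g t) -> avg f <= avg g.
Proof. by move=> h; apply: ler_wpM2r; [rewrite invr_ge0 ler0n|apply: ler_sum]. Qed.

Lemma avgD T (f g : T -> R) : avg (fun t => f t + g t) = avg f + avg g.
Proof. by rewrite /avg big_split mulrDl. Qed.

Lemma avgZ T (f : T -> R) c : avg (fun t => c * f t) = c * avg f.
Proof. by rewrite /avg -mulr_sumr mulrA. Qed.

Lemma avg_sum T T' (P : pred T') (f : T -> T' -> R) :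
  avg (fun t => \sum_(i | P i) f t i) = \sum_(i | P i) avg (f^~ i).
Proof. by rewrite /avg exchange_big /= mulr_suml. Qed.

Lemma avg_const T c : (0 < #|T|)%N -> avg (fun _ : T => c) = c.
Proof.
by move=> h; rewrite /avg sumr_const -[c *+ _]mulr_natr mulfK // pnatr_eq0 -lt0n.
Qed.

Lemma exists_le_avg T (f : T -> R) c : (0 < #|T|)%N -> avg f <= c -> exists t, f t <= c.
Proof.
move=> h hc; apply/existsP; apply: contraLR hc; rewrite negb_exists => /forallP hf.
rewrite -ltNge -(avg_const c h) /avg ltr_pM2r ?invr_gt0 ?ltr0n //.
apply: ltr_sum => [|t _]; last by rewrite ltNge hf.
by move/card_gt0P: h => [t _]; apply/hasP; exists t => //; rewrite mem_index_enum.
Qed.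

Lemma avg_prod T T' (f : T -> T' -> R) :
  avg (fun p : T * T' => f p.1 p.2) = avg (fun t => avg (f t)).
Proof.
rewrite /avg -(pair_bigA _ f) /= card_prod natrM invfM.
by rewrite -mulr_suml -mulrA [X in _ * X]mulrC.
Qed.

(** Values of a random function at distinct arguments are independent, and the second-moment
    arguments need only pairs. The uniform law on functions is written as a product over the
    arguments so that the sum factors. *)
Lemma avg_hash2 TA TH (a a' : TA) (phi psi : TH -> R) : (0 < #|TH|)%N -> a != a' ->
  avg (fun h : {ffun TA -> TH} => phi (h a) * psi (h a')) = avg phi * avg psi.
Proof.
move=> hH haa; have haa' : (a' == a) = false by rewrite eq_sym (negbTE haa).
set N : R := #|TH|%:R.
have hN : N != 0 by rewrite pnatr_eq0 -lt0n.
pose F x k : R := (if x == a then phi k else if x == a' then psi k else 1) / N.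
have -> : avg (fun h : {ffun TA -> TH} => phi (h a) * psi (h a')) =
          \sum_(h : {ffun TA -> TH}) \prod_x F x (h x).
  rewrite /avg card_ffun natrX mulr_suml; apply: eq_bigr => h _.
  rewrite /F big_split prodr_const exprVn -/N; congr (_ * _).
  rewrite (bigD1 a) //= eqxx; congr (_ * _).
  rewrite (bigD1 a') ?haa' //= eqxx big1 ?mulr1 // => x /andP[hx hx'].
  by rewrite (negbTE hx) (negbTE hx').
rewrite -(bigA_distr_bigA F) (bigD1 a) //= (bigD1 a') ?haa' //=.
rewrite [X in _ * (_ * X)]big1 ?mulr1; last first.
  move=> x /andP[/negbTE hx /negbTE hx']; rewrite /F hx hx'.
  by rewrite -mulr_suml sumr_const -/N mulfV.
by congr (_ * _); rewrite /avg mulr_suml; apply: eq_bigr => k _; rewrite /F ?haa' eqxx.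
Qed.

Lemma avg_hash1 TA TH (a : TA) (phi : TH -> R) : (0 < #|TH|)%N ->
  avg (fun h : {ffun TA -> TH} => phi (h a)) = avg phi.
Proof.
move=> hH; set N : R := #|TH|%:R.
have hN : N != 0 by rewrite pnatr_eq0 -lt0n.
pose F x k : R := (if x == a then phi k else 1) / N.
have -> : avg (fun h : {ffun TA -> TH} => phi (h a)) =
          \sum_(h : {ffun TA -> TH}) \prod_x F x (h x).
  rewrite /avg card_ffun natrX mulr_suml; apply: eq_bigr => h _.
  rewrite /F big_split prodr_const exprVn -/N; congr (_ * _).
  rewrite (bigD1 a) //= eqxx big1 ?mulr1 // => x hx.
  by rewrite (negbTE hx).
rewrite -(bigA_distr_bigA F) (bigD1 a) //=.
rewrite [X in _ * X]big1 ?mulr1; last first.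
  by move=> x /negbTE hx; rewrite /F hx -mulr_suml sumr_const -/N mulfV.
by rewrite /avg mulr_suml; apply: eq_bigr => k _; rewrite /F eqxx.
Qed.

(** The image of the uniform law is uniform. Thus a single random hash into a product can be read
    through projections, each of which is again a random hash. *)
Definition balanced TH TK (pi : TH -> TK) : Prop :=
  forall k, avg (fun h => (pi h == k)%:R) = (#|TK|%:R)^-1 :> R.

Lemma balanced_fst TH TK : (0 < #|TK|)%N -> balanced (@fst TH TK).
Proof.
move=> hK k; rewrite (avg_prod (fun h _ => (h == k)%:R)) (eq_avg (g := fun h => (h == k)%:R)).
  by rewrite /avg (bigD1 k) //= eqxx big1 ?addr0 ?mul1r // => h hk; rewrite (negbTE hk).
by move=> h; rewrite avg_const.
Qed.

(* Leftover hash lemma: a random hash whose range is small compared with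
   [1/tau] is almost uniform given the side information; [good] marks the pairs of
   conditional probability at most [tau]. *)
Lemma avg_dev_hash O TA TB TH TK (P : O -> R) (A : O -> TA) (B : O -> TB)
    (pi : TH -> TK) (good : TA -> TB -> bool) (tau s : R) :
  (0 < #|TH|)%N -> balanced pi -> (forall o, 0 <= P o) -> \sum_o P o <= 1 ->
  0 <= tau -> 0 < s -> #|TK|%:R * tau <= s ^+ 2 ->
  (forall a b, good a b -> law P (fun o => (A o, B o)) (a, b) <= tau * law P B b) ->
  avg (fun h : {ffun TA -> TH} => dev P (fun o => pi (h (A o))) B) <=
    2 * \sum_(o | ~~ good (A o) (B o)) P o + s.
Proof.
move=> hH hpi hP hP1 htau0 hs htau hgood.
set M : R := #|TK|%:R.
have hM : 0 < M.
  rewrite ltr0n; case/card_gt0P: hH => h _; apply/card_gt0P; by exists (pi h).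
pose p a b := law P (fun o => (A o, B o)) (a, b).
have hp a b : 0 <= p a b by apply: law_ge0.
pose c (h : {ffun TA -> TH}) k a : R := (pi (h a) == k)%:R - M^-1.
(* [X] collects the good values, whose second moment is small; the remaining ones, in [Y], are
   bounded crudely by their total mass. *)
pose X h k b := \sum_(a | good a b) c h k a * p a b.
pose Y (h : {ffun TA -> TH}) k b := \sum_(a | ~~ good a b) ((pi (h a) == k)%:R + M^-1) * p a b.
have hlaw (h : {ffun TA -> TH}) k b : law P (fun o => (pi (h (A o)), B o)) (k, b) = \sum_a (pi (h a) == k)%:R * p a b.
  rewrite [LHS](_ : _ = \sum_(ab | (pi (h ab.1), ab.2) == (k, b)) law P (fun o => (A o, B o)) ab); last first.
    exact: (law_comp P (fun o => (A o, B o)) (fun ab => (pi (h ab.1), ab.2))).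
  rewrite big_mkcond -(pair_bigA _ (fun a b' => if (pi (h a), b') == (k, b) then p a b' else 0)) /=.
  apply: eq_bigr => a _; rewrite (bigD1 b) //= big1 ?addr0; last first.
    by move=> b' hb; rewrite xpair_eqE (negbTE hb) andbF.
  by rewrite xpair_eqE eqxx andbT; case: (_ == _); rewrite ?mul1r ?mul0r.
have hB b : law P B b = \sum_a p a b by rewrite -(law_fst P A).
have hle (h : {ffun TA -> TH}) k b : `|law P (fun o => (pi (h (A o)), B o)) (k, b) - law P B b / M| <= `|X h k b| + Y h k b.
  rewrite hlaw hB mulr_suml -sumrB (bigID (fun a => good a b)) /=.
  apply: le_trans (ler_normD _ _) (lerD _ _).
    by rewrite le_eqVlt; apply/orP; left; apply/eqP; congr (`|_|); apply: eq_bigr => a _; rewrite /c; ring.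
  apply: le_trans (ler_norm_sum _ _ _) _; apply: ler_sum => a _.
  rewrite [p a b / M]mulrC -mulrBl normrM (ger0_norm (hp _ _)); apply: ler_wpM2r => //.
  apply: le_trans (ler_normB _ _) _.
  by rewrite normr_nat [`|M^-1|]ger0_norm // invr_ge0 ltW.
have hY h : \sum_k \sum_b Y h k b <= 2 * \sum_(o | ~~ good (A o) (B o)) P o.
  rewrite exchange_big /=.
  have -> : \sum_(o | ~~ good (A o) (B o)) P o = \sum_b law (fun o => if ~~ good (A o) (B o) then P o else 0) B b.
    by rewrite law_total big_mkcond.
  have -> : 2 * \sum_b law (fun o => if ~~ good (A o) (B o) then P o else 0) B b = \sum_b \sum_(a | ~~ good a b) 2 * p a b.
    rewrite mulr_sumr; apply: eq_bigr => b _; rewrite -mulr_sumr; congr (_ * _).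
    rewrite /law (partition_big A predT) //= [RHS]big_mkcond; apply: eq_bigr => a _.
    rewrite -big_mkcondr /=.
    case: ifPn => hg; last by rewrite big1 // => o /andP[/andP[/eqP hb /eqP ha]]; rewrite ha hb (negbTE hg).
    by rewrite /p /law; apply: eq_bigl => o; rewrite xpair_eqE; case: eqVneq => [->|]; case: eqVneq => [->|]; rewrite ?hg ?andbF.
  apply: ler_sum => b _; rewrite exchange_big /=; apply: ler_sum => a _.
  rewrite -mulr_suml; apply: ler_wpM2r => //.
  rewrite big_split /= sumr_const -[_ *+ _]mulr_natl mulfV ?gt_eqF //.
  by rewrite (bigD1 (pi (h a))) //= eqxx big1 ?addr0 // => k hk; rewrite eq_sym (negbTE hk).
have hX k b : avg (fun h => `|X h k b|) <= s * law P B b / M.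
  have [h0|hb] := eqVneq (law P B b) 0.
    rewrite h0 mulr0 mul0r (eq_avg (g := fun=> 0)) ?avg_const ?card_ffun ?expn_gt0 ?hH // => h.
    rewrite /X big1 ?normr0 // => a _.
    suff -> : p a b = 0 by rewrite mulr0.
    by apply/le_anti; rewrite hp andbT -h0 law_pair_le.
  have hb0 : 0 < law P B b by rewrite lt_neqAle eq_sym hb law_ge0.
  (* Jensen's inequality would call for a square root, which a real field may lack. Instead
     [|x| <= x^2 / (2 cc) + cc / 2] is averaged; the second moment is at most [cc^2] because
     [#|TK| * tau <= s^2], so each half contributes at most [cc / 2]. *)
  pose cc : R := s * law P B b / M.
  have hcc : 0 < cc by rewrite !mulr_gt0 ?invr_gt0.
  have hsq : avg (fun h => X h k b ^+ 2) <= tau * law P B b * law P B b / M.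
    have -> : avg (fun h => X h k b ^+ 2) =
       \sum_(a | good a b) \sum_(a' | good a' b) p a b * p a' b * avg (fun h => c h k a * c h k a').
      under [RHS]eq_bigr do under eq_bigr do rewrite -avgZ.
      under [RHS]eq_bigr do rewrite -avg_sum.
      rewrite -avg_sum; apply: eq_avg => h.
      rewrite /X expr2 mulr_suml; apply: eq_bigr => a _; rewrite mulr_sumr; apply: eq_bigr => a' _.
      by rewrite mulrACA mulrC.
    pose d (k' : TH) : R := (pi k' == k)%:R - M^-1.
    have hd0 : avg d = 0.
      rewrite /d avgD hpi avg_const // -/M subrr //.
    have hd2 : avg (fun k' => d k' * d k') <= M^-1.
      have -> : avg (fun k' => d k' * d k') = avg (fun k' => (pi k' == k)%:R + (- (2 * M^-1) * (pi k' == k)%:R + M^-1 ^+ 2)).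
        by apply: eq_avg => k'; rewrite /d; case: (_ == _); rewrite /=; ring.
      rewrite avgD avgD avgZ hpi avg_const // -/M expr2.
      have : 0 <= M^-1 * M^-1 by rewrite mulr_ge0 // invr_ge0 ltW.
      have -> : - (2 * M^-1) * M^-1 = - (2 * (M^-1 * M^-1)) by ring.
      by lra.
    apply: (@le_trans _ _ (\sum_(a | good a b) p a b * (tau * law P B b) / M)); last first.
      rewrite -mulr_suml -mulr_suml; apply: ler_wpM2r; first by rewrite invr_ge0 ltW.
      rewrite [leRHS]mulrC; apply: ler_wpM2r; first by rewrite mulr_ge0 ?law_ge0.
      by rewrite hB [leRHS](bigID (fun a => good a b)) /= lerDl sumr_ge0.
    (* Off-diagonal terms vanish: distinct arguments have independent centred hash indicators. *)
    apply: ler_sum => a ha; rewrite (bigD1 a) //= big1 ?addr0; last first.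
      move=> a' /andP[_ haa]; rewrite (avg_hash2 d d) ?hd0 ?mulr0 //.
      by rewrite eq_sym.
    rewrite (avg_hash1 a (fun k' => d k' * d k')) // -!mulrA.
    apply: ler_wpM2l => //; apply: (@le_trans _ _ (p a b / M)); first by apply: ler_wpM2l.
    by rewrite mulrA; apply: ler_wpM2r; [rewrite invr_ge0 ltW|apply: hgood].
  apply: (@le_trans _ _ (avg (fun h => (cc^-1 / 2) * X h k b ^+ 2 + cc / 2))).
    apply: avg_le => h; set x := X h k b.
    have : 0 <= (`|x| - cc) ^+ 2 / cc by rewrite mulr_ge0 ?sqr_ge0 ?invr_ge0 ?ltW.
    have -> : (`|x| - cc) ^+ 2 / cc = cc^-1 * x ^+ 2 - 2 * `|x| + cc.
      by rewrite -[x ^+ 2](real_normK (num_real x)); field; rewrite gt_eqF.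
    have -> : cc^-1 / 2 * x ^+ 2 = (cc^-1 * x ^+ 2) / 2 by rewrite mulrAC.
    by lra.
  rewrite avgD avg_const ?card_ffun ?expn_gt0 ?hH // avgZ.
  have h1 : cc^-1 / 2 * avg (fun h => X h k b ^+ 2) <= cc / 2.
    apply: (@le_trans _ _ (cc^-1 / 2 * (tau * law P B b * law P B b / M))).
      by apply: ler_wpM2l => //; rewrite mulr_ge0 // invr_ge0 ?ltW.
    set L := law P B b in hb0 cc hcc hsq *.
    rewrite mulrAC ler_pM2r ?invr_gt0 ?ltr0n // ler_pdivrMl // -expr2.
    have -> : cc ^+ 2 = s ^+ 2 * (L * L / (M * M)) by rewrite /cc; field; rewrite gt_eqF.
    have -> : tau * L * L / M = (M * tau) * (L * L / (M * M)) by field; rewrite gt_eqF.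
    by apply: ler_wpM2r => //; rewrite !mulr_ge0 ?invr_ge0 ?mulr_ge0 ?ltW.
  apply: (@le_trans _ _ (cc / 2 + cc / 2)); first by rewrite lerD2r.
  by rewrite -splitr.
apply: (@le_trans _ _ (avg (fun h => \sum_k \sum_b `|X h k b| + 2 * \sum_(o | ~~ good (A o) (B o)) P o))).
  apply: avg_le => h; apply: le_trans (lerD (lexx _) (hY h)).
  rewrite /dev -big_split; apply: ler_sum => k _; rewrite -big_split; apply: ler_sum => b _.
  by apply: hle.
rewrite avgD avg_const ?card_ffun ?expn_gt0 ?hH // addrC lerD2l.
rewrite avg_sum; apply: (@le_trans _ _ (\sum_(k : TK) \sum_b s * law P B b / M)).
  by apply: ler_sum => k _; rewrite avg_sum; apply: ler_sum => b _.
rewrite sumr_const -mulr_suml -mulr_sumr law_total -[_ *+ _]mulr_natr -/M mulfVK ?gt_eqF //.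
by rewrite -[leRHS]mulr1 ler_pM2l.
Qed.
(* Slepian-Wolf decoding of [A] from [B] and a random hash of [A]. *)
Lemma avg_err_hash O TA TB TH TK (P : O -> R) (A : O -> TA) (B : O -> TB)
    (pi : TH -> TK) (good : TA -> TB -> bool) (tau : R) (a0 : TA) :
  (0 < #|TH|)%N -> balanced pi -> (forall o, 0 <= P o) -> \sum_o P o <= 1 ->
  0 < tau ->
  (forall a b, good a b -> tau * law P B b <= law P (fun o => (A o, B o)) (a, b)) ->
  exists dec : {ffun TA -> TH} -> TB -> TK -> TA,
  avg (fun h : {ffun TA -> TH} => \sum_(o | dec h (B o) (pi (h (A o))) != A o) P o) <=
    \sum_(o | ~~ good (A o) (B o)) P o + (tau * #|TK|%:R)^-1.
Proof.
move=> hH hpi hP hP1 htau hgood.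
(* Bob takes any good candidate with the right hash; [a0] is the value when there is none. *)
pose dec (h : {ffun TA -> TH}) b k := odflt a0 [pick a | good a b & pi (h a) == k].
exists dec.
set M : R := #|TK|%:R.
have hM : 0 < M.
  by rewrite ltr0n; case/card_gt0P: hH => h _; apply/card_gt0P; exists (pi h).
pose cnt (h : {ffun TA -> TH}) o : R := \sum_(a | good a (B o) && (a != A o)) (pi (h a) == pi (h (A o)))%:R.
have hpt (h : {ffun TA -> TH}) : \sum_(o | dec h (B o) (pi (h (A o))) != A o) P o <=
    \sum_(o | ~~ good (A o) (B o)) P o + \sum_o P o * cnt h o.
  rewrite big_mkcond [X in _ <= X + _]big_mkcond -big_split /=; apply: ler_sum => o _.
  have hc : 0 <= cnt h o by apply: sumr_ge0 => a _; rewrite ler0n.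
  have hpc : 0 <= P o * cnt h o by rewrite mulr_ge0.
  case: ifP => hd; last by rewrite addr_ge0 //; case: ifP.
  case: ifPn => hg; first by rewrite lerDl.
  rewrite add0r -[leLHS]mulr1; apply: ler_wpM2l => //.
  move: hd; rewrite /dec; case: pickP => [a /andP[ha /eqP hk]|hn] /=; last first.
    by have := hn (A o); rewrite (negbNE hg) eqxx.
  move=> haA; rewrite /cnt (bigD1 a) ?ha //= hk eqxx lerDl.
  by apply: sumr_ge0 => *; rewrite ler0n.
apply: le_trans (avg_le hpt) _.
rewrite avgD avg_const ?card_ffun ?expn_gt0 ?hH // lerD2l avg_sum.
have hcnt o : avg (fun h => P o * cnt h o) <= P o * \sum_(a | good a (B o)) M^-1.
  rewrite avgZ; apply: ler_wpM2l => //; rewrite avg_sum.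
  rewrite [leRHS](bigID (fun a => a != A o)) /= -[leLHS]addr0 lerD //; last first.
    by apply: sumr_ge0 => *; rewrite invr_ge0 ltW.
  apply: ler_sum => a /andP[_ ha].
  have -> : avg (fun h : {ffun TA -> TH} => (pi (h a) == pi (h (A o)))%:R : R) =
     avg (fun h : {ffun TA -> TH} => \sum_k (pi (h a) == k)%:R * (pi (h (A o)) == k)%:R).
    apply: eq_avg => h; rewrite (bigD1 (pi (h a))) //= eqxx mul1r big1 ?addr0; last first.
      by move=> k hk; rewrite eq_sym (negbTE hk) mul0r.
    by rewrite eq_sym.
  rewrite avg_sum (eq_bigr (fun _ => M^-1 * M^-1)); last first.
    by move=> k _; rewrite (avg_hash2 (fun x => (pi x == k)%:R) (fun x => (pi x == k)%:R)) // hpi.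
  by rewrite sumr_const -[_ *+ _]mulr_natl mulrA mulfV ?gt_eqF // mul1r.
apply: le_trans (ler_sum _ (fun o _ => hcnt o)) _.
apply: (@le_trans _ _ (\sum_o P o * (tau * M)^-1)); last first.
  by rewrite -mulr_suml -[leRHS]mul1r; apply: ler_wpM2r => //; rewrite invr_ge0 mulr_ge0 ?ltW.
(* Given [b], a good [a] has conditional probability at least [tau], so there are at most [1 / tau]
   candidates, each colliding with probability [1 / #|TK|]. *)
rewrite -(sum_law P B (fun b => \sum_(a | good a b) M^-1)) -(sum_law P B (fun _ => (tau * M)^-1)).
apply: ler_sum => b _; rewrite invfM mulrA mulr_sumr.
rewrite -mulr_suml ler_wpM2r ?invr_ge0 ?(ltW hM) //.
rewrite ler_pdivlMr // mulr_suml -(law_fst P A) [leRHS](bigID (fun a => good a b)) /= -[leLHS]addr0 lerD //.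
  by rewrite law_fst; apply: ler_sum => a ha; rewrite mulrC hgood.
by apply: sumr_ge0 => *; apply: law_ge0.
Qed.

(** Replaces Slepian-Wolf decoding for degenerate auxiliary variables, where Bob's observation
    already fixes the sequence and the hash ranges can be singletons. *)
Lemma err_determined O TA TB TH TK (P : O -> R) (A : O -> TA) (B : O -> TB)
    (pi : TH -> TK) (phi : TB -> TA) :
  (forall o, P o != 0 -> A o = phi (B o)) ->
  exists dec : {ffun TA -> TH} -> TB -> TK -> TA,
  avg (fun h : {ffun TA -> TH} => \sum_(o | dec h (B o) (pi (h (A o))) != A o) P o) <= 0.
Proof.
move=> h; exists (fun _ b _ => phi b); rewrite /avg big1 ?mul0r // => g _.
rewrite big1 // => o ho; apply/eqP; apply: contraNT ho => /h ->; exact: eqxx.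
Qed.

Lemma dev_card1 O TK TB (P : O -> R) (K : O -> TK) (B : O -> TB) :
  #|TK| = 1%N -> dev P K B = 0.
Proof.
move=> hK; rewrite /dev; apply: big1 => k _; apply: big1 => b _.
rewrite hK divr1; have -> : law P (fun o => (K o, B o)) (k, b) = law P B b; last by rewrite subrr normr0.
have /card_le1_eqP hK1 : (#|TK| <= 1)%N by rewrite hK.
by apply: eq_bigl => o; rewrite xpair_eqE (hK1 k (K o)) ?eqxx.
Qed.

End Hash.

(** * Memoryless sources *)

Section Iid.
Variable R : realFieldType.
Implicit Types O T TA TB TC TK TH : finType.

Definition iid O (P : O -> R) n (o : {ffun 'I_n -> O}) : R := \prod_i P (o i).

Definition vec O T (A : O -> T) n (o : {ffun 'I_n -> O}) : {ffun 'I_n -> T} :=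
  [ffun i => A (o i)].

Lemma iid_ge0 O (P : O -> R) n o : (forall o, 0 <= P o) -> 0 <= @iid O P n o.
Proof. by move=> hP; apply: prodr_ge0. Qed.

Lemma sum_iid O (P : O -> R) n : \sum_o P o = 1 -> \sum_o @iid O P n o = 1.
Proof.
move=> hP; rewrite /iid -(bigA_distr_bigA (fun i o => P o)).
by apply: big1.
Qed.

Lemma law_iid O T (P : O -> R) (A : O -> T) n a :
  law (@iid O P n) (@vec O T A n) a = iid (law P A) a.
Proof.
rewrite /iid /law bigA_distr_big_dep /=.
apply: eq_bigl => o; apply/eqP/familyP.
  by move=> <- i; rewrite unfold_in ffunE.
by move=> h; apply/ffunP => i; rewrite ffunE; apply/eqP; exact: h i.
Qed.

Lemma law_iid2 O T T' (P : O -> R) (A : O -> T) (B : O -> T') n a b :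
  law (@iid O P n) (fun o => (vec A o, vec B o)) (a, b) =
  \prod_i law P (fun o => (A o, B o)) (a i, b i).
Proof.
have -> : \prod_i law P (fun o => (A o, B o)) (a i, b i) =
          iid (law P (fun o => (A o, B o))) [ffun i => (a i, b i)].
  by apply: eq_bigr => i _; rewrite ffunE.
rewrite -law_iid; apply: eq_bigl => o; rewrite xpair_eqE.
apply/andP/eqP => [[/eqP <- /eqP <-]|h].
  by apply/ffunP => i; rewrite !ffunE.
by split; apply/eqP/ffunP => i; have := congr1 (fun f : {ffun _ -> _} => f i) h; rewrite !ffunE => -[].
Qed.

(** Telescopes through the hybrids [r j], whose first [j] coordinates follow [p] and the others [q];
    consecutive hybrids differ in one coordinate only. *)
Lemma iid_L1 T (p q : T -> R) n : (forall t, 0 <= p t) -> (forall t, 0 <= q t) ->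
  \sum_t p t = 1 -> \sum_t q t = 1 ->
  \sum_f `|@iid T p n f - iid q f| <= n%:R * \sum_t `|p t - q t|.
Proof.
move=> hp hq hp1 hq1.
pose r (j : nat) (i : 'I_n) t := if (i < j)%N then p t else q t.
have hr j i t : 0 <= r j i t by rewrite /r; case: ifP.
have hr1 j i : \sum_t r j i t = 1 by rewrite /r; case: (i < j)%N.
have htel (f : {ffun 'I_n -> T}) : iid p f - iid q f =
   \sum_(j < n) (\prod_i r j.+1 i (f i) - \prod_i r j i (f i)).
  rewrite -(big_mkord xpredT (fun j => \prod_(i < n) r j.+1 i (f i) - \prod_(i < n) r j i (f i))).
  by rewrite telescope_sumr //; congr (_ - _); apply: eq_bigr => i _; rewrite /r ?ltn_ord.
have hterm (j : 'I_n) : \sum_(f : {ffun 'I_n -> T}) `|\prod_i r j.+1 i (f i) - \prod_i r j i (f i)| = \sum_t `|p t - q t|.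
  pose F i t := if i == j then `|p t - q t| else r j i t.
  have -> : \sum_(f : {ffun 'I_n -> T}) `|\prod_i r j.+1 i (f i) - \prod_i r j i (f i)| =
            \sum_(f : {ffun 'I_n -> T}) \prod_i F i (f i).
    apply: eq_bigr => f _; rewrite (bigD1 j) //= [X in `|_ - X|](bigD1 j) //= [RHS](bigD1 j) //=.
    rewrite {1}/r ltnSn {2}/r ltnn {1}/F eqxx.
    have -> : \prod_(i | i != j) r j.+1 i (f i) = \prod_(i | i != j) r j i (f i).
      by apply: eq_bigr => i hi; rewrite /r ltnS leq_eqVlt (negbTE (_ : val i != val j)).
    rewrite -mulrBl normrM; congr (_ * _).
    rewrite ger0_norm ?prodr_ge0 //; apply: eq_bigr => i hi; by rewrite /F (negbTE hi).
  rewrite -(bigA_distr_bigA F) (bigD1 j) //= [X in _ * X]big1 ?mulr1.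
    by apply: eq_bigr => t _; rewrite /F eqxx.
  by move=> i hi; rewrite /F (negbTE hi) hr1.
apply: (@le_trans _ _ (\sum_(f : {ffun 'I_n -> T}) \sum_(j < n) `|\prod_i r j.+1 i (f i) - \prod_i r j i (f i)|)).
  by apply: ler_sum => f _; rewrite htel ler_norm_sum.
rewrite exchange_big /= (eq_bigr _ (fun j _ => hterm j)) sumr_const card_ord.
by rewrite mulr_natl.
Qed.

(** Both the joint law and its reference law are products over the coordinates, so [iid_L1] applies
    on [TK * TB]. *)
Lemma dev_iid O TK TB (P : O -> R) (K : O -> TK) (B : O -> TB) n :
  (forall o, 0 <= P o) -> \sum_o P o = 1 -> (0 < #|TK|)%N ->
  dev (@iid O P n) (@vec _ _ K n) (@vec _ _ B n) <= n%:R * dev P K B.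
Proof.
move=> hP hP1 hK.
pose p (x : TK * TB) := law P (fun o => (K o, B o)) x.
pose q (x : TK * TB) : R := law P B x.2 / #|TK|%:R.
have -> : dev P K B = \sum_x `|p x - q x|.
  by rewrite /dev pair_big; apply: eq_bigr => -[].
have hN : #|TK|%:R != 0 :> R by rewrite pnatr_eq0 -lt0n.
have hp x : 0 <= p x by apply: law_ge0.
have hq x : 0 <= q x by rewrite mulr_ge0 ?law_ge0 ?invr_ge0 ?ler0n.
have hp1 : \sum_x p x = 1 by rewrite law_total.
have hq1 : \sum_x q x = 1.
  rewrite -(pair_bigA _ (fun k b => law P B b / #|TK|%:R)) /= sumr_const -mulr_suml law_total hP1.
  by rewrite mul1r -[_ *+ _]mulr_natl mulfV.
apply: le_trans (iid_L1 n hp hq hp1 hq1).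
pose s (f : {ffun 'I_n -> TK * TB}) := (vec fst f, vec snd f).
pose t (kb : {ffun 'I_n -> TK} * {ffun 'I_n -> TB}) := [ffun i => (kb.1 i, kb.2 i)].
rewrite /dev pair_big (reindex s) /=; last first.
  exists t => [f _|[k b] _].
    by apply/ffunP => i; rewrite !ffunE; case: (f i).
  by congr (_, _); apply/ffunP => i; rewrite !ffunE.
rewrite le_eqVlt; apply/orP; left; apply/eqP; apply: eq_bigr => f _.
congr (`|_ - _|).
  by rewrite law_iid2; apply: eq_bigr => i _; rewrite !ffunE -surjective_pairing.
rewrite law_iid /iid /q /= big_split prodr_const card_ord card_ffun card_ord natrX exprVn.
by congr (_ * _); apply: eq_bigr => i _; rewrite ffunE.
Qed.

Lemma iid_pair O (P : O -> R) n (i j : 'I_n) (phi psi : O -> R) :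
  \sum_o P o = 1 -> i != j ->
  \sum_o @iid O P n o * (phi (o i) * psi (o j)) =
    (\sum_o P o * phi o) * (\sum_o P o * psi o).
Proof.
move=> hP1 hij; have hij' : (j == i) = false by rewrite eq_sym (negbTE hij).
pose F x o := if x == i then P o * phi o else if x == j then P o * psi o else P o.
rewrite (eq_bigr (fun o : {ffun 'I_n -> O} => \prod_x F x (o x))); last first.
  move=> o _; rewrite /iid (bigD1 i) //= (bigD1 j) ?hij' //=.
  rewrite [RHS](bigD1 i) //= [X in _ = _ * X](bigD1 j) ?hij' //= /F !eqxx hij'.
  have -> : \prod_(x | (x != i) && (x != j)) P (o x) = \prod_(x | (x != i) && (x != j)) F x (o x); last by rewrite /F; ring.
  by apply: eq_bigr => x /andP[hx hx']; rewrite /F (negbTE hx) (negbTE hx').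
rewrite -(bigA_distr_bigA F) (bigD1 i) //= (bigD1 j) ?hij' //=.
rewrite [X in _ * (_ * X)]big1 ?mulr1; last first.
  by move=> x /andP[hx hx']; rewrite /F (negbTE hx) (negbTE hx').
by congr (_ * _); rewrite /F ?hij' eqxx.
Qed.

Lemma iid_marg O (P : O -> R) n (i : 'I_n) (phi : O -> R) :
  \sum_o P o = 1 -> \sum_o @iid O P n o * phi (o i) = \sum_o P o * phi o.
Proof.
move=> hP1.
pose F x o := if x == i then P o * phi o else P o.
rewrite (eq_bigr (fun o : {ffun 'I_n -> O} => \prod_x F x (o x))); last first.
  move=> o _; rewrite /iid (bigD1 i) //= [RHS](bigD1 i) //= /F eqxx mulrAC; congr (_ * _).
  by apply: eq_bigr => x hx; rewrite (negbTE hx).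
rewrite -(bigA_distr_bigA F) (bigD1 i) //=.
rewrite [X in _ * X]big1 ?mulr1; last by move=> x hx; rewrite /F (negbTE hx).
by rewrite /F eqxx.
Qed.

(** The lower bound on the sum is asked only at sequences of positive probability, since the
    information densities to which it is applied are meaningful only there. *)
Lemma chebyshev O (P : O -> R) (g : O -> R) n (e : R) (E : pred {ffun 'I_n -> O}) :
  (forall o, 0 <= P o) -> \sum_o P o = 1 -> \sum_o P o * g o = 0 -> 0 < e -> (0 < n)%N ->
  (forall o, E o -> iid P o != 0 -> n%:R * e <= `|\sum_i g (o i)|) ->
  \sum_(o | E o) iid P o <= (\sum_o P o * g o ^+ 2) / (n%:R * e ^+ 2).
Proof.
move=> hP hP1 hg he hn hE.
set S := \sum_o P o * g o ^+ 2.
have hvar : \sum_o @iid O P n o * (\sum_i g (o i)) ^+ 2 = n%:R * S.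
  under eq_bigr => o _.
    rewrite expr2 mulr_suml mulr_sumr.
    under eq_bigr do rewrite mulr_sumr mulr_sumr.
  over.
  rewrite exchange_big /=.
  rewrite (eq_bigr (fun _ => S)); first by rewrite sumr_const card_ord mulr_natl.
  move=> i _; rewrite exchange_big (bigD1 i) //= [X in _ + X]big1 ?addr0; last first.
    by move=> j hj; rewrite iid_pair // 1?eq_sym // hg mul0r.
  by rewrite (iid_marg i (fun o => g o * g o)) //.
have hn0 : 0 < n%:R :> R by rewrite ltr0n.
have hc : 0 < (n%:R * e) ^+ 2 by rewrite exprn_gt0 // mulr_gt0.
have -> : S / (n%:R * e ^+ 2) = n%:R * S / (n%:R * e) ^+ 2.
  by field; rewrite !gt_eqF.
rewrite ler_pdivlMr // -hvar mulr_suml [leRHS](bigID E) /= -[leLHS]addr0 lerD //; last first.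
  by apply: sumr_ge0 => o _; rewrite mulr_ge0 ?sqr_ge0 ?iid_ge0.
apply: ler_sum => o ho; have [->|h0] := eqVneq (iid P o) 0; first by rewrite !mul0r.
apply: ler_wpM2l; first exact: iid_ge0.
rewrite -[leRHS]real_normK ?num_real // ler_pXn2r ?nnegrE ?normr_ge0 //.
  by apply: hE.
by rewrite mulr_ge0 // ltW.
Qed.

End Iid.

(** * Block-Markov coding *)

Section Code.
Variable R : realFieldType.
Variables X Y Yh Z : finType.
Variable W : X -> Y * Yh * Z -> R.

Definition cprob n (Rr : finType) (pr : Rr -> R) (phi : 'I_n -> Rr -> seq Yh -> X)
  (o : Rr * {ffun 'I_n -> Y * Yh * Z}) : R :=
  pr o.1 * \prod_i W (phi i o.1 (fb_hist o.2 i)) (o.2 i).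

(** A secret key code judged by its error [e1] and by a single L1 deviation [e2], which stands for
    leakage and non-uniformity together. *)
Definition tv_code n (K : finType) (e1 e2 : R) : Prop :=
  exists (Rr : finType) (pr : Rr -> R) (phi : 'I_n -> Rr -> seq Yh -> X)
         (psia : Rr -> {ffun 'I_n -> Yh} -> K) (psib : {ffun 'I_n -> Y} -> K),
    [/\ forall r, 0 <= pr r, \sum_r pr r = 1,
        \sum_(o | psia o.1 (Yhseq o.2) != psib (Yseq o.2)) cprob pr phi o <= e1 &
        dev (cprob pr phi) (fun o => psia o.1 (Yhseq o.2)) (fun o => Zseq o.2) <= e2].

End Code.

Section CondLaw.
Variable R : realFieldType.
Variables (T T' : finType) (p : T -> R) (h : T -> T').

(* On a class of probability zero the conditional law defaults to [p]. *)
Definition cond_law (c : T') (t : T) : R :=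
  if law p h c == 0 then p t else p t * (h t == c)%:R / law p h c.

Hypothesis p_ge0 : forall t, 0 <= p t.
Hypothesis p1 : \sum_t p t = 1.

Lemma cond_law_ge0 c t : 0 <= cond_law c t.
Proof.
rewrite /cond_law; case: ifP => // _.
by rewrite !mulr_ge0 ?ler0n ?invr_ge0 ?law_ge0.
Qed.

Lemma cond_law_sum c : \sum_t cond_law c t = 1.
Proof.
rewrite /cond_law; case: eqVneq => // hc.
rewrite -mulr_suml -[X in X / _](_ : law p h c = _) ?divff // /law big_mkcond.
by apply: eq_bigr => t _; case: eqP; rewrite ?mulr1 ?mulr0.
Qed.

(** On a null class both sides vanish because [p] does, so the default in [cond_law] is harmless. *)
Lemma cond_law_mul c t : law p h c * cond_law c t = p t * (h t == c)%:R.
Proof.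
rewrite /cond_law; case: eqVneq => hc; last by rewrite mulrC mulfVK.
rewrite hc mul0r; case: eqP => [ht|_]; last by rewrite mulr0.
rewrite mulr1; apply/esym/le_anti; rewrite p_ge0 andbT -hc /law.
by rewrite (bigD1 t) ?ht //= lerDl sumr_ge0.
Qed.

End CondLaw.

(** * One block: the ideal law and the law of the encoder *)

Section BlockScheme.
Variable R : realFieldType.
Variables X Y Yh Z : finType.
Variable W : X -> Y * Yh * Z -> R.
Variables (S V G F K : finType) (B : finZmodType).
Variables (pS : S -> R) (xw : S -> X) (pV : S -> Yh -> V -> R).
Variables (g : S -> G) (be : S -> B) (f : V -> F) (b : V -> B) (kap : S -> V -> K).
Variables (dec1 : Y -> G -> B) (dec2 : Y -> G -> F -> B -> K).

Definition blaw (o : S * (Y * Yh * Z) * V) : R :=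
  pS o.1.1 * W (xw o.1.1) o.1.2 * pV o.1.1 o.1.2.1.2 o.2.

(* [g] and [f] are hashes agreed upon in advance, [be] is the part of the input
   hash that carries the bin index of the preceding block, [b] is the bin index
   that the next block will carry, and [kap] is the key. *)
Definition block_scheme_spec (d : R) : Prop :=
  [/\ dev pS (fun s => (g s, be s)) (fun _ => tt) <= d,
      dev blaw (fun o => f o.2) (fun o => (o.1.1, o.1.2.1.2)) <= d,
      \sum_(o | dec1 o.1.2.1.1 (g o.1.1) != be o.1.1) blaw o <= d,
      \sum_(o | dec2 o.1.2.1.1 (g o.1.1) (f o.2) (b o.2) != kap o.1.1 o.2) blaw o <= d &
      dev blaw (fun o => kap o.1.1 o.2)
        (fun o => (g o.1.1, be o.1.1, f o.2, b o.2, o.1.2.2)) <= d].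

Hypothesis pS_ge0 : forall s, 0 <= pS s.
Hypothesis pS1 : \sum_s pS s = 1.
Hypothesis W_ge0 : forall x w, 0 <= W x w.
Hypothesis W1 : forall x, \sum_w W x w = 1.
Hypothesis pV_ge0 : forall s y v, 0 <= pV s y v.
Hypothesis pV1 : forall s y, \sum_v pV s y v = 1.

Lemma blaw_ge0 o : 0 <= blaw o.
Proof. by rewrite /blaw !mulr_ge0. Qed.

Let C : finType := (G * B * F)%type.
Let Ob : finType := (S * (Y * Yh * Z) * V)%type.

Definition enc1 (gb : G * B) (s : S) : R := cond_law pS (fun s => (g s, be s)) gb s.
Definition enc2 (s : S) (y : Yh) (c : F) (v : V) : R := cond_law (pV s y) f c v.

(** Here the seed is read off a block sampled without constraint; in [block_real] it is drawn
    uniformly beforehand and the block is sampled to agree with it. The code follows [block_real],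
    the error and secrecy estimates hold for [block_ideal]. *)
Definition block_ideal (t : C * Ob) : R :=
  blaw t.2 * ((g t.2.1.1, be t.2.1.1, f t.2.2) == t.1)%:R.
Definition block_realx (c : C) (o : Ob) : R :=
  enc1 c.1 o.1.1 * W (xw o.1.1) o.1.2 * enc2 o.1.1 o.1.2.1.2 c.2 o.2.
Definition block_real (t : C * Ob) : R := block_realx t.1 t.2 / #|C|%:R.

Hypothesis G_gt0 : (0 < #|G|)%N.
Hypothesis F_gt0 : (0 < #|F|)%N.

Lemma enc1_ge0 gb s : 0 <= enc1 gb s. Proof. exact: cond_law_ge0. Qed.
Lemma enc2_ge0 s y c v : 0 <= enc2 s y c v. Proof. exact: cond_law_ge0. Qed.
Lemma enc1_sum gb : \sum_s enc1 gb s = 1. Proof. exact: cond_law_sum. Qed.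
Lemma enc2_sum s y c : \sum_v enc2 s y c v = 1. Proof. exact: cond_law_sum. Qed.

Lemma block_realx_ge0 c o : 0 <= block_realx c o.
Proof. by rewrite /block_realx !mulr_ge0 ?enc1_ge0 ?enc2_ge0. Qed.

Lemma sum_triple (p : S -> R) (q : S -> Yh -> V -> R) (phi : S -> Yh -> R) :
  (forall s y, \sum_v q s y v = 1) ->
  \sum_(o : Ob) p o.1.1 * W (xw o.1.1) o.1.2 * q o.1.1 o.1.2.1.2 o.2 * phi o.1.1 o.1.2.1.2 =
  \sum_s p s * \sum_w W (xw s) w * phi s w.1.2.
Proof.
move=> hq.
rewrite -(pair_bigA _ (fun sw v => p sw.1 * W (xw sw.1) sw.2 * q sw.1 sw.2.1.2 v * phi sw.1 sw.2.1.2)) /=.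
rewrite -(pair_bigA _ (fun s w => \sum_v p s * W (xw s) w * q s w.1.2 v * phi s w.1.2)) /=.
apply: eq_bigr => s _; rewrite mulr_sumr; apply: eq_bigr => w _.
under eq_bigr do rewrite mulrAC.
by rewrite -mulr_sumr hq mulr1 mulrA.
Qed.

Lemma sum_triple1 (p : S -> R) (q : S -> Yh -> V -> R) :
  (forall s y, \sum_v q s y v = 1) ->
  \sum_(o : Ob) p o.1.1 * W (xw o.1.1) o.1.2 * q o.1.1 o.1.2.1.2 o.2 = \sum_s p s.
Proof.
move=> hq; have := sum_triple p (fun _ _ => 1) hq.
under eq_bigr do rewrite mulr1.
move=> ->; apply: eq_bigr => s _; under eq_bigr do rewrite mulr1.
by rewrite W1 mulr1.
Qed.

Lemma blaw_sum : \sum_o blaw o = 1.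
Proof. by rewrite (sum_triple1 pS pV1). Qed.

Lemma block_realx_sum c : \sum_o block_realx c o = 1.
Proof.
rewrite (sum_triple1 (enc1 c.1) (q := fun s y v => enc2 s y c.2 v)) ?enc1_sum //.
by move=> s y; rewrite enc2_sum.
Qed.

Lemma C_gt0 : (0 < #|C|)%N.
Proof.
rewrite !card_prod !muln_gt0 G_gt0 F_gt0 andbT /=.
by apply/card_gt0P; exists 0.
Qed.

Lemma block_real_sum : \sum_t block_real t = 1.
Proof.
rewrite /block_real -mulr_suml -(pair_bigA _ (fun c o => block_realx c o)) /=.
rewrite (eq_bigr (fun _ => 1)) => [|c _]; last by rewrite block_realx_sum.
by rewrite sumr_const mulfV // pnatr_eq0 -lt0n C_gt0.
Qed.

Lemma block_real_ge0 t : 0 <= block_real t.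
Proof. by rewrite mulr_ge0 ?block_realx_ge0 ?invr_ge0 ?ler0n. Qed.

Lemma block_ideal_ge0 t : 0 <= block_ideal t.
Proof. by rewrite mulr_ge0 ?blaw_ge0 ?ler0n. Qed.

Lemma sum_ideal (phi : C * Ob -> R) :
  \sum_t block_ideal t * phi t = \sum_o blaw o * phi ((g o.1.1, be o.1.1, f o.2), o).
Proof.
rewrite sum_pair exchange_big /=.
apply: eq_bigr => o _; rewrite (bigD1 (g o.1.1, be o.1.1, f o.2)) //= big1 ?addr0.
  by rewrite /block_ideal eqxx mulr1.
by move=> c hc; rewrite /block_ideal /= eq_sym (negbTE hc) mulr0 mul0r.
Qed.

Lemma block_ideal_sum : \sum_t block_ideal t = 1.
Proof.
have := sum_ideal (fun=> 1); under eq_bigr do rewrite mulr1.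
by move=> ->; under eq_bigr do rewrite mulr1; exact: blaw_sum.
Qed.

(** Both laws factor through the same [enc1], [W] and [enc2], hence differ only in the law of the
    seed. Making [f] uniform given the input and the feedback costs [A1], making [(g, be)] uniform
    costs [A2]; the first two clauses of the specification bound each by [d]. *)
Lemma block_ideal_real_L1 d : block_scheme_spec d -> \sum_t `|block_ideal t - block_real t| <= 2 * d.
Proof.
case=> h1 h2 _ _ _.
set MG : R := #|{: G * B}|%:R; set MF : R := #|F|%:R.
have hMG : MG != 0.
  rewrite pnatr_eq0 -lt0n card_prod muln_gt0 G_gt0; by apply/card_gt0P; exists 0.
have hMF : MF != 0 by rewrite pnatr_eq0 -lt0n.
pose q1 gb := law pS (fun s => (g s, be s)) gb.
pose q2 s y c := law (pV s y) f c.
have hq1 gb : 0 <= q1 gb by apply: law_ge0.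
have hI gb c o : block_ideal ((gb, c), o) =
    q1 gb * enc1 gb o.1.1 * W (xw o.1.1) o.1.2 * (q2 o.1.1 o.1.2.1.2 c * enc2 o.1.1 o.1.2.1.2 c o.2).
  rewrite /block_ideal /blaw /= cond_law_mul // cond_law_mul // xpair_eqE.
  by rewrite -mulnb natrM; ring.
pose A1 gb c o := q1 gb * enc1 gb o.1.1 * W (xw o.1.1) o.1.2 * enc2 o.1.1 o.1.2.1.2 c o.2 * `|q2 o.1.1 o.1.2.1.2 c - MF^-1|.
pose A2 gb c o := `|q1 gb - MG^-1| / MF * (enc1 gb o.1.1 * W (xw o.1.1) o.1.2 * enc2 o.1.1 o.1.2.1.2 c o.2).
have hle gb c o : `|block_ideal ((gb, c), o) - block_real ((gb, c), o)| <= A1 gb c o + A2 gb c o.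
  rewrite hI /block_real /block_realx /A1 /A2 /= card_prod natrM -/MG -/MF.
  set e1 := enc1 _ _; set e2 := enc2 _ _ _ _; set ww := W _ _; set qq := q2 _ _ _.
  have he : 0 <= e1 * ww * e2 by exact: (block_realx_ge0 (gb, c) o).
  have -> : q1 gb * e1 * ww * (qq * e2) - e1 * ww * e2 / (MG * MF) =
     (e1 * ww * e2) * (q1 gb * (qq - MF^-1) + (q1 gb - MG^-1) / MF) by rewrite invfM; ring.
  rewrite normrM (ger0_norm he).
  have -> : q1 gb * e1 * ww * e2 * `|qq - MF^-1| + `|q1 gb - MG^-1| / MF * (e1 * ww * e2) =
     (e1 * ww * e2) * (q1 gb * `|qq - MF^-1| + `|q1 gb - MG^-1| / MF) by ring.
  apply: ler_wpM2l => //; apply: le_trans (ler_normD _ _) _.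
  by rewrite !normrM (ger0_norm (hq1 gb)) [`|MF^-1|]ger0_norm ?invr_ge0 ?ler0n.
apply: (@le_trans _ _ (\sum_gb \sum_c \sum_o (A1 gb c o + A2 gb c o))).
  rewrite -(pair_bigA _ (fun gbc o => `|block_ideal (gbc, o) - block_real (gbc, o)|)) /=.
  rewrite -(pair_bigA _ (fun gb c => \sum_o `|block_ideal ((gb, c), o) - block_real ((gb, c), o)|)) /=.
  by do 3! (apply: ler_sum => ? _).
have hA2 : \sum_gb \sum_c \sum_o A2 gb c o <= d.
  apply: le_trans h1.
  rewrite /dev le_eqVlt; apply/orP; left; apply/eqP; apply: eq_bigr => gb _.
  rewrite (bigD1 tt) //= [X in _ = _ + X]big1 ?addr0; last by case.
  rewrite (eq_bigr (fun _ => `|q1 gb - MG^-1| / MF)); last first.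
    move=> c _; rewrite -mulr_sumr.
    rewrite (sum_triple1 (enc1 gb) (q := fun s y v => enc2 s y c v)) ?enc1_sum ?mulr1 //.
    by move=> s y; rewrite enc2_sum.
  rewrite sumr_const -[_ *+ _]mulr_natr -/MF mulfVK //; congr (`|_ - _|).
    by rewrite /q1 /law; apply: eq_bigl => s; rewrite xpair_eqE andbT.
  by rewrite /law (eq_bigl xpredT) ?pS1 ?mul1r // => s; rewrite eqxx.
have hA1 : \sum_gb \sum_c \sum_o A1 gb c o <= d.
  apply: le_trans h2; rewrite exchange_big /= /dev; apply: ler_sum => c _.
  rewrite /A1 [leRHS]sum_pair.
  rewrite (eq_bigr (fun gb => \sum_s (q1 gb * enc1 gb s) * \sum_w W (xw s) w * `|q2 s w.1.2 c - MF^-1|)); last first.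
    move=> gb _; apply: (sum_triple (fun s => q1 gb * enc1 gb s) (q := fun s y v => enc2 s y c v) (fun s y => `|q2 s y c - MF^-1|)).
    by move=> s y; rewrite enc2_sum.
  rewrite exchange_big /= le_eqVlt; apply/orP; left; apply/eqP; apply: eq_bigr => s _.
  rewrite -mulr_suml (eq_bigr (fun gb => pS s * ((g s, be s) == gb)%:R)); last first.
    by move=> gb _; rewrite cond_law_mul.
  rewrite (bigD1 (g s, be s)) //= eqxx mulr1 big1 ?addr0; last first.
    by move=> gb hgb; rewrite eq_sym (negbTE hgb) mulr0.
  rewrite mulr_sumr (partition_big (fun w : Y * Yh * Z => w.1.2) predT) //=; apply: eq_bigr => y _.
  have -> : law blaw (fun o => (f o.2, (o.1.1, o.1.2.1.2))) (c, (s, y)) =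
            \sum_(w | w.1.2 == y) pS s * W (xw s) w * q2 s y c.
    rewrite /law big_mkcond sum_pair sum_pair (bigD1 s) //= [X in _ + X]big1 ?addr0; last first.
      move=> s' hs'; rewrite big1 // => w _; rewrite big1 // => v _.
      by rewrite !xpair_eqE (negbTE hs') andbF.
    rewrite [RHS]big_mkcond; apply: eq_bigr => w _.
    case: eqP => [hw|hw]; last first.
      by rewrite big1 // => v _; rewrite !xpair_eqE (negbTE (introN eqP hw)) !andbF.
    rewrite /q2 /law mulr_sumr [RHS]big_mkcond; apply: eq_bigr => v _.
    by rewrite !xpair_eqE hw !eqxx !andbT /blaw /= hw.
  have -> : law blaw (fun o => (o.1.1, o.1.2.1.2)) (s, y) = \sum_(w | w.1.2 == y) pS s * W (xw s) w.
    rewrite /law big_mkcond sum_pair sum_pair (bigD1 s) //= [X in _ + X]big1 ?addr0; last first.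
      move=> s' hs'; rewrite big1 // => w _; rewrite big1 // => v _.
      by rewrite !xpair_eqE (negbTE hs').
    rewrite [RHS]big_mkcond; apply: eq_bigr => w _.
    have [hw|hw] := eqVneq w.1.2 y; last first.
      by rewrite big1 // => v _; rewrite !xpair_eqE (negbTE hw) andbF.
    rewrite -[pS s * W _ _]mulr1 -(pV1 s y) mulr_sumr; apply: eq_bigr => v _.
    by rewrite !xpair_eqE hw !eqxx /blaw /= hw.
  rewrite -mulr_suml -/MF -mulrBr normrM ger0_norm ?sumr_ge0 //; last by move=> *; rewrite mulr_ge0.
  by rewrite mulr_suml; apply: eq_bigr => w /eqP ->; rewrite mulrA.
rewrite mulr_natl mulr2n; apply: le_trans (lerD hA1 hA2).
rewrite -big_split; apply: ler_sum => gb _; rewrite -big_split; apply: ler_sum => c _.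
by rewrite -big_split.
Qed.

End BlockScheme.

Lemma sum_ffun_prod1 (R : realFieldType) (A T : finType) (p : A -> T -> R) :
  (forall a, \sum_t p a t = 1) -> \sum_(f : {ffun A -> T}) \prod_a p a (f a) = 1.
Proof. by move=> hp; rewrite -(bigA_distr_bigA p); apply: big1. Qed.

Lemma sum_ffun_point (R : realFieldType) (A T : finType) (p : A -> T -> R) a0 t0 :
  (forall a, \sum_t p a t = 1) ->
  \sum_(f : {ffun A -> T} | f a0 == t0) \prod_a p a (f a) = p a0 t0.
Proof.
move=> hp.
pose F a t := if a == a0 then (if t == t0 then p a t else 0) else p a t.
transitivity (\sum_(f : {ffun A -> T}) \prod_a F a (f a)).
  rewrite big_mkcond; apply: eq_bigr => f _.
  rewrite (bigD1 a0) //= [RHS](bigD1 a0) //= {1}/F eqxx.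
  have -> : \prod_(i | i != a0) F i (f i) = \prod_(i | i != a0) p i (f i).
    by apply: eq_bigr => i hi; rewrite /F (negbTE hi).
  by case: ifP; rewrite ?mul0r.
rewrite -(bigA_distr_bigA F) (bigD1 a0) //= [X in _ * X]big1 ?mulr1; last first.
  by move=> a ha; rewrite /F (negbTE ha) hp.
rewrite /F eqxx (bigD1 t0) //= eqxx big1 ?addr0 // => t ht; by rewrite (negbTE ht).
Qed.

(** * Simulating stochastic encoders by local randomness *)

Section Simulation.
Variable R : realFieldType.
Variables X Y Yh Z : finType.
Variable W : X -> Y * Yh * Z -> R.
Variables (S V B : finType) (m : nat).
Local Notation M := m.+1.
Let Ob : finType := (S * (Y * Yh * Z) * V)%type.
Variables (xw : S -> X) (e1 : 'I_M -> B -> S -> R) (e2 : 'I_M -> S -> Yh -> V -> R).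
Variables (b0 : B) (nx : 'I_M -> V -> B) (y0 : Yh).
Hypothesis e1_ge0 : forall j b s, 0 <= e1 j b s.
Hypothesis e2_ge0 : forall j s y v, 0 <= e2 j s y v.
Hypothesis e1_sum : forall j b, \sum_s e1 j b s = 1.
Hypothesis e2_sum : forall j s y, \sum_v e2 j s y v = 1.

Definition prev_state (o : {ffun 'I_M -> Ob}) (j : 'I_M) : B :=
  if val j is j'.+1 then nx j (o (inord j')).2 else b0.

Definition chain_law (o : {ffun 'I_M -> Ob}) : R :=
  \prod_j (e1 j (prev_state o j) (o j).1.1 * W (xw (o j).1.1) (o j).1.2 *
           e2 j (o j).1.1 (o j).1.2.1.2 (o j).2).

(* Local randomness: for each block, one sample for every argument of the two
   stochastic encoders. *)
Let Rr : finType := {ffun 'I_M -> {ffun B -> S} * {ffun S * Yh -> V}}.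

Definition rand_law (r : Rr) : R :=
  \prod_j (\prod_c e1 j c ((r j).1 c) * \prod_sy e2 j sy.1 sy.2 ((r j).2 sy)).

(** The feedback is a function on [nat], so that one recursion serves both the causal encoder, which
    pads a partial history with [y0], and the key map, which sees the whole feedback. *)
Fixpoint bstate (r : Rr) (yh : nat -> Yh) (j : nat) : B :=
  if j is j'.+1 then
    nx (inord j) ((r (inord j')).2 ((r (inord j')).1 (bstate r yh j'), yh j'))
  else b0.

Definition sstate (r : Rr) (yh : nat -> Yh) (j : nat) : S := (r (inord j)).1 (bstate r yh j).
Definition vstate (r : Rr) (yh : nat -> Yh) (j : nat) : V := (r (inord j)).2 (sstate r yh j, yh j).

Lemma bstateS r yh j : bstate r yh j.+1 = nx (inord j.+1) (vstate r yh j).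
Proof. by []. Qed.

Lemma eq_bstate r yh yh' j : (forall k, (k < j)%N -> yh k = yh' k) ->
  bstate r yh j = bstate r yh' j.
Proof.
elim: j => //= j IH h; rewrite IH ?h // => k hk.
by apply: h; apply: ltnW.
Qed.

Definition block_phi (j : 'I_M) (r : Rr) (hist : seq Yh) : X := xw (sstate r (nth y0 hist) j).

Definition ext_ffun (y : {ffun 'I_M -> Yh}) (k : nat) : Yh := y (inord k).

Definition block_traj (o : Rr * {ffun 'I_M -> Y * Yh * Z}) : {ffun 'I_M -> Ob} :=
  [ffun j : 'I_M => (sstate o.1 (ext_ffun (Yhseq o.2)) j, o.2 j, vstate o.1 (ext_ffun (Yhseq o.2)) j)].

(** Causality: the state of block [j] depends only on feedback from blocks before [j], so the
    padding [y0] is never read. *)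
Lemma block_phiE (j : 'I_M) r (w : {ffun 'I_M -> Y * Yh * Z}) :
  block_phi j r (fb_hist w j) = xw (sstate r (ext_ffun (Yhseq w)) j).
Proof.
rewrite /block_phi /sstate; congr (xw ((r _).1 _)); apply: eq_bstate => k hk.
have hkM : (k < M)%N by apply: ltn_trans hk (ltn_ord j).
rewrite /fb_hist nth_take // (nth_map j) ?size_enum_ord // /ext_ffun /Yhseq ffunE.
by congr ((w _).1.2); apply: val_inj; rewrite /= inordK // nth_enum_ord.
Qed.

(** Turns the event into one look-up per table, at arguments prescribed by [o]. The induction [key]
    is needed because the actual arguments are computed from the earlier blocks. *)
Lemma block_traj_eq r w (o : {ffun 'I_M -> Ob}) :
  (block_traj (r, w) == o) =
  (w == [ffun j => (o j).1.2]) &&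
  [forall j, ((r j).1 (prev_state o j) == (o j).1.1) &&
             ((r j).2 ((o j).1.1, (o j).1.2.1.2) == (o j).2)].
Proof.
have inordv (j : 'I_M) : inord (val j) = j by apply: val_inj; rewrite /= inordK.
apply/eqP/andP => [h|[/eqP hw /forallP h]].
  have hj j : o j = (sstate r (ext_ffun (Yhseq w)) j, w j, vstate r (ext_ffun (Yhseq w)) j).
    by rewrite -h ffunE.
  split; first by apply/eqP/ffunP => j; rewrite ffunE hj.
  apply/forallP => j.
  have hb : prev_state o j = bstate r (ext_ffun (Yhseq w)) j.
    rewrite /prev_state /=; have := inordv j; have := ltn_ord j; rewrite /=.
    case: (nat_of_ord j) => [//|j'] hlt hj'.
    rewrite bstateS hj' hj /= inordK //; exact: ltnW.
  rewrite hb hj /=; apply/andP; split; apply/eqP.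
    by rewrite /sstate inordv.
  rewrite /vstate inordv; congr ((r j).2 (_, _)).
  by rewrite /ext_ffun /Yhseq ffunE inordv.
have key k (hk : (k < M)%N) : bstate r (ext_ffun (Yhseq w)) k = prev_state o (inord k) /\
    sstate r (ext_ffun (Yhseq w)) k = (o (inord k)).1.1 /\
    vstate r (ext_ffun (Yhseq w)) k = (o (inord k)).2.
  elim: k hk => [|k IH] hk.
    have hb : bstate r (ext_ffun (Yhseq w)) 0 = prev_state o (inord 0).
      by rewrite /prev_state /= inordK.
    have /andP[/eqP h1 /eqP h2] := h (inord 0).
    have hs : sstate r (ext_ffun (Yhseq w)) 0 = (o (inord 0)).1.1 by rewrite /sstate hb.
    split=> //; split=> //; rewrite /vstate hs -h2; congr (_ (_, _)).
    by rewrite /ext_ffun /Yhseq hw !ffunE.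
  have [_ [_ hv]] := IH (ltnW hk).
  have hb : bstate r (ext_ffun (Yhseq w)) k.+1 = prev_state o (inord k.+1).
    by rewrite bstateS hv /prev_state /= inordK.
  have /andP[/eqP h1 /eqP h2] := h (inord k.+1).
  have hs : sstate r (ext_ffun (Yhseq w)) k.+1 = (o (inord k.+1)).1.1 by rewrite /sstate hb.
  split=> //; split=> //; rewrite /vstate hs -h2; congr (_ (_, _)).
  by rewrite /ext_ffun /Yhseq hw !ffunE.
apply/ffunP => j; rewrite ffunE.
have [_ [hs hv]] := key _ (ltn_ord j); rewrite inordv in hs hv.
by rewrite hs hv hw ffunE; case: (o j) => [[]].
Qed.

Lemma rand_law_ge0 r : 0 <= rand_law r.
Proof. by apply: prodr_ge0 => j _; apply: mulr_ge0; apply: prodr_ge0. Qed.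

Lemma rand_law_sum : \sum_r rand_law r = 1.
Proof.
rewrite /rand_law -(bigA_distr_bigA (fun j (r : {ffun B -> S} * {ffun S * Yh -> V}) =>
  \prod_c e1 j c (r.1 c) * \prod_sy e2 j sy.1 sy.2 (r.2 sy))).
apply: big1 => j _; rewrite sum_pair /=.
under eq_bigr do rewrite -mulr_sumr.
rewrite -mulr_suml sum_ffun_prod1 // (sum_ffun_prod1 (p := fun sy => e2 j sy.1 sy.2)) ?mulr1 //.
Qed.

(** Along a fixed trajectory each table is read at exactly one argument, so summing out the unread
    entries leaves the factors of [chain_law]. *)
Lemma law_block_traj o : law (cprob W rand_law block_phi) block_traj o = chain_law o.
Proof.
rewrite /law big_mkcond sum_pair exchange_big /=.
rewrite (bigD1 [ffun j => (o j).1.2]) //= [X in _ + X]big1 ?addr0; last first.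
  by move=> w hw; rewrite big1 // => r _; rewrite block_traj_eq (negbTE hw).
pose Q (r : Rr) := [forall j, ((r j).1 (prev_state o j) == (o j).1.1) &&
             ((r j).2 ((o j).1.1, (o j).1.2.1.2) == (o j).2)].
transitivity (\sum_(r | Q r) rand_law r * \prod_j W (xw (o j).1.1) (o j).1.2).
  rewrite [RHS]big_mkcond; apply: eq_bigr => r _; rewrite block_traj_eq eqxx /= -/(Q r).
  case: ifP => // hq; rewrite /cprob /=; congr (_ * _); apply: eq_bigr => j _.
  rewrite block_phiE ffunE; congr (W (xw _) _).
  have /eqP : block_traj (r, [ffun j => (o j).1.2]) == o by rewrite block_traj_eq eqxx.
  by move/ffunP/(_ j); rewrite ffunE => <-.
rewrite -mulr_suml /chain_law.
under [RHS]eq_bigr do rewrite mulrAC.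
rewrite [RHS]big_split; congr (_ * _).
pose Fj j (r : {ffun B -> S} * {ffun S * Yh -> V}) : R :=
  \prod_c e1 j c (r.1 c) * \prod_sy e2 j sy.1 sy.2 (r.2 sy).
have -> : \sum_(r | Q r) rand_law r =
  \prod_j \sum_(r : {ffun B -> S} * {ffun S * Yh -> V} |
     (r.1 (prev_state o j) == (o j).1.1) && (r.2 ((o j).1.1, (o j).1.2.1.2) == (o j).2)) Fj j r.
  rewrite bigA_distr_big_dep; apply: eq_bigl => r; rewrite /Q.
  by apply/forallP/familyP => h j; have := h j; rewrite unfold_in.
apply: eq_bigr => j _.
rewrite big_mkcond sum_pair /Fj /=.
under eq_bigr => r1 _.
  rewrite -big_mkcond /=.
  over.
rewrite (eq_bigr (fun r1 : {ffun B -> S} => if r1 (prev_state o j) == (o j).1.1 then \prod_c e1 j c (r1 c) * e2 j (o j).1.1 (o j).1.2.1.2 (o j).2 else 0)); last first.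
  move=> r1 _; case: ifP => hr; last by rewrite big1.
  by rewrite -mulr_sumr (sum_ffun_point (p := fun sy => e2 j sy.1 sy.2)).
by rewrite -big_mkcond -mulr_suml sum_ffun_point.
Qed.

End Simulation.

Section Aux.
Variable R : realFieldType.
Implicit Types C O T TA TB TC TK TH : finType.

Lemma dev_balanced O TK TH TB (P : O -> R) (K : O -> TH) (B : O -> TB) (pi : TH -> TK) :
  balanced R pi -> dev P (pi \o K) B <= dev P K B.
Proof.
move=> hpi; rewrite /dev exchange_big [leRHS]exchange_big /=; apply: ler_sum => b _.
apply: le_trans (ler_norm_fiber pi _); apply: ler_sum => k _.
rewrite sumrB le_eqVlt; apply/orP; left; apply/eqP; congr (`|_ - _|).
  rewrite /law (partition_big K (fun h => pi h == k)) /=; last first.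
    by move=> o; rewrite xpair_eqE => /andP[].
  apply: eq_bigr => h /eqP hk; apply: eq_bigl => o; rewrite !xpair_eqE.
  by case: (eqVneq (K o) h) => [->|]; rewrite ?hk ?eqxx ?andbF ?andbT.
rewrite -(hpi k) /avg mulrA -mulr_suml mulr_sumr; congr (_ / _).
by rewrite [RHS]big_mkcond; apply: eq_bigr => h _; case: ifP; rewrite ?mulr1 ?mulr0.
Qed.

Definition drop_last (K : Type) n (k : {ffun 'I_n.+1 -> K}) : {ffun 'I_n -> K} :=
  [ffun j => k (lift ord_max j)].

Definition rcons_ffun (K : Type) n (p : {ffun 'I_n -> K} * K) : {ffun 'I_n.+1 -> K} :=
  [ffun i => oapp p.1 p.2 (unlift ord_max i)].

Lemma drop_last_rcons (K : Type) n (p : {ffun 'I_n -> K} * K) :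
  drop_last (rcons_ffun p) = p.1.
Proof. by apply/ffunP => j; rewrite !ffunE liftK. Qed.

Lemma rcons_ffun_bij (K : Type) n : bijective (@rcons_ffun K n).
Proof.
exists (fun k => (drop_last k, k ord_max)) => [[k x]|k].
  by rewrite drop_last_rcons ffunE unlift_none.
by apply/ffunP => i; rewrite !ffunE; case: unliftP => [j ->|->] //=; rewrite ffunE.
Qed.

Lemma balanced_drop_last (K : finType) n : (0 < #|K|)%N -> balanced R (@drop_last K n).
Proof.
move=> hK k'.
rewrite /avg (reindex (@rcons_ffun K n)) /=; last exact/onW_bij/rcons_ffun_bij.
have -> : #|{: {ffun 'I_n.+1 -> K}}|%:R = #|{: {ffun 'I_n -> K} * K}|%:R :> R.
  by congr (_%:R); rewrite (bij_eq_card (@rcons_ffun_bij K n)).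
rewrite -(balanced_fst _ hK k') /avg; congr (_ / _).
by apply: eq_bigr => p _; rewrite drop_last_rcons.
Qed.

(** When a uniform seed is part of Eve's view, the deviation is the average over the seeds; this is
    what allows a good seed to be selected. *)
Lemma dev_mix C O TK TB (P : C -> O -> R) (K : O -> TK) (B : O -> TB) :
  dev (fun p : C * O => P p.1 p.2 / #|C|%:R) (fun p => K p.2) (fun p => (p.1, B p.2)) =
  avg (fun c => dev (P c) K B).
Proof.
rewrite /avg /dev mulr_suml exchange_big sum_pair /=; apply: eq_bigr => c _.
rewrite exchange_big mulr_suml; apply: eq_bigr => k _; rewrite mulr_suml; apply: eq_bigr => b _.
rewrite -[X in _ = _ * X]ger0_norm ?invr_ge0 ?ler0n // -normrM mulrBl.
have hl T (A : O -> T) a : law (fun p : C * O => P p.1 p.2 / #|C|%:R) (fun p => (p.1, A p.2)) (c, a) = law (P c) A a / #|C|%:R.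
  rewrite /law big_mkcond sum_pair (bigD1 c) //= [X in _ + X]big1 ?addr0; last first.
    by move=> c' hc; rewrite big1 // => o _; rewrite xpair_eqE (negbTE hc).
  by rewrite mulr_suml [RHS]big_mkcond; apply: eq_bigr => o _; rewrite xpair_eqE eqxx.
congr (`|_ - _|).
  rewrite -hl; apply: eq_bigl => p; rewrite !xpair_eqE; by rewrite andbCA.
by rewrite hl mulrAC.
Qed.

Lemma err_le_L1 O (P P' : O -> R) (E : pred O) :
  \sum_(o | E o) P' o <= \sum_(o | E o) P o + \sum_o `|P o - P' o|.
Proof.
rewrite [X in _ + X](bigID E) /= addrA -big_split /= -[leLHS]addr0 lerD ?sumr_ge0 //.
apply: ler_sum => o _; rewrite distrC -lerBlDl; exact: ler_norm.
Qed.

Lemma err_le_union O (P : O -> R) n (I : 'I_n -> pred O) (E : pred O) :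
  (forall o, 0 <= P o) -> (forall o, E o -> [exists j, I j o]) ->
  \sum_(o | E o) P o <= \sum_j \sum_(o | I j o) P o.
Proof.
move=> hP hE; rewrite big_mkcond; under [leRHS]eq_bigr do rewrite big_mkcond.
rewrite exchange_big /=; apply: ler_sum => o _.
case: ifPn => hE'; last by apply: sumr_ge0 => j _; case: ifP.
have /existsP[j hj] := hE o hE'.
by rewrite (bigD1 j) //= hj lerDl; apply: sumr_ge0 => i _; case: ifP.
Qed.

Lemma iid_marg_pred O (P : O -> R) n (i : 'I_n) (E : pred O) :
  \sum_o P o = 1 -> \sum_(o : {ffun 'I_n -> O} | E (o i)) iid P o = \sum_(o | E o) P o.
Proof.
move=> hP; rewrite big_mkcond [RHS]big_mkcond.
have := iid_marg i (fun o => (E o)%:R) hP.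
rewrite (eq_bigr (fun o : {ffun 'I_n -> O} => if E (o i) then iid P o else 0)) => [->|o _].
  by apply: eq_bigr => o _; case: ifP; rewrite ?mulr1 ?mulr0.
by case: ifP; rewrite ?mulr1 ?mulr0.
Qed.

End Aux.

(** * Chaining the blocks with masked bin indices *)

Section BlockCode.
Variable R : realFieldType.
Variables X Y Yh Z : finType.
Variable W : X -> Y * Yh * Z -> R.
Variables (S V G F K : finType) (B : finZmodType).
Variables (pS : S -> R) (xw : S -> X) (pV : S -> Yh -> V -> R).
Variables (g : S -> G) (be : S -> B) (f : V -> F) (b : V -> B) (kap : S -> V -> K).
Variables (dec1 : Y -> G -> B) (dec2 : Y -> G -> F -> B -> K).
Variables (m : nat) (y0 : Yh).
Local Notation M := m.+1.
Let C : finType := (G * B * F)%type.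
Let Ob : finType := (S * (Y * Yh * Z) * V)%type.

Hypothesis pS_ge0 : forall s, 0 <= pS s.
Hypothesis pS1 : \sum_s pS s = 1.
Hypothesis W_ge0 : forall x w, 0 <= W x w.
Hypothesis W1 : forall x, \sum_w W x w = 1.
Hypothesis pV_ge0 : forall s y v, 0 <= pV s y v.
Hypothesis pV1 : forall s y, \sum_v pV s y v = 1.
Hypothesis G_gt0 : (0 < #|G|)%N.
Hypothesis F_gt0 : (0 < #|F|)%N.
Hypothesis K_gt0 : (0 < #|K|)%N.

Definition prev_bin (o : {ffun 'I_M -> Ob}) (j : 'I_M) : B :=
  if val j is j'.+1 then b (o (inord j')).2 else 0.

Local Notation Cm := {ffun 'I_M -> C}.

(** In the seed [c j], the part [.1.1] prescribes [g], [.1.2] is the shift masking the incoming bin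
    index, and [.2] prescribes [f]. *)
Definition blk_e1 (c : Cm) (j : 'I_M) (st : B) (s : S) : R := enc1 pS g be ((c j).1.1, st) s.
Definition blk_e2 (c : Cm) (j : 'I_M) (s : S) (y : Yh) (v : V) : R := enc2 pV f s y (c j).2 v.
Definition blk_nx (c : Cm) (j : 'I_M) (v : V) : B := (c j).1.2 + b v.

Definition code_law (c : Cm) : {ffun 'I_M -> Ob} -> R :=
  chain_law W xw (blk_e1 c) (blk_e2 c) (c ord0).1.2 (blk_nx c).

(** No block carries the bin index of the last one, so its key is given up: [m.+1] blocks yield [m]
    keys. *)
Definition keyA (o : {ffun 'I_M -> Ob}) : {ffun 'I_m -> K} :=
  drop_last [ffun j => kap (o j).1.1 (o j).2].

(** [lift ord_max j] is block [j] and [lift ord0 j] is block [j + 1], whose decoded hash minus the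
    public shift is the bin index of block [j]. *)
Definition keyB (c : Cm) (y : {ffun 'I_M -> Y}) : {ffun 'I_m -> K} :=
  [ffun j => let j0 := lift ord_max j in let j1 := lift ord0 j in
     dec2 (y j0) (c j0).1.1 (c j0).2 (dec1 (y j1) (c j1).1.1 - (c j1).1.2)].

Definition outY (o : {ffun 'I_M -> Ob}) : {ffun 'I_M -> Y} := [ffun j => (o j).1.2.1.1].
Definition outZ (o : {ffun 'I_M -> Ob}) : {ffun 'I_M -> Z} := [ffun j => (o j).1.2.2].

Lemma tv_code_of_fixed (c : Cm) e1 e2 :
  \sum_(o | keyA o != keyB c (outY o)) code_law c o <= e1 ->
  dev (code_law c) keyA outZ <= e2 ->
  tv_code W M {ffun 'I_m -> K} e1 e2.
Proof.
move=> h1 h2.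
pose pr := rand_law (blk_e1 c) (blk_e2 c).
pose phi := block_phi xw (c ord0).1.2 (blk_nx c) y0.
pose traj := @block_traj Y Yh Z S V B m (c ord0).1.2 (blk_nx c).
have e1_ge0 j st s : 0 <= blk_e1 c j st s by apply: cond_law_ge0.
have e2_ge0 j s y v : 0 <= blk_e2 c j s y v by apply: cond_law_ge0.
have e1_sum j st : \sum_s blk_e1 c j st s = 1 by apply: cond_law_sum.
have e2_sum j s y : \sum_v blk_e2 c j s y v = 1 by apply: cond_law_sum.
have hlaw o : law (cprob W pr phi) traj o = code_law c o by apply: law_block_traj.
exists _, pr, phi.
pose st (r : {ffun 'I_M -> {ffun B -> S} * {ffun S * Yh -> V}}) (y : {ffun 'I_M -> Yh}) j := sstate (c ord0).1.2 (blk_nx c) r (ext_ffun y) j.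
pose vt (r : {ffun 'I_M -> {ffun B -> S} * {ffun S * Yh -> V}}) (y : {ffun 'I_M -> Yh}) j := vstate (c ord0).1.2 (blk_nx c) r (ext_ffun y) j.
exists (fun r y => drop_last [ffun j : 'I_M => kap (st r y j) (vt r y j)]), (keyB c).
have hA o : drop_last [ffun j : 'I_M => kap (st o.1 (Yhseq o.2) j) (vt o.1 (Yhseq o.2) j)] = keyA (traj o).
  by congr (drop_last _); apply/ffunP => j; rewrite !ffunE.
have hY o : Yseq o.2 = outY (traj o) by apply/ffunP => j; rewrite !ffunE.
have hZ o : Zseq o.2 = outZ (traj o) by apply/ffunP => j; rewrite !ffunE.
split.
- exact: rand_law_ge0.
- exact: rand_law_sum.
- apply: le_trans h1.
  rewrite big_mkcond [leRHS]big_mkcond /=.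
  rewrite (eq_bigr (fun o => cprob W pr phi o *
      (if keyA (traj o) != keyB c (outY (traj o)) then 1 else 0))); last first.
    by move=> o _; rewrite hA hY; case: ifP; rewrite ?mulr1 ?mulr0.
  rewrite -(sum_law (cprob W pr phi) traj (fun o => if keyA o != keyB c (outY o) then 1 else 0)).
  rewrite le_eqVlt; apply/orP; left; apply/eqP.
  by apply: eq_bigr => o _; rewrite hlaw; case: ifP; rewrite ?mulr1 ?mulr0.
apply: le_trans h2; rewrite le_eqVlt; apply/orP; left; apply/eqP.
rewrite -(dev_push keyA outZ hlaw); exact: eq_dev.
Qed.

Lemma prev_stateE (c : Cm) (o : {ffun 'I_M -> Ob}) j :
  prev_state (c ord0).1.2 (blk_nx c) o j = (c j).1.2 + prev_bin o j.
Proof.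
rewrite /prev_state /prev_bin /blk_nx /=; case: j => -[|j] hj //=.
rewrite addr0; congr ((c _).1.2); exact: val_inj.
Qed.

(** One-time pad as a change of variables: trading the value of [be] for the shift, its difference
    with the previous bin index, is a bijection. It carries independent blocks with uniform seeds to
    the chained blocks with uniform seeds. *)
Definition dither (t : {ffun 'I_M -> C * Ob}) : Cm * {ffun 'I_M -> Ob} :=
  let o := [ffun j => (t j).2] in
  ([ffun j => ((t j).1.1.1, (t j).1.1.2 - prev_bin o j, (t j).1.2)], o).

Definition undither (p : Cm * {ffun 'I_M -> Ob}) : {ffun 'I_M -> C * Ob} :=
  [ffun j => (((p.1 j).1.1, (p.1 j).1.2 + prev_bin p.2 j, (p.1 j).2), p.2 j)].

Lemma ditherK : cancel dither undither.
Proof.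
move=> t; apply/ffunP => j; rewrite !ffunE /= subrK.
by case: (t j) => [[[? ?] ?] ?].
Qed.

Lemma unditherK : cancel undither dither.
Proof.
move=> [c o]; rewrite /dither.
have -> : [ffun j => (undither (c, o) j).2] = o by apply/ffunP => j; rewrite !ffunE.
congr (_, _); apply/ffunP => j; rewrite !ffunE /= addrK.
by case: (c j) => [[? ?] ?].
Qed.

Definition mix_law (p : Cm * {ffun 'I_M -> Ob}) : R := code_law p.1 p.2 / #|{: Cm}|%:R.

Local Notation realt := (block_real W pS xw pV g be f).
Local Notation idealt := (block_ideal W pS xw pV g be f).

Lemma mix_law_dither t : mix_law (dither t) = iid realt t.
Proof.
rewrite /mix_law card_ffun card_ord natrX /iid /block_real big_split prodr_const card_ord exprVn.
congr (_ / _); rewrite /code_law /chain_law; apply: eq_bigr => j _.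
rewrite prev_stateE /blk_e1 /blk_e2 /block_realx !ffunE /= subrK.
by congr (enc1 _ _ _ _ _ * _ * _); case: (t j).1.1.
Qed.

Lemma law_dither p : law (@iid R _ realt M) dither p = mix_law p.
Proof.
rewrite /law (bigD1 (undither p)) ?unditherK //= big1 ?addr0; last first.
  by move=> t /andP[/eqP <-]; rewrite ditherK eqxx.
by rewrite -mix_law_dither unditherK.
Qed.

(** Under the ideal law a block contributes at most [2 * d] to the error and [d] to the deviation.
    Passing to the real law costs [2 * M * d], once for the error and twice for the deviation, which
    gives 4 and 5, in total 9. *)
Lemma block_tv_code d : 0 <= d ->
  block_scheme_spec W pS xw pV g be f b kap dec1 dec2 d ->
  tv_code W M {ffun 'I_m -> K} (9 * M%:R * d) (9 * M%:R * d).
Proof.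
move=> d0 hspec.
have hL1 := block_ideal_real_L1 pS_ge0 pS1 W_ge0 W1 pV_ge0 pV1 G_gt0 F_gt0 hspec.
have [_ _ h3 h4 h5] := hspec.
have hI0 : forall t, 0 <= idealt t by apply: block_ideal_ge0.
have hI1 : \sum_t idealt t = 1 by apply: block_ideal_sum.
have hR0 : forall t, 0 <= realt t by apply: block_real_ge0.
have hR1 : \sum_t realt t = 1 by apply: block_real_sum.
have hM := iid_L1 M hI0 hR0 hI1 hR1.
have hM2 : \sum_t `|@iid R _ idealt M t - iid realt t| <= 2 * M%:R * d.
  apply: le_trans hM _; rewrite -mulrA mulrCA; apply: ler_wpM2l => //; exact: ler0n.
have hC : (0 < #|{: Cm}|)%N by rewrite card_ffun expn_gt0 C_gt0.
have herr : \sum_(p | keyA p.2 != keyB p.1 (outY p.2)) mix_law p <= 4 * M%:R * d.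
  pose bad p := keyA p.2 != keyB p.1 (outY p.2).
  have -> : \sum_(p | keyA p.2 != keyB p.1 (outY p.2)) mix_law p =
            \sum_(t | bad (dither t)) @iid R _ realt M t.
    transitivity (\sum_p law (@iid R _ realt M) dither p * (bad p)%:R).
      rewrite big_mkcond; apply: eq_bigr => p _; rewrite law_dither /bad.
      by case: ifP; rewrite ?mulr1 ?mulr0.
    rewrite sum_law [RHS]big_mkcond; apply: eq_bigr => t _.
    by case: ifP; rewrite ?mulr1 ?mulr0.
  apply: le_trans (err_le_L1 (@iid R _ idealt M) (@iid R _ realt M) (fun t => bad (dither t))) _.
  have -> : 4 * M%:R * d = M%:R * (2 * d) + 2 * M%:R * d by ring.
  apply: lerD hM2.
  pose bad1 (t : C * Ob) := (dec1 t.2.1.2.1.1 t.1.1.1 != t.1.1.2) ||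
    (dec2 t.2.1.2.1.1 t.1.1.1 t.1.2 (b t.2.2) != kap t.2.1.1 t.2.2).
  apply: le_trans (@err_le_union _ _ (@iid R _ idealt M) M (fun j t => bad1 (t j)) (fun t => bad (dither t)) _ _) _.
  - by move=> t; apply: iid_ge0.
  - move=> t; apply: contraLR; rewrite negb_exists => /forallP h.
    rewrite /bad negbK; apply/eqP/ffunP => j.
    have hinord : inord j = lift ord_max j :> 'I_M.
      by apply: ord_inj; rewrite lift_max inordK // ltnS ltnW.
    do 2! rewrite !ffunE /=.
    have := h (lift ord_max j); rewrite negb_or !negbK => /andP[_ /eqP <-].
    have := h (lift ord0 j); rewrite negb_or !negbK => /andP[/eqP -> _].
    by rewrite opprB addrCA subrr addr0 /prev_bin /= hinord !ffunE.
  apply: (@le_trans _ _ (\sum_(j < M) 2 * d)); last by rewrite sumr_const card_ord -[_ *+ _]mulr_natl.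
  apply: ler_sum => j _; rewrite iid_marg_pred //.
  have -> : \sum_(t | bad1 t) idealt t = \sum_o blaw W pS xw pV o * (bad1 ((g o.1.1, be o.1.1, f o.2), o))%:R.
    rewrite -(sum_ideal W pS xw pV g be f (fun t => (bad1 t)%:R)) big_mkcond; apply: eq_bigr => t _.
    by case: ifP; rewrite ?mulr1 ?mulr0.
  rewrite mulr_natl mulr2n; apply: le_trans (lerD h3 h4).
  rewrite [X in _ <= X + _]big_mkcond [X in _ <= _ + X]big_mkcond -big_split /=.
  apply: ler_sum => o _; have hb := blaw_ge0 xw pS_ge0 W_ge0 pV_ge0 o.
  by rewrite /bad1 /=; case: ifP => _; case: ifP => _; rewrite /= ?mulr1 ?mulr0 ?addr0 ?add0r // lerDl.
have hdev : dev mix_law (fun p => keyA p.2) (fun p => (p.1, outZ p.2)) <= 5 * M%:R * d.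
  rewrite -(dev_push _ _ law_dither).
  (* This is more than Eve sees: from the value of [be] in each block and the bin index of the
     preceding one, the public shift can be computed. *)
  pose E1 (t : C * Ob) := (t.1, b t.2.2, t.2.1.2.2).
  pose K1 (t : C * Ob) := kap t.2.1.1 t.2.2.
  have hKm (t : {ffun 'I_M -> C * Ob}) : drop_last (vec K1 t) = keyA (dither t).2.
    by congr (drop_last _); apply/ffunP => j; rewrite !ffunE.
  have -> : dev (@iid R _ realt M) ((fun p => keyA p.2) \o dither) ((fun p => (p.1, outZ p.2)) \o dither) =
     dev (@iid R _ realt M) (@drop_last K m \o @vec _ _ K1 M) ((fun p => (p.1, outZ p.2)) \o dither).
    by apply: eq_dev => // t; rewrite /= hKm.
  pose phi (e : {ffun 'I_M -> C * B * Z}) : Cm * {ffun 'I_M -> Z} :=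
    ([ffun j => ((e j).1.1.1.1, (e j).1.1.1.2 - (if val j is j'.+1 then (e (inord j')).1.2 else 0), (e j).1.1.2)],
     [ffun j => (e j).2]).
  apply: le_trans (@dev_coarse_eq _ _ _ _ _ _ _ (@vec _ _ E1 M) _ phi _) _.
    move=> t; congr (_, _); apply/ffunP => j; rewrite !ffunE //=.
    by congr (_, _ - _, _); rewrite /prev_bin /=; case: (nat_of_ord j) => // j'; rewrite !ffunE.
  apply: le_trans (@dev_L1 _ _ _ _ (@iid R _ idealt M) _ _ _ _) _; first by rewrite card_ffun expn_gt0 K_gt0.
  have -> : 5 * M%:R * d = M%:R * d + 2 * (2 * M%:R * d) by ring.
  apply: lerD; last by rewrite ler_pM2l.
  apply: le_trans (dev_balanced _ _ _ (balanced_drop_last _ _)) _ => //.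
  apply: le_trans (dev_iid _ _ _ _ _ _) _ => //.
  apply: ler_wpM2l; first exact: ler0n.
  apply: le_trans h5; rewrite le_eqVlt; apply/orP; left; apply/eqP.
  have hj t : law (blaw W pS xw pV) (fun o => ((g o.1.1, be o.1.1, f o.2), o)) t = idealt t.
    rewrite /law big_mkcond (bigD1 t.2) //= [X in _ + X]big1 ?addr0; last first.
      by move=> o ho; case: eqP => // h; move: ho; rewrite -h eqxx.
    by rewrite /block_ideal [in LHS](surjective_pairing t) xpair_eqE eqxx andbT /=; case: (_ == _); rewrite ?mulr1 ?mulr0.
  by rewrite -(dev_push K1 E1 hj).
(* Error and deviation are averaged as one sum, so that a single seed is good for both. *)
have : avg (fun c => \sum_(o | keyA o != keyB c (outY o)) code_law c o + dev (code_law c) keyA outZ) <= 9 * M%:R * d.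
  rewrite avgD -dev_mix.
  have -> : avg (fun c => \sum_(o | keyA o != keyB c (outY o)) code_law c o) =
     \sum_(p | keyA p.2 != keyB p.1 (outY p.2)) mix_law p.
    rewrite [RHS]big_mkcond sum_pair /avg mulr_suml; apply: eq_bigr => c _.
    by rewrite mulr_suml big_mkcond.
  apply: le_trans (lerD herr hdev) _; rewrite -!mulrDl -natrD //.
case/(exists_le_avg hC) => c hc.
have hd := dev_ge0 (code_law c) keyA outZ.
have he : 0 <= \sum_(o | keyA o != keyB c (outY o)) code_law c o.
  apply: sumr_ge0 => o _; apply: prodr_ge0 => j _.
  by rewrite !mulr_ge0 //; apply: cond_law_ge0.
by apply: (tv_code_of_fixed (c := c)); apply: le_trans hc; rewrite ?lerDl ?lerDr.
Qed.

End BlockCode.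

Lemma size_fb_hist (Y Yh Z : finType) n (w : {ffun 'I_n -> Y * Yh * Z}) (i : 'I_n) :
  size (fb_hist w i) = i.
Proof. by rewrite /fb_hist size_take size_map size_enum_ord ltn_ord. Qed.

Lemma nth_fb_hist (Y Yh Z : finType) n (w : {ffun 'I_n -> Y * Yh * Z}) (i k : 'I_n) y0 :
  (k < i)%N -> nth y0 (fb_hist w i) k = (w k).1.2.
Proof.
move=> hk; rewrite /fb_hist nth_take // (nth_map k) ?size_enum_ord //.
by rewrite nth_ord_enum.
Qed.

(** Induction on the last channel use: its input is determined by the earlier outputs, so its own
    output sums to one. The encoder is indexed by [nat] so that it stays the same when the length
    decreases. *)
Lemma sum_feedback_channel (R : realFieldType) (X Y Yh Z : finType)
    (W : X -> Y * Yh * Z -> R) n (phi : nat -> seq Yh -> X) :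
  (forall x, \sum_w W x w = 1) ->
  \sum_(w : {ffun 'I_n -> Y * Yh * Z}) \prod_(i < n) W (phi i (fb_hist w i)) (w i) = 1.
Proof.
move=> W1; elim: n => [|n IH].
  rewrite (eq_bigr (fun _ => 1)) => [|w _]; last by rewrite big_ord0.
  by rewrite sumr_const card_ffun card_ord expn0.
rewrite (reindex (@rcons_ffun (Y * Yh * Z) n)) /=; last exact/onW_bij/rcons_ffun_bij.
rewrite sum_pair -[RHS]IH; apply: eq_bigr => w _.
have hw x (i : 'I_n) : rcons_ffun (w, x) (widen_ord (leqnSn n) i) = w i.
  have -> : widen_ord (leqnSn n) i = lift ord_max i by apply: ord_inj; rewrite lift_max.
  by rewrite ffunE liftK.
have hl x : rcons_ffun (w, x) ord_max = x by rewrite ffunE unlift_none.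
have hf x x' : fb_hist (rcons_ffun (w, x)) ord_max = fb_hist (rcons_ffun (w, x')) ord_max.
  apply: (@eq_from_nth _ x.1.2); rewrite ?size_fb_hist // => k hk.
  have hk' : (k < n.+1)%N by apply: ltnW.
  rewrite -[k]/(val (Ordinal hk')) (nth_fb_hist _ _ (k := Ordinal hk')) // nth_fb_hist //.
  have -> : Ordinal hk' = widen_ord (leqnSn n) (Ordinal hk) by apply: val_inj.
  by rewrite !hw.
have hf' x (i : 'I_n) : fb_hist (rcons_ffun (w, x)) (widen_ord (leqnSn n) i) = fb_hist w i.
  apply: (@eq_from_nth _ x.1.2); rewrite ?size_fb_hist // => k hk.
  have hk1 : (k < n)%N by apply: ltn_trans hk (ltn_ord i).
  have hk2 : (k < n.+1)%N by apply: ltnW.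
  rewrite -{1}[k]/(val (Ordinal hk2)) nth_fb_hist // -[k]/(val (Ordinal hk1)) nth_fb_hist //.
  by rewrite -(hw x); congr (rcons_ffun _ _).1.2; apply: val_inj.
case: (pickP (fun _ : Y * Yh * Z => true)) => [x0 _|h0]; last first.
  have := W1 (phi 0%N [::]); rewrite big_pred0 // => /eqP; by rewrite eq_sym oner_eq0.
pose q := fb_hist (rcons_ffun (w, x0)) ord_max.
rewrite (eq_bigr (fun x => \prod_(i < n) W (phi i (fb_hist w i)) (w i) * W (phi n q) x)).
  by rewrite -mulr_sumr W1 mulr1.
move=> x _; rewrite big_ord_recr /= (hf x x0) -/q hl; congr (_ * _).
by apply: eq_bigr => i _; rewrite hf' hw.
Qed.

Lemma cprob_sum (R : realFieldType) (X Y Yh Z : finType) (W : X -> Y * Yh * Z -> R)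
    n (Rr : finType) (pr : Rr -> R) (phi : 'I_n -> Rr -> seq Yh -> X) :
  (forall x, \sum_w W x w = 1) -> \sum_r pr r = 1 ->
  \sum_o cprob W pr phi o = 1.
Proof.
move=> W1 hpr; rewrite sum_pair -[RHS]hpr; apply: eq_bigr => r _.
rewrite /cprob /= -mulr_sumr -[RHS]mulr1; congr (_ * _).
case: n phi => [|n] phi.
  rewrite (eq_bigr (fun _ => 1)) => [|w _]; last by rewrite big_ord0.
  by rewrite sumr_const card_ffun card_ord expn0.
rewrite -[RHS](sum_feedback_channel n.+1 (fun i => phi (inord i) r) W1).
by apply: eq_bigr => w _; apply: eq_bigr => i _; rewrite inord_val.
Qed.

Lemma law_bij (R : realFieldType) (O T : finType) (P : O -> R) (h : O -> T) (h' : T -> O) t :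
  cancel h h' -> cancel h' h -> law P h t = P (h' t).
Proof.
move=> hk hk'; rewrite /law (bigD1 (h' t)) ?hk' //= big1 ?addr0 // => o /andP[/eqP <-].
by rewrite hk eqxx.
Qed.

Lemma dev_indep (R : realFieldType) (O O' TK TB : finType) (P : O -> R) (Q : O' -> R)
    (K : O -> TK) (B : O -> TB) :
  (forall q, 0 <= Q q) -> \sum_q Q q = 1 ->
  dev (fun p : O * O' => P p.1 * Q p.2) (fun p => K p.1) (fun p => (B p.1, p.2)) = dev P K B.
Proof.
move=> hQ hQ1; rewrite /dev; apply: eq_bigr => k _.
rewrite sum_pair; apply: eq_bigr => b _.
have hl (T : finType) (A : O -> T) a q : law (fun p : O * O' => P p.1 * Q p.2) (fun p => (A p.1, p.2)) (a, q) = law P A a * Q q.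
  rewrite /law big_mkcond sum_pair exchange_big (bigD1 q) //= [X in _ + X]big1 ?addr0; last first.
    by move=> q' hq; rewrite big1 // => o _; rewrite xpair_eqE (negbTE hq) andbF.
  by rewrite mulr_suml [RHS]big_mkcond; apply: eq_bigr => o _; rewrite xpair_eqE eqxx andbT.
rewrite (eq_bigr (fun q => `|law P (fun o => (K o, B o)) (k, b) - law P B b / #|TK|%:R| * Q q)).
  by rewrite -mulr_sumr hQ1 mulr1.
move=> q _; rewrite -[in RHS](ger0_norm (hQ q)) -normrM mulrBl; congr (`|_ - _|).
  by rewrite -(hl _ (fun o => (K o, B o))); apply: eq_bigl => p; rewrite !xpair_eqE andbA.
by rewrite hl mulrAC.
Qed.

(** * From a channel of blocks to single channel uses *)

Section Unblock.
Variable R : realFieldType.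
Variables X Y Yh Z : finType.
Variable W : X -> Y * Yh * Z -> R.

(** One use of this channel is a whole block, so the encoder receives the feedback only when a block
    is complete. *)
Definition block_channel n (x : {ffun 'I_n -> X})
    (w : {ffun 'I_n -> Y} * {ffun 'I_n -> Yh} * {ffun 'I_n -> Z}) : R :=
  \prod_i W (x i) (w.1.1 i, w.1.2 i, w.2 i).

Variables (m' n' r : nat).
Local Notation m := m'.+1.
Local Notation n := n'.+1.
Local Notation N := (m * n + r)%N.
Local Notation Wo := (Y * Yh * Z)%type.
Local Notation Wb := ({ffun 'I_n -> Y} * {ffun 'I_n -> Yh} * {ffun 'I_n -> Z})%type.

Lemma block_idx_proof (p : 'I_m * 'I_n) : (p.1 * n + p.2 < m * n)%N.
Proof.
apply: (@leq_trans (p.1.+1 * n)%N); last by rewrite leq_mul2r ltn_ord orbT.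
by rewrite mulSn addnC ltn_add2r ltn_ord.
Qed.

Definition block_idx (p : 'I_m * 'I_n) : 'I_(m * n) := Ordinal (block_idx_proof p).

Lemma block_idx_bij : bijective block_idx.
Proof.
apply: inj_card_bij; last by rewrite card_prod !card_ord.
move=> [j t] [j' t'] /(congr1 val) /= h.
have hj : val j = val j'.
  by have := congr1 (fun x => x %/ n)%N h; rewrite !divnMDl // !divn_small ?ltn_ord // !addn0.
have ht : val t = val t' by move: h; rewrite /= hj => /addnI.
by congr (_, _); apply: val_inj.
Qed.

Definition to_blocks (w : {ffun 'I_N -> Wo}) : {ffun 'I_m -> Wb} :=
  [ffun j => ([ffun t => (w (lshift r (block_idx (j, t)))).1.1],
              [ffun t => (w (lshift r (block_idx (j, t)))).1.2],
              [ffun t => (w (lshift r (block_idx (j, t)))).2])].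

Definition to_rest (w : {ffun 'I_N -> Wo}) : {ffun 'I_r -> Wo} :=
  [ffun i => w (rshift (m * n) i)].

Definition of_blocks (wb : {ffun 'I_m -> Wb}) (wr : {ffun 'I_r -> Wo}) : {ffun 'I_N -> Wo} :=
  [ffun i => match split i with
   | inl k => let j := inord (k %/ n) in let t := inord (k %% n) in
              ((wb j).1.1 t, (wb j).1.2 t, (wb j).2 t)
   | inr k => wr k end].

Lemma block_idxE (k : 'I_(m * n)) : block_idx (inord (k %/ n), inord (k %% n)) = k.
Proof.
apply: val_inj; rewrite /= !inordK ?ltn_pmod //; first by rewrite -divn_eq.
by rewrite ltn_divLR.
Qed.

Lemma of_blocksK w : of_blocks (to_blocks w) (to_rest w) = w.
Proof.
apply/ffunP => i; rewrite ffunE; case: splitP => k hk.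
  have -> : i = lshift r k by apply: val_inj.
  by rewrite /= !ffunE /= ?ffunE block_idxE; case: (w _) => [[]].
by rewrite ffunE; congr (w _); apply: val_inj; rewrite /= hk.
Qed.

Lemma split_lshift p : split (lshift r p) = inl p :> 'I_(m * n) + 'I_r.
Proof. exact: (unsplitK (inl p)). Qed.

Lemma split_rshift p : split (rshift (m * n) p) = inr p :> 'I_(m * n) + 'I_r.
Proof. exact: (unsplitK (inr p)). Qed.

Lemma to_blocksK wb wr : to_blocks (of_blocks wb wr) = wb.
Proof.
apply/ffunP => j; rewrite ffunE.
have hv t : of_blocks wb wr (lshift r (block_idx (j, t))) = ((wb j).1.1 t, (wb j).1.2 t, (wb j).2 t).
  rewrite ffunE split_lshift /= divnMDl // divn_small ?ltn_ord // addn0 modnMDl modn_small ?ltn_ord //.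
  by rewrite !inord_val.
rewrite [RHS](surjective_pairing (wb j)) [X in _ = (X, _)](surjective_pairing (wb j).1).
by congr (_, _, _); apply/ffunP => t; rewrite ffunE hv.
Qed.

Lemma to_restK wb wr : to_rest (of_blocks wb wr) = wr.
Proof. by apply/ffunP => i; rewrite !ffunE split_rshift. Qed.

Variables (Rr : finType) (pr : Rr -> R).
Variables (phi : 'I_m -> Rr -> seq {ffun 'I_n -> Yh} -> {ffun 'I_n -> X}) (x0 : X) (y0 : Yh).

Definition hist_blocks (hist : seq Yh) (j : nat) : seq {ffun 'I_n -> Yh} :=
  mkseq (fun k => [ffun t : 'I_n => nth y0 hist (k * n + t)]) j.

(** The last [r] uses only fill up the length to one that need not be a multiple of the block
    length; they send the fixed symbol [x0]. *)
Definition flat_phi (i : 'I_N) (s : Rr) (hist : seq Yh) : X :=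
  match split i with
  | inl k => phi (inord (k %/ n)) s (hist_blocks hist (k %/ n)) (inord (k %% n))
  | inr _ => x0
  end.

Lemma hist_blocksE (w : {ffun 'I_N -> Wo}) (j : 'I_m) (t : 'I_n) :
  hist_blocks (fb_hist w (lshift r (block_idx (j, t)))) j = fb_hist (to_blocks w) j.
Proof.
apply: (@eq_from_nth _ [ffun=> y0]); first by rewrite size_mkseq size_fb_hist.
rewrite size_mkseq => k hk; have hkm := ltn_trans hk (ltn_ord j).
rewrite nth_mkseq // (nth_fb_hist _ _ (k := Ordinal hkm)) // ffunE /=.
apply/ffunP => u; rewrite !ffunE.
rewrite -(nth_fb_hist (i := lshift r (block_idx (j, t))) w y0) //=.
have := ltn_ord u; have := ltn_ord t; nia.
Qed.

Lemma cprob_unblock s w :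
  cprob W pr flat_phi (s, w) =
  cprob (block_channel (n := n)) pr phi (s, to_blocks w) * \prod_i W x0 (to_rest w i).
Proof.
rewrite /cprob /= -mulrA; congr (_ * _).
rewrite big_split_ord; congr (_ * _); last first.
  by apply: eq_bigr => i _; rewrite /flat_phi split_rshift ffunE.
rewrite (reindex block_idx) /=; last exact: onW_bij block_idx_bij.
rewrite /block_channel pair_big /=; apply: eq_bigr => -[j t] _.
rewrite !ffunE /= ?ffunE -!surjective_pairing; congr (W _ _).
rewrite /flat_phi split_lshift /= divnMDl // divn_small ?ltn_ord // addn0.
by rewrite hist_blocksE modnMDl modn_small ?ltn_ord // !inord_val.
Qed.

End Unblock.

(** The outputs of the [r] filling uses form an independent factor: they sum out of the error
    probability and, by [dev_indep], tell Eve nothing about the key. *)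
Lemma tv_code_unblock (R : realFieldType) (X Y Yh Z : finType) (W : X -> Y * Yh * Z -> R)
    (x0 : X) (m n r : nat) (K : finType) e1 e2 :
  (forall x w, 0 <= W x w) -> (forall x, \sum_w W x w = 1) ->
  tv_code (block_channel W (n := n.+1)) m.+1 K e1 e2 ->
  tv_code W (m.+1 * n.+1 + r) K e1 e2.
Proof.
move=> W0 W1 [Rr [pr [phi [psia [psib [hpr hpr1 h1 h2]]]]]].
have y0 : Yh.
  case: (pickP (fun _ : Y * Yh * Z => true)) => [[[_ y] _] _|h]; first exact: y.
  by exfalso; have := W1 x0; rewrite big_pred0 // => /eqP; rewrite eq_sym oner_eq0.
pose phi' := flat_phi (r := r) phi x0 y0.
pose T (o : Rr * {ffun 'I_(m.+1 * n.+1 + r) -> Y * Yh * Z}) :=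
  ((o.1, to_blocks o.2), to_rest o.2).
pose T' (p : Rr * {ffun 'I_m.+1 -> {ffun 'I_n.+1 -> Y} * {ffun 'I_n.+1 -> Yh} * {ffun 'I_n.+1 -> Z}} *
             {ffun 'I_r -> Y * Yh * Z}) := (p.1.1, of_blocks p.1.2 p.2).
have hT : cancel T T' by move=> [s w]; rewrite /T /T' of_blocksK.
have hT' : cancel T' T by move=> [[s wb] wr]; rewrite /T /T' to_blocksK to_restK.
pose Q (wr : {ffun 'I_r -> Y * Yh * Z}) := iid (W x0) wr.
have hQ0 q : 0 <= Q q by apply: iid_ge0.
have hQ1 : \sum_q Q q = 1 by apply: sum_iid.
have hlaw p : law (cprob W pr phi') T p =
    cprob (block_channel W (n := n.+1)) pr phi p.1 * Q p.2.
  rewrite (law_bij _ _ hT hT') /T' /phi' cprob_unblock to_blocksK to_restK.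
  by rewrite -surjective_pairing.
pose yh (y : {ffun 'I_(m.+1 * n.+1 + r) -> Yh}) : {ffun 'I_m.+1 -> {ffun 'I_n.+1 -> Yh}} :=
  [ffun j => [ffun t => y (lshift r (block_idx (j, t)))]].
pose yy (y : {ffun 'I_(m.+1 * n.+1 + r) -> Y}) : {ffun 'I_m.+1 -> {ffun 'I_n.+1 -> Y}} :=
  [ffun j => [ffun t => y (lshift r (block_idx (j, t)))]].
have hyh w : yh (Yhseq w) = Yhseq (to_blocks w).
  by apply/ffunP => j; rewrite !ffunE /=; apply/ffunP => t; rewrite !ffunE.
have hyy w : yy (Yseq w) = Yseq (to_blocks w).
  by apply/ffunP => j; rewrite !ffunE /=; apply/ffunP => t; rewrite !ffunE.
exists Rr, pr, phi', (fun s y => psia s (yh y)), (fun y => psib (yy y)); split=> //.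
  apply: le_trans h1; rewrite big_mkcond [leRHS]big_mkcond /=.
  pose bad (o : Rr * {ffun 'I_m.+1 -> {ffun 'I_n.+1 -> Y} * {ffun 'I_n.+1 -> Yh} * {ffun 'I_n.+1 -> Z}}) : R :=
    (psia o.1 (Yhseq o.2) != psib (Yseq o.2))%:R.
  rewrite (eq_bigr (fun o => cprob W pr phi' o * bad (T o).1)); last first.
    by move=> o _; rewrite hyh hyy /bad /=; case: (_ != _); rewrite ?mulr1 ?mulr0.
  rewrite -(sum_law _ T (fun p => bad p.1)) sum_pair le_eqVlt; apply/orP; left; apply/eqP.
  apply: eq_bigr => o _; rewrite /= -mulr_suml; rewrite (eq_bigr _ (fun wr _ => hlaw (o, wr))) /=.
  rewrite -mulr_sumr hQ1 mulr1 /bad.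
  by case: (_ != _); rewrite ?mulr1 ?mulr0.
apply: le_trans h2.
rewrite -[leRHS](dev_indep _ _ _ hQ0 hQ1) -[leRHS](dev_push _ _ hlaw).
rewrite -(eq_dev (P := cprob W pr phi') (K := (fun p => psia p.1.1 (Yhseq p.1.2)) \o T)
  (B := fun o => Zseq o.2) (fun _ => erefl) _ (fun _ => erefl)); last by move=> o; rewrite /= hyh.
pose zz (p : {ffun 'I_m.+1 -> {ffun 'I_n.+1 -> Z}} * {ffun 'I_r -> Y * Yh * Z}) :
    {ffun 'I_(m.+1 * n.+1 + r) -> Z} :=
  [ffun i => match split i with
   | inl k => p.1 (inord (k %/ n.+1)) (inord (k %% n.+1))
   | inr k => (p.2 k).2 end].
apply: (@dev_coarse_eq _ _ _ _ _ _ _ _ _ zz) => o; apply/ffunP => i; rewrite !ffunE /=.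
case: splitP => k hk.
  have -> : i = lshift r k by apply: val_inj.
  by rewrite /= !ffunE /= ?ffunE block_idxE.
by rewrite ffunE; congr (o.2 _).2; apply: val_inj.
Qed.

Bind Scope ring_scope with Rdefinitions.R.
Arguments ln _%_ring_scope.
Arguments Rpower _%_ring_scope _%_ring_scope.
Local Notation R := Rdefinitions.R.

(** * Entropy and key rates *)

Definition lg (x : R) : R := ln x / ln 2.
Definition pw2 (x : R) : R := Rpower 2 x.

Lemma R2E : IZR 2 = 2 :> R. Proof. by []. Qed.

Lemma ln2_gt0 : 0 < ln 2 :> R.
Proof. by apply/RltP; apply: Rlt_trans ln_lt_2; apply/RltP; rewrite RinvE R2E invr_gt0. Qed.

Lemma ln2_neq0 : ln 2 != 0 :> R. Proof. by rewrite gt_eqF ?ln2_gt0. Qed.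

Lemma lgM x y : 0 < x -> 0 < y -> lg (x * y) = lg x + lg y.
Proof. move=> /RltP hx /RltP hy; rewrite /lg.
by have -> : ln (x * y) = ln x + ln y := ln_mult _ _ hx hy; rewrite mulrDl. Qed.

Lemma lg1 : lg 1 = 0.
Proof. by rewrite /lg; have -> : ln 1 = 0 := ln_1; rewrite mul0r. Qed.

Lemma lgV x : 0 < x -> lg x^-1 = - lg x.
Proof.
move=> hx; apply: (addrI (lg x)); rewrite -lgM ?invr_gt0 // divff ?gt_eqF // lg1 subrr //.
Qed.

Lemma lg_le x y : 0 < x -> x <= y -> lg x <= lg y.
Proof.
move=> hx; rewrite le_eqVlt => /orP[/eqP -> //|/RltP hxy].
apply: ler_wpM2r; first by rewrite invr_ge0 ltW ?ln2_gt0.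
by apply/RleP; left; apply: ln_increasing => //; apply/RltP.
Qed.

Lemma lg_ge0 x : 1 <= x -> 0 <= lg x.
Proof. by move=> hx; rewrite -lg1 lg_le. Qed.

Lemma lg_sub1 x : 0 < x -> lg x <= (x - 1) / ln 2.
Proof.
move=> hx; apply: ler_wpM2r; first by rewrite invr_ge0 ltW ?ln2_gt0.
have h := exp_ineq1_le (ln x); rewrite exp_ln in h; last exact/RltP.
by move/RleP: h; rewrite RplusE R1E; lra.
Qed.

Lemma ln2V_le2 : (ln 2)^-1 <= 2 :> R.
Proof.
have h : 2^-1 <= ln 2 :> R by apply/RleP; left; exact: ln_lt_2.
by rewrite -[leRHS]invrK lef_pV2 // posrE ?invr_gt0 ?ln2_gt0.
Qed.

Lemma lg_pw2 x : lg (pw2 x) = x.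
Proof. by rewrite /lg; have -> : ln (pw2 x) = x * ln 2 := ln_exp _; rewrite mulfK // ln2_neq0. Qed.

Lemma pw2_gt0 x : 0 < pw2 x. Proof. by apply/RltP; apply: exp_pos. Qed.

Lemma pw2_lg x : 0 < x -> pw2 (lg x) = x.
Proof.
move=> hx; rewrite /pw2 /Rpower /lg RmultE mulfVK ?ln2_neq0 // exp_ln //; exact/RltP.
Qed.

Lemma pw2D x y : pw2 (x + y) = pw2 x * pw2 y.
Proof. exact: Rpower_plus. Qed.

Lemma pw20 : pw2 0 = 1.
Proof. by rewrite /pw2 /Rpower RmultE mul0r -R0E exp_0. Qed.

Lemma pw2N x : pw2 (- x) = (pw2 x)^-1.
Proof.
have h : pw2 (- x) * pw2 x = 1 by rewrite -pw2D addNr pw20.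
by rewrite -[LHS](mulfK (lt0r_neq0 (pw2_gt0 x))) h mul1r.
Qed.

Lemma ler_pw2 x y : (pw2 x <= pw2 y) = (x <= y).
Proof.
apply/idP/idP => h.
  by rewrite -[x]lg_pw2 -[y]lg_pw2 lg_le ?pw2_gt0.
move: h; rewrite le_eqVlt => /orP[/eqP -> //|/RltP h].
have h2 : 1 < 2 :> R by rewrite ltr1n.
by apply/RleP; left; apply: (Rpower_lt _ _ _ (elimT (@RltP 1 2) h2) h).
Qed.

Lemma pw2Mn x n : pw2 (n%:R * x) = pw2 x ^+ n.
Proof.
elim: n => [|n IH]; first by rewrite mul0r pw20.
by rewrite exprSr -IH -pw2D; congr pw2; rewrite -natr1; ring.
Qed.

Lemma lgX x n : 0 < x -> lg (x ^+ n) = n%:R * lg x.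
Proof. by move=> hx; rewrite -{1}(pw2_lg hx) -pw2Mn lg_pw2. Qed.

Definition xlg (p : R) : R := if 0 < p then p * lg p else 0.

Lemma xlog2xE p : xlog2x p = xlg p.
Proof.
rewrite /xlog2x /xlg; case: Rlt_dec => h; case: ifP => // h'.
  have h0 : 0 < p := introT RltP h; by rewrite h0 in h'.
by case: h; exact: (elimT RltP h').
Qed.

Lemma xlg0 : xlg 0 = 0. Proof. by rewrite /xlg ltxx. Qed.

Lemma xlgE p : 0 <= p -> xlg p = p * lg p.
Proof. by rewrite /xlg le0r => /orP[/eqP ->|->] //; rewrite ltxx mul0r. Qed.

Section Ent.
Implicit Types O T TA TB TC TK : finType.

Lemma pmf_ofE O T (P : O -> R) (A : O -> T) a : pmf_of P A a = law P A a.
Proof. by []. Qed.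

Lemma entE O T (P : O -> R) (A : O -> T) : ent P A = - \sum_a xlg (law P A a).
Proof. by rewrite /ent; congr (- _); apply: eq_bigr => a _; rewrite xlog2xE pmf_ofE. Qed.

Lemma eq_ent O T (P P' : O -> R) (A A' : O -> T) : P =1 P' -> A =1 A' -> ent P A = ent P' A'.
Proof. by move=> hP hA; rewrite !entE; congr (- _); apply: eq_bigr => a _; rewrite (eq_law hP hA). Qed.

Lemma ent_push O O' T (P : O -> R) (P' : O' -> R) (h : O' -> O) (A : O -> T) :
  (forall o, law P' h o = P o) -> ent P' (A \o h) = ent P A.
Proof. by move=> hP; rewrite !entE; congr (- _); apply: eq_bigr => a _; rewrite (law_push _ hP). Qed.

Lemma ent_cancel O T T' (P : O -> R) (A : O -> T) (B : O -> T') (phi : T -> T') (psi : T' -> T) :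
  (forall o, B o = phi (A o)) -> (forall o, A o = psi (B o)) -> ent P B = ent P A.
Proof.
move=> hB hA; rewrite !entE; congr (- _).
have h0 b : phi (psi b) != b -> law P B b = 0.
  move=> hb; rewrite /law big1 // => o /eqP ho; move: hb.
  by rewrite -ho -hA -hB eqxx.
have h0' a : psi (phi a) != a -> law P A a = 0.
  move=> ha; rewrite /law big1 // => o /eqP ho; move: ha.
  by rewrite -ho -hB -hA eqxx.
rewrite (bigID (fun b => phi (psi b) == b)) /= [X in _ + X]big1 ?addr0; last first.
  by move=> b hb; rewrite h0 // xlg0.
rewrite [RHS](bigID (fun a => psi (phi a) == a)) /= [X in _ = _ + X]big1 ?addr0; last first.
  by move=> a ha; rewrite h0' // xlg0.
rewrite (reindex_onto phi psi) /=; last by move=> b /eqP.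
apply: eq_big => [a|a /andP[/eqP h1 /eqP h2]].
  apply/andP/eqP => [[_ /eqP //]|h]; by rewrite h eqxx.
by congr xlg; apply: eq_bigl => o; apply/eqP/eqP => [h|<-]; rewrite ?hB // hA h.
Qed.

Lemma ent_le_card O T (P : O -> R) (A : O -> T) :
  (forall o, 0 <= P o) -> \sum_o P o = 1 -> (0 < #|T|)%N -> ent P A <= lg #|T|%:R.
Proof.
move=> hP hP1 hT; rewrite entE lerNl; set M : R := #|T|%:R.
have hM : 0 < M by rewrite ltr0n.
have hp a : 0 <= law P A a by apply: law_ge0.
have hkey a : xlg (law P A a) >= - (law P A a * lg M) + (law P A a - M^-1) / ln 2.
  rewrite /xlg; case: ifP => h; last first.
    have -> : law P A a = 0 by apply/le_anti; rewrite hp leNgt h.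
    rewrite mul0r oppr0 add0r sub0r mulNr oppr_le0 mulr_ge0 ?invr_ge0 ?ltW //; exact: ln2_gt0.
  set p := law P A a in h *.
  have := lg_sub1 (x := (p * M)^-1); rewrite invr_gt0 mulr_gt0 // => /(_ isT).
  rewrite lgV ?mulr_gt0 // lgM // => /(ler_wpM2l (hp a)); rewrite -/p mulrA => hh.
  have e : p * ((p * M)^-1 - 1) = M^-1 - p by field; rewrite !gt_eqF.
  rewrite e in hh; have : (p - M^-1) / ln 2 = - ((M^-1 - p) / ln 2) by rewrite -mulNr opprB.
  by move=> ->; lra.
apply: le_trans (ler_sum _ (fun a _ => hkey a)).
rewrite big_split /= sumrN -mulr_suml law_total hP1 mul1r lerDl -mulr_suml sumrB law_total hP1.
by rewrite sumr_const -[_ *+ _]mulr_natl -/M mulfV ?gt_eqF // subrr mul0r.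
Qed.

(** The relative entropy to a uniform key is bounded term by term. Put [x = p k b * M / q b]. Terms
    with [x <= 1] are non-positive; for [1 <= x <= M] one has [x * lg x = (x - 1) * lg x + lg x <=
    (x - 1) * (lg M + 2)], as [1 / ln 2 <= 2]. The bound is therefore linear in [d], without the
    [d * lg d] of general continuity estimates. *)
Lemma cond_ent_dev O TK TB (P : O -> R) (K : O -> TK) (B : O -> TB) d :
  (forall o, 0 <= P o) -> \sum_o P o = 1 -> (0 < #|TK|)%N -> dev P K B <= d ->
  lg #|TK|%:R - d * (lg #|TK|%:R + 2) <= ent P (fun o => (K o, B o)) - ent P B.
Proof.
move=> hP hP1 hT hd; set M : R := #|TK|%:R.
have hM1 : 1 <= M by rewrite ler1n.
have hM : 0 < M by rewrite ltr0n.
pose p k b := law P (fun o => (K o, B o)) (k, b).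
pose q b := law P B b.
have hp k b : 0 <= p k b by apply: law_ge0.
have hq b : 0 <= q b by apply: law_ge0.
have hpq b : q b = \sum_k p k b by rewrite /q -(law_fst P K).
have hple k b : p k b <= q b by apply: law_pair_le.
have hkey k b : xlg (p k b) - p k b * lg (q b) + p k b * lg M <= `|p k b - q b / M| * (lg M + 2).
  have hl : 0 <= lg M by apply: lg_ge0.
  have hr : 0 <= `|p k b - q b / M| * (lg M + 2) by rewrite mulr_ge0 // addr_ge0.
  have [h0|h0] := ltP 0 (p k b); last first.
    have -> : p k b = 0 by apply/le_anti; rewrite hp h0.
    by rewrite xlg0 !mul0r subrr add0r mulr_ge0 // addr_ge0.
  have hq0 : 0 < q b by apply: lt_le_trans h0 (hple k b).
  rewrite (xlgE (ltW h0)); set x := p k b / q b * M.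
  have hx : 0 < x by rewrite !mulr_gt0 ?invr_gt0.
  have -> : p k b * lg (p k b) - p k b * lg (q b) + p k b * lg M = p k b * lg x.
    by rewrite /x !lgM ?divr_gt0 ?invr_gt0 // lgV //; ring.
  have /orP[hx1|hx1] := le_total x 1.
    apply: (le_trans _ hr); rewrite pmulr_rle0 // -lg1; exact: lg_le.
  have -> : p k b = q b / M * x by rewrite /x; field; rewrite !gt_eqF.
  have -> : q b / M * x - q b / M = q b / M * (x - 1) by ring.
  have hqM : 0 <= q b / M by rewrite divr_ge0 // ltW.
  have -> : `|q b / M * (x - 1)| = q b / M * (x - 1).
    by rewrite ger0_norm // mulr_ge0 // subr_ge0.
  rewrite -2!mulrA -[leRHS]mulrA -[leRHS]mulrA; apply: ler_wpM2l => //.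
  apply: ler_wpM2l; first by rewrite invr_ge0 ltW.
  have h1 : lg x <= lg M.
    by apply: lg_le => //; rewrite /x -[leRHS]mul1r ler_wpM2r ?ler0n // ler_pdivrMr // mul1r.
  have h2 : lg x <= (x - 1) * 2.
    apply: le_trans (lg_sub1 hx) _; apply: ler_wpM2l ln2V_le2; by rewrite subr_ge0.
  have h3 : (x - 1) * lg x <= (x - 1) * lg M by apply: ler_wpM2l => //; rewrite subr_ge0.
  by rewrite mulrDr; lra.
have hs : \sum_k \sum_b (xlg (p k b) - p k b * lg (q b) + p k b * lg M) <= d * (lg M + 2).
  apply: (@le_trans _ _ (dev P K B * (lg M + 2))); last first.
    by apply: ler_wpM2r => //; rewrite addr_ge0 // lg_ge0.
  rewrite /dev mulr_suml; apply: ler_sum => k _; rewrite mulr_suml; apply: ler_sum => b _.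
  exact: hkey.
have e : \sum_k \sum_b (xlg (p k b) - p k b * lg (q b) + p k b * lg M) =
   - ent P (fun o => (K o, B o)) + ent P B + lg M.
  rewrite !entE !opprK sum_pair.
  have hM1s : \sum_k \sum_b p k b * lg M = lg M.
    under eq_bigr do rewrite -mulr_suml.
    by rewrite -mulr_suml -sum_pair law_total hP1 mul1r.
  have -> : \sum_a xlg (law P B a) = \sum_k \sum_b p k b * lg (q b).
    rewrite exchange_big; apply: eq_bigr => b _ /=.
    by rewrite -mulr_suml -hpq (xlgE (hq b)).
  rewrite -[X in _ = _ + X]hM1s -sumrB -big_split; apply: eq_bigr => k _ /=.
  by rewrite -sumrB -big_split.
by rewrite e in hs; lra.
Qed.

End Ent.

Section Achieve.
Variables X Y Yh Z : finType.
Variable W : X -> Y * Yh * Z -> R.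

Lemma leq_keyM n Rk k : k%:R <= pw2 (n%:R * Rk) -> (k <= keyM n Rk)%N.
Proof.
rewrite /keyM INRE -/(pw2 (n%:R * Rk)) => h.
have [h1 h2] := base_Int_part (pw2 (n%:R * Rk)).
set I := Int_part _ in h1 h2 *.
have hk : Rlt (IZR (Z.of_nat k)) (IZR (I + 1)).
  rewrite plus_IZR -INR_IZR_INZ INRE; apply: Rle_lt_trans (elimT RleP h) _.
  by move: h2; set q := pw2 _; Lra.lra.
move/lt_IZR: hk => hk; lia.
Qed.

(** The key is embedded injectively into the prescribed alphabet, which leaves its entropy
    unchanged; the gap between [n * Rk] and [lg #|K|] is charged to the uniformity condition.
    Leakage and uniformity both come from [cond_ent_dev], with Eve's output and with nothing as side
    information. *)
Lemma good_SK_of_tv (K : finType) n Rk eps e1 e2 :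
  (forall x w, 0 <= W x w) -> (forall x, \sum_w W x w = 1) ->
  (0 < n)%N -> (0 < #|K|)%N -> #|K|%:R <= pw2 (n%:R * Rk) ->
  tv_code W n K e1 e2 -> e1 <= eps ->
  e2 * (lg #|K|%:R + 2) <= eps * n%:R ->
  n%:R * Rk - lg #|K|%:R + e2 * (lg #|K|%:R + 2) <= eps * n%:R ->
  good_SK_code W Rk n eps.
Proof.
move=> W0 W1 hn hK hKM [Rr [pr [phi [psia [psib [hpr hpr1 herr hdev]]]]]] he1 he2 he3.
have hn0 : 0 < n%:R :> R by rewrite ltr0n.
have hM := leq_keyM hKM.
pose io (k : K) : 'I_(keyM n Rk) := widen_ord hM (enum_rank k).
have io_inj : injective io.
  by move=> k k' /(congr1 val) /= h; apply: enum_rank_inj; apply: val_inj.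
have [k0 _] : exists k : K, true by move/card_gt0P: hK => [k _]; exists k.
pose oi i := odflt k0 [pick k | io k == i].
have ioK : cancel io oi.
  move=> k; rewrite /oi; case: pickP => [k' /eqP /io_inj //|/(_ k)]; by rewrite eqxx.
exists Rr, pr, phi, (fun s y => io (psia s y)), (fun y => io (psib y)).
split; first by split; [move=> r; apply/RleP; exact: hpr|exact: hpr1].
set P := code_pmf W pr phi; cbv zeta.
have hP0 o : 0 <= P o by apply: mulr_ge0 => //; apply: prodr_ge0 => i _; apply: W0.
have hP1 : \sum_o P o = 1 by exact: (cprob_sum phi W1 hpr1).
set Kf := (fun o => io _); set Zf := (fun o => Zseq _).
pose Kr (o : Rr * {ffun 'I_n -> Y * Yh * Z}) := psia o.1 (Yhseq o.2).
have hdev' : dev P Kr Zf <= e2 by exact: hdev.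
have hdev1 : dev P Kr (fun _ => tt) <= e2.
  by apply: le_trans hdev'; apply: (@dev_coarse_eq _ _ _ _ _ P Kr Zf _ (fun _ => tt)).
have hKK : ent P Kf = ent P Kr by apply: (@ent_cancel _ _ _ _ _ _ io oi) => o //; rewrite ioK.
have h1 := cond_ent_dev hP0 hP1 hK hdev'.
have h2 := cond_ent_dev hP0 hP1 hK hdev1.
have h3 := ent_le_card Kr hP0 hP1 hK.
have htt : ent P (fun _ => tt) = 0.
  rewrite entE (bigD1 tt) //= big1 ?addr0; last by case.
  by rewrite /law (eq_bigl xpredT) // hP1 xlgE // lg1 mulr0 oppr0.
have hKt : ent P (fun o => (Kr o, tt)) = ent P Kr.
  exact: (@ent_cancel _ _ _ _ _ _ (fun k => (k, tt)) (fst)).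
have hmi : mi P Kf Zf = ent P Kr + ent P Zf - ent P (fun o => (Kr o, Zf o)).
  rewrite /mi /cmi htt.
  have -> : ent P (fun o => (Kf o, tt)) = ent P Kr.
    by apply: (@ent_cancel _ _ _ _ _ _ (fun k => (io k, tt)) (fun p => oi p.1)) => o //=; rewrite ioK.
  have -> : ent P (fun o => (Zf o, tt)) = ent P Zf.
    exact: (@ent_cancel _ _ _ _ _ _ (fun k => (k, tt)) (fst)).
  have -> : ent P (fun o => (Kf o, Zf o, tt)) = ent P (fun o => (Kr o, Zf o)).
    by apply: (@ent_cancel _ _ _ _ _ _ (fun p => (io p.1, p.2, tt)) (fun p => (oi p.1.1, p.1.2))) => o //=; rewrite ioK.
  by rewrite RminusE RminusE RplusE subr0.
split; first last.
  split; apply/RleP; rewrite INRE RdivE ler_pdivrMr //.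
    rewrite hmi; apply: le_trans he2; lra.
  by rewrite hKK RminusE RmultE; apply: le_trans he3; rewrite hKt htt in h2; lra.
apply/RleP; apply: le_trans he1; apply: le_trans herr.
rewrite [leRHS]big_mkcond le_eqVlt; apply/orP; left; apply/eqP; apply: eq_bigr => o _.
by rewrite (inj_eq io_inj).
Qed.
End Achieve.

Definition has_block_scheme (X Y Yh Z : finType) (W : X -> Y * Yh * Z -> R) (K : finType) (d : R) : Prop :=
  exists (S V G F : finType) (B : finZmodType) (pS : S -> R) (xw : S -> X) (pV : S -> Yh -> V -> R)
    (g : S -> G) (be : S -> B) (f : V -> F) (b : V -> B) (kap : S -> V -> K)
    (dec1 : Y -> G -> B) (dec2 : Y -> G -> F -> B -> K),
    [/\ (forall s, 0 <= pS s) /\ \sum_s pS s = 1,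
        (forall s y v, 0 <= pV s y v) /\ (forall s y, \sum_v pV s y v = 1),
        (0 < #|G|)%N, (0 < #|F|)%N &
        block_scheme_spec W pS xw pV g be f b kap dec1 dec2 d].

(** The factor 4 allows for rounding down two key alphabets, one for [U] and one for [V], each by a
    factor of at most 2. *)
Definition block_rate (X Y Yh Z : finType) (W : X -> Y * Yh * Z -> R) (Rk : R) : Prop :=
  forall d : R, 0 < d -> exists n0 : nat, forall n : nat, (n0 <= n)%N ->
  exists K : finType, [/\ pw2 (n.+1%:R * Rk) <= 4 * #|K|%:R, #|K|%:R <= pw2 (n.+1%:R * Rk) &
    has_block_scheme (block_channel W (n := n.+1)) K d].

Lemma exists_nat_ge (x : R) : exists n : nat, x <= n%:R.
Proof.
exists (Num.truncn `|x|).+1; apply: le_trans (ler_norm x) _; apply: ltW; exact: truncnS_gt.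
Qed.

(** * Choosing the number and the length of the blocks *)

Section Blocks.
Variables X Y Yh Z : finType.
Variable W : X -> Y * Yh * Z -> R.
Hypothesis W0 : forall x w, 0 <= W x w.
Hypothesis W1 : forall x, \sum_w W x w = 1.
Variable x0 : X.

Lemma block_channel_ge0 n x w : 0 <= block_channel W (n := n) x w.
Proof. by apply: prodr_ge0. Qed.

Lemma block_channel_sum n x : \sum_w block_channel W (n := n) x w = 1.
Proof.
pose s (w : {ffun 'I_n -> Y * Yh * Z}) := ([ffun i => (w i).1.1], [ffun i => (w i).1.2], [ffun i => (w i).2]).
pose t (w : {ffun 'I_n -> Y} * {ffun 'I_n -> Yh} * {ffun 'I_n -> Z}) := [ffun i => (w.1.1 i, w.1.2 i, w.2 i)].
rewrite (reindex s) /=; last first.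
  exists t => [w _|[[y yh] z] _].
    by apply/ffunP => i; rewrite !ffunE /= ?ffunE; case: (w i) => [[]].
  by congr (_, _, _); apply/ffunP => i; rewrite !ffunE.
rewrite (eq_bigr (fun w : {ffun 'I_n -> Y * Yh * Z} => \prod_i W (x i) (w i))).
  by rewrite -(bigA_distr_bigA (fun i => W (x i))); apply: big1.
move=> w _; rewrite /block_channel; apply: eq_bigr => i _; rewrite !ffunE.
by case: (w i) => [[]].
Qed.

Lemma achievable_of_block_rate Rk : 0 <= Rk -> block_rate W Rk -> SK_achievable W Rk.
Proof.
move=> hRk hblk eps' /RltP heps'; set eps : R := eps'.
have heps : 0 < eps by [].
(* Losing the key of the last block costs the fraction [1 / m.+1] of the rate, which this [m] makes
   at most [eps / 4]. *)
have [m hm] := exists_nat_ge (4 * Rk / eps).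
have hm1 : Rk <= eps / 4 * m.+1%:R.
  have -> : m.+1%:R = m%:R + 1 :> R by rewrite natr1. move: hm; rewrite ler_pdivrMr // => hm; lra.
set m1 : R := m.+1%:R in hm1 *.
have hm0 : 0 < m1 by rewrite ltr0n.
(* Chosen so that [9 * m1 * d * (Rk + 2) = eps / 2], where [9 * m1 * d] comes from [block_tv_code]
   and [(Rk + 2) * N] bounds [lg] of the key alphabet plus 2. *)
pose d : R := eps / (18 * m1 * (Rk + 2)).
have hRk2 : 0 < Rk + 2 by rewrite ltr_wpDl.
have hd : 0 < d by rewrite divr_gt0 // !mulr_gt0.
have [n0 hn0] := hblk d hd.
(* From [N1] on, the remainder of fewer than [m.+1] uses and the two bits lost by rounding in each
   block cost at most another [eps / 4]. *)
have [N1 hN1] := exists_nat_ge ((m%:R * Rk + 2 * m%:R) / (eps / 4)).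
exists (maxn N1 (n0.+1 * m.+1)%N) => N; rewrite geq_max => /andP[hN hN'].
pose n1 := (N %/ m.+1)%N.
have hn1 : (n0.+1 <= n1)%N by rewrite /n1 leq_divRL.
have [n hn] : exists n, n1 = n.+1 by exists n1.-1; rewrite prednK // (leq_trans _ hn1).
have hnn0 : (n0 <= n)%N by rewrite -ltnS -hn.
have [K [hK1 hK2 hsch]] := hn0 n hnn0.
have hNdec : N = (m.+1 * n.+1 + N %% m.+1)%N.
  by rewrite -hn /n1 mulnC -divn_eq.
set r := (N %% m.+1)%N in hNdec.
have hr : (r <= m)%N by rewrite -ltnS ltn_pmod.
have hK0 : (0 < #|K|)%N.
  rewrite lt0n; apply/eqP => h; move: hK1; rewrite h mulr0 leNgt pw2_gt0 //.
case: hsch => S [V [G [F [B [pS [xw [pV [g [be [f [b [kap [dec1 [dec2 [[pS0 pS1] [pV0 pV1] hG hF hspec]]]]]]]]]]]]]]].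
have y0 : {ffun 'I_n.+1 -> Yh}.
  case: (pickP (fun _ : Y * Yh * Z => true)) => [[[_ y] _] _|h]; first exact: [ffun=> y].
  by exfalso; have := W1 x0; rewrite big_pred0 // => /eqP; rewrite eq_sym oner_eq0.
have htv := block_tv_code m y0 pS0 pS1 (@block_channel_ge0 n.+1) (@block_channel_sum n.+1) pV0 pV1 hG hF hK0 (ltW hd) hspec.
have := tv_code_unblock x0 r W0 W1 htv; rewrite -hNdec -/m1 => {}htv.
have hcard : #|{: {ffun 'I_m -> K}}|%:R = #|K|%:R ^+ m :> R by rewrite card_ffun card_ord natrX.
have hNR : N%:R = m1 * n.+1%:R + r%:R :> R by rewrite {1}hNdec natrD natrM.
have hNpos : (0 < N)%N by rewrite hNdec addn_gt0.
have hKr : 0 < #|K|%:R :> R by rewrite ltr0n.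
set n1r : R := n.+1%:R in hNR hK1 hK2 *.
have hn1r : 0 < n1r by rewrite ltr0n.
set mr : R := m%:R in hN1 *.
have hmr : 0 <= mr by rewrite ler0n.
have hm1r : m1 = mr + 1 by rewrite /m1 /mr natr1.
have hr0 : 0 <= r%:R :> R by rewrite ler0n.
have hr1 : r%:R <= mr by rewrite ler_nat.
have hlgK : n1r * Rk - 2 <= lg #|K|%:R.
  have h4 : lg (4 : R) = 2.
    have -> : (4 : R) = pw2 (2%:R * 1); last by rewrite lg_pw2 mulr1.
    rewrite pw2Mn /pw2 Rpower_1 ?expr2; last by apply/RltP.
    by ring.
  have : lg (pw2 (n1r * Rk)) <= lg (4 * #|K|%:R) by apply: lg_le => //; apply: pw2_gt0.
  by rewrite lg_pw2 lgM // h4; lra.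
have hlgK2 : lg #|K|%:R <= n1r * Rk.
  by rewrite -[leRHS]lg_pw2; apply: lg_le.
have hlgKm : lg (#|K|%:R ^+ m) = mr * lg #|K|%:R.
  exact: lgX.
have hNr : 0 < N%:R :> R by rewrite ltr0n.
have he2 : 9 * m1 * d = eps / (2 * (Rk + 2)).
  rewrite /d; field; apply/andP; split; apply: lt0r_neq0 => //.
  by rewrite addrC natr1.
have hN1r : mr * Rk + 2 * mr <= eps / 4 * N%:R.
  have h : N1%:R <= N%:R :> R by rewrite ler_nat.
  move: (le_trans hN1 h); by rewrite ler_pdivrMr ?divr_gt0 // [N%:R * _]mulrC.
have hlgup : lg (#|K|%:R ^+ m) <= N%:R * Rk.
  rewrite hlgKm; apply: (@le_trans _ _ (mr * (n1r * Rk))); first exact: ler_wpM2l.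
  rewrite mulrA; apply: ler_wpM2r => //; rewrite hNR hm1r mulrDl mul1r; lra.
have hfin : 9 * m1 * d * (lg (#|K|%:R ^+ m) + 2) <= eps / 2 * N%:R.
  rewrite he2; have -> : eps / 2 * N%:R = eps / (2 * (Rk + 2)) * ((Rk + 2) * N%:R) by field; rewrite gt_eqF.
  apply: ler_wpM2l; first by rewrite divr_ge0 ?ltW // mulr_gt0.
  have : 1 <= N%:R :> R by rewrite ler1n.
  nra.
apply: (good_SK_of_tv W0 W1 hNpos _ _ htv); rewrite ?hcard.
- by rewrite card_ffun expn_gt0 hK0.
- apply: (@le_trans _ _ (pw2 (lg (#|K|%:R ^+ m)))); first by rewrite pw2_lg ?exprn_gt0.
  by rewrite ler_pw2.
- rewrite he2 ler_pdivrMr ?mulr_gt0 //; nra.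
- apply: le_trans hfin _; rewrite ler_pM2r //; lra.
have h1 : N%:R * Rk - lg (#|K|%:R ^+ m) <= eps / 2 * N%:R.
  rewrite hlgKm; have h : mr * (n1r * Rk - 2) <= mr * lg #|K|%:R by apply: ler_wpM2l.
  have h2 : n1r * Rk <= n1r * (eps / 4 * m1) by apply: ler_wpM2l => //; apply: ltW.
  have h3 : r%:R * Rk <= mr * Rk by apply: ler_wpM2r.
  have h4 : eps / 4 * (m1 * n1r) <= eps / 4 * N%:R.
    by apply: ler_wpM2l; [lra|rewrite hNR lerDl ler0n].
  rewrite {1}hNR hm1r in h4 *; rewrite hm1r in h2.
  nra.
by apply: le_trans (lerD h1 hfin) _; rewrite -mulrDl -splitr.
Qed.

End Blocks.

(** * Random hashing of memoryless sources *)

Section Asymptotic.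
Variables O TA TB : finType.
Variables (P : O -> R) (A : O -> TA) (B : O -> TB).
Hypothesis P_ge0 : forall o, 0 <= P o.
Hypothesis P1 : \sum_o P o = 1.

Definition cond_ent : R := ent P (fun o => (A o, B o)) - ent P B.

(** The conditional information density, whose mean is [cond_ent]. *)
Definition info (o : O) : R :=
  lg (law P B (B o)) - lg (law P (fun o => (A o, B o)) (A o, B o)).

Lemma sum_info : \sum_o P o * info o = cond_ent.
Proof.
have hs (T : finType) (C : O -> T) : \sum_o P o * lg (law P C (C o)) = - ent P C.
  rewrite entE opprK -(sum_law P C (fun c => lg (law P C c))).
  by apply: eq_bigr => c _; rewrite xlgE // law_ge0.
rewrite /info; under eq_bigr do rewrite mulrBr.
rewrite sumrB (hs _ B) (hs _ (fun o => (A o, B o))) /cond_ent.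
by move: (ent P B) (ent P _) => x y; ring.
Qed.

Lemma law_gt0 (T : finType) (C : O -> T) o : P o != 0 -> 0 < law P C (C o).
Proof.
move=> h; rewrite /law (bigD1 o) //= ltr_pwDl ?sumr_ge0 //.
by rewrite lt_neqAle eq_sym h P_ge0.
Qed.

Lemma lg_prod (I : finType) (F : I -> R) : (forall i, 0 < F i) ->
  lg (\prod_i F i) = \sum_i lg (F i).
Proof.
move=> hF; suff [_ ->] : 0 < \prod_i F i /\ lg (\prod_i F i) = \sum_i lg (F i) by [].
apply: (big_ind2 (fun x y => 0 < x /\ lg x = y)) => [|x1 x2 y1 y2 [h1 <-] [h2 <-]|i _].
- by rewrite lg1.
- by rewrite mulr_gt0 // lgM.
- by [].
Qed.

Lemma info_iid n (o : {ffun 'I_n -> O}) : iid P o != 0 ->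
  [/\ 0 < law (@iid R O P n) (@vec O TB B n) (vec B o),
      0 < law (@iid R O P n) (fun o => (vec A o, vec B o)) (vec A o, vec B o) &
      lg (law (@iid R O P n) (@vec O TB B n) (vec B o)) -
      lg (law (@iid R O P n) (fun o => (vec A o, vec B o)) (vec A o, vec B o)) =
      \sum_i info (o i)].
Proof.
move=> ho.
have hi i : P (o i) != 0.
  by apply: contraNneq ho => h; rewrite /iid (bigD1 i) //= h mul0r.
rewrite law_iid law_iid2 /iid.
have hB i : 0 < law P B (vec B o i) by rewrite ffunE law_gt0.
have hAB i : 0 < law P (fun o => (A o, B o)) (vec A o i, vec B o i).
  by rewrite !ffunE (law_gt0 (fun o => (A o, B o))).
split; [exact: prodr_gt0|exact: prodr_gt0|].
by rewrite !lg_prod // -sumrB; apply: eq_bigr => i _; rewrite !ffunE.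
Qed.

Lemma pw2_vanish (e c : R) : 0 < e -> 0 < c ->
  exists n0 : nat, forall n : nat, (n0 <= n)%N -> pw2 (- (n%:R * e)) <= c.
Proof.
move=> he hc; have [n0 hn0] := exists_nat_ge (- lg c / e).
exists n0 => n hn; rewrite -[leRHS]pw2_lg // ler_pw2 lerNl.
by rewrite -ler_pdivrMr //; apply: le_trans hn0 _; rewrite ler_nat.
Qed.

(** The event [E] is arbitrary so that either tail can be taken: too large a conditional probability
    spoils hashing, too small a one spoils decoding. *)
Lemma info_deviation (e d : R) : 0 < e -> 0 < d ->
  exists n0 : nat, forall n : nat, (n0 <= n)%N -> (0 < n)%N /\
  forall E : pred {ffun 'I_n -> O},
    (forall o, E o -> iid P o != 0 -> n%:R * e <= `|\sum_i info (o i) - n%:R * cond_ent|) ->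
    \sum_(o | E o) iid P o <= d.
Proof.
move=> he hd.
pose g o := info o - cond_ent.
have hg : \sum_o P o * g o = 0.
  rewrite /g; under eq_bigr do rewrite mulrBr.
  by rewrite sumrB sum_info -mulr_suml P1 mul1r subrr.
set v := \sum_o P o * g o ^+ 2.
have hv : 0 <= v by apply: sumr_ge0 => o _; rewrite mulr_ge0 ?sqr_ge0.
have [n0 hn0] := exists_nat_ge (v / (d * e ^+ 2)).
exists n0.+1 => n hn; have hn1 : (0 < n)%N by apply: leq_trans hn.
split=> // E hE.
have hnr : 0 < n%:R :> R by rewrite ltr0n.
apply: le_trans (chebyshev P_ge0 P1 hg he hn1 _) _.
  move=> o hEo ho; apply: le_trans (hE o hEo ho) _.
  by rewrite /g [X in _ <= `|X|]sumrB sumr_const card_ord mulr_natl.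
have he2 : 0 < e ^+ 2 by rewrite exprn_gt0.
rewrite -/v ler_pdivrMr ?mulr_gt0 // mulrCA -ler_pdivrMr ?mulr_gt0 //.
apply: le_trans hn0 _; rewrite ler_nat; exact: ltnW.
Qed.

(** The alternative [#|TK| = 1] absorbs rates that are not positive: alphabets always keep at least
    one element, even where [pw2] of the exponent is below 1. *)
Lemma asym_dev (e d : R) : 0 < e -> 0 < d ->
  exists n0 : nat, forall n : nat, (n0 <= n)%N ->
  forall (TH TK : finType) (pi : TH -> TK), (0 < #|TH|)%N -> balanced R pi ->
  #|TK| = 1%N \/ #|TK|%:R <= pw2 (n%:R * (cond_ent - e)) ->
  avg (fun h : {ffun {ffun 'I_n -> TA} -> TH} =>
    dev (@iid R O P n) (fun o => pi (h (vec A o))) (@vec O TB B n)) <= d.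
Proof.
move=> he hd.
have he2 : 0 < e / 2 by rewrite divr_gt0.
have hd4 : 0 < d / 4 by rewrite divr_gt0.
have [n1 h1] := info_deviation he2 hd4.
have hd2 : 0 < (d / 2) ^+ 2 by rewrite exprn_gt0 // divr_gt0.
have [n2 h2] := pw2_vanish he2 hd2.
exists (maxn n1 n2) => n; rewrite geq_max => /andP[hn1 hn2] TH TK pi hTH hpi [hK|hK].
  rewrite (eq_avg (g := fun _ => 0)) => [|h]; last exact: dev_card1.
  by rewrite avg_const ?ltW // card_ffun expn_gt0 hTH.
have [hn0 {}h1] := h1 n hn1; have {}h2 := h2 n hn2.
(* Half of [e] separates typical conditional probabilities from [tau]; the other half makes
   [#|TK| * tau] vanish. *)
pose tau := pw2 (- (n%:R * (cond_ent - e / 2))).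
pose good (a : {ffun 'I_n -> TA}) (b : {ffun 'I_n -> TB}) :=
  law (@iid R O P n) (fun o => (vec A o, vec B o)) (a, b) <= tau * law (@iid R O P n) (@vec O TB B n) b.
apply: le_trans (avg_dev_hash (good := good) (tau := tau) (s := d / 2) hTH hpi _ _ _ _ _ _) _ => //.
- by move=> o; apply: iid_ge0.
- by rewrite sum_iid.
- exact/ltW/pw2_gt0.
- by rewrite divr_gt0.
- apply: le_trans h2; apply: le_trans (ler_wpM2r _ hK) _; first exact/ltW/pw2_gt0.
  by rewrite /tau -pw2D ler_pw2 le_eqVlt; apply/orP; left; apply/eqP; field.
have : \sum_(o | ~~ good (vec A o) (vec B o)) iid P o <= d / 4.
  apply: h1 => o; rewrite -ltNge => hgood ho.
  have [hB hAB hi] := info_iid ho.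
  have : lg (tau * law (@iid R O P n) (@vec O TB B n) (vec B o)) <=
         lg (law (@iid R O P n) (fun o => (vec A o, vec B o)) (vec A o, vec B o)).
    by apply: lg_le; [rewrite mulr_gt0 ?pw2_gt0|exact: ltW].
  rewrite lgM ?pw2_gt0 // lg_pw2 => hl.
  rewrite -hi distrC; apply: le_trans (ler_norm _); lra.
by lra.
Qed.

Lemma asym_err (e d : R) : 0 < e -> 0 < d ->
  exists n0 : nat, forall n : nat, (n0 <= n)%N ->
  forall (TH TK : finType) (pi : TH -> TK), (0 < #|TH|)%N -> balanced R pi ->
  pw2 (n%:R * (cond_ent + e)) <= #|TK|%:R ->
  exists dec : {ffun {ffun 'I_n -> TA} -> TH} -> {ffun 'I_n -> TB} -> TK -> {ffun 'I_n -> TA},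
  avg (fun h : {ffun {ffun 'I_n -> TA} -> TH} =>
    \sum_(o | dec h (vec B o) (pi (h (vec A o))) != vec A o) @iid R O P n o) <= d.
Proof.
move=> he hd.
have [o0 _] : exists o : O, true.
  case: (pickP (fun _ : O => true)) => [o _|h]; first by exists o.
  by have := P1; rewrite big_pred0 // => /eqP; rewrite eq_sym oner_eq0.
have he2 : 0 < e / 2 by rewrite divr_gt0.
have hd2 : 0 < d / 2 by rewrite divr_gt0.
have [n1 h1] := info_deviation he2 hd2.
have [n2 h2] := pw2_vanish he2 hd2.
exists (maxn n1 n2) => n; rewrite geq_max => /andP[hn1 hn2] TH TK pi hTH hpi hK.
have [hn0 {}h1] := h1 n hn1; have {}h2 := h2 n hn2.
(* The slack is split as for hashing: half for typicality, half to make collisions rare. *)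
pose tau := pw2 (- (n%:R * (cond_ent + e / 2))).
pose good (a : {ffun 'I_n -> TA}) (b : {ffun 'I_n -> TB}) :=
  tau * law (@iid R O P n) (@vec O TB B n) b <= law (@iid R O P n) (fun o => (vec A o, vec B o)) (a, b).
have hiid0 : forall o, 0 <= @iid R O P n o by move=> o; apply: iid_ge0.
have hiid1 : \sum_o @iid R O P n o <= 1 by rewrite sum_iid.
have [dec hdec] := avg_err_hash (A := @vec O TA A n) (B := @vec O TB B n) (good := good)
  [ffun=> A o0] hTH hpi hiid0 hiid1 (pw2_gt0 _ : 0 < tau) (fun a b h => h).
exists dec; apply: le_trans hdec _; rewrite (splitr d); apply: lerD.
  apply: h1 => o; rewrite -ltNge => hgood ho.
  have [hB hAB hi] := info_iid ho.
  have : lg (law (@iid R O P n) (fun o => (vec A o, vec B o)) (vec A o, vec B o)) <=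
         lg (tau * law (@iid R O P n) (@vec O TB B n) (vec B o)).
    by apply: lg_le => //; exact: ltW.
  rewrite lgM ?pw2_gt0 // lg_pw2 => hl.
  rewrite -hi; apply: le_trans (ler_norm _); lra.
apply: le_trans h2; rewrite invfM -pw2N opprK.
rewrite ler_pdivrMr; last by apply: lt_le_trans hK; apply: pw2_gt0.
apply: le_trans (ler_wpM2l _ hK); last exact/ltW/pw2_gt0.
by rewrite -pw2D ler_pw2 le_eqVlt; apply/orP; left; apply/eqP; field.
Qed.

End Asymptotic.

Lemma balanced_bij (F : realFieldType) (T T' : finType) (pi : T -> T') : bijective pi -> balanced F pi.
Proof.
move=> hpi k; case: (hpi) => pi' hk hk'.
rewrite /avg (bigD1 (pi' k)) //= hk' eqxx big1 ?addr0 ?mul1r; last first.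
  by move=> t ht; case: eqP => // h; move: ht; rewrite -h hk eqxx.
by rewrite (bij_eq_card hpi).
Qed.

Lemma balanced_id (F : realFieldType) (T : finType) : balanced F (fun x : T => x).
Proof. by apply: balanced_bij; exists (fun x : T => x). Qed.

Lemma balanced_comp (F : realFieldType) (T T' T'' : finType) (p1 : T -> T') (p2 : T' -> T'') :
  balanced F p1 -> balanced F p2 -> balanced F (p2 \o p1).
Proof.
move=> h1 h2 k.
have -> : avg (fun h => ((p2 \o p1) h == k)%:R) =
          avg (fun h => \sum_(t | p2 t == k) (p1 h == t)%:R) :> F.
  apply: eq_avg => h; rewrite big_mkcond (bigD1 (p1 h)) //= eqxx big1 ?addr0.
    by case: (_ == _).
  by move=> t ht; rewrite [p1 h == t]eq_sym (negbTE ht) if_same.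
rewrite avg_sum (eq_bigr (fun _ => (#|T'|%:R)^-1)) => [|t _]; last exact: h1.
rewrite -(h2 k) /avg mulr_suml big_mkcond; apply: eq_bigr => t _.
by case: (_ == _); rewrite ?mul1r ?mul0r.
Qed.

Lemma sum_push (F : realFieldType) (O O' : finType) (P : O -> F) (P' : O' -> F) (h : O' -> O) (E : pred O) :
  (forall o, law P' h o = P o) -> \sum_(o | E (h o)) P' o = \sum_(o | E o) P o.
Proof.
move=> hP; rewrite (partition_big h E) //=; apply: eq_bigr => o ho.
rewrite -hP; apply: eq_bigl => o'.
by case: (eqVneq (h o') o) => [->|]; rewrite ?ho ?andbF.
Qed.

Lemma err_le2 (F : realFieldType) (O : finType) (P : O -> F) (E E1 E2 : pred O) :
  (forall o, 0 <= P o) -> (forall o, ~~ E1 o -> ~~ E2 o -> ~~ E o) ->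
  \sum_(o | E o) P o <= \sum_(o | E1 o) P o + \sum_(o | E2 o) P o.
Proof.
move=> hP hE; rewrite big_mkcond [X in _ <= X + _]big_mkcond [X in _ <= _ + X]big_mkcond -big_split /=.
apply: ler_sum => o _; move: (hE o) (hP o).
case: (E o); case: (E1 o); case: (E2 o); rewrite /= => h h0; rewrite ?addr0 ?add0r ?lerDl ?addr_ge0 //.
by have := h isT isT.
Qed.

Definition vmap (T T' : finType) (phi : T -> T') n (f : {ffun 'I_n -> T}) : {ffun 'I_n -> T'} :=
  [ffun i => phi (f i)].

Definition vzip (T T' : finType) n (a : {ffun 'I_n -> T}) (b : {ffun 'I_n -> T'}) : {ffun 'I_n -> T * T'} :=
  [ffun i => (a i, b i)].

Lemma vec_vmap (O T T' : finType) (A : O -> T) (phi : T -> T') n (o : {ffun 'I_n -> O}) :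
  vmap phi (vec A o) = vec (fun o => phi (A o)) o.
Proof. by apply/ffunP => i; rewrite !ffunE. Qed.

Lemma vec_vzip (O T T' : finType) (A : O -> T) (B : O -> T') n (o : {ffun 'I_n -> O}) :
  vzip (vec A o) (vec B o) = vec (fun o => (A o, B o)) o.
Proof. by apply/ffunP => i; rewrite !ffunE. Qed.

(** * One block assembled from four random hashes *)

Section Scheme.
Variables Q U X Y Yh Z V T : finType.
Variable W : X -> Y * Yh * Z -> R.
Variables (pQU : Q * U -> R) (pXgU : U -> X -> R) (pVg : U * X * Yh -> V -> R) (pTgV : V -> T -> R).
Hypothesis W0 : forall x w, 0 <= W x w.
Hypothesis W1 : forall x, \sum_w W x w = 1.
Hypothesis pQU0 : forall p, 0 <= pQU p.
Hypothesis pQU1 : \sum_p pQU p = 1.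
Hypothesis pX0 : forall u x, 0 <= pXgU u x.
Hypothesis pX1 : forall u, \sum_x pXgU u x = 1.
Hypothesis pV0 : forall c v, 0 <= pVg c v.
Hypothesis pV1 : forall c, \sum_v pVg c v = 1.
Hypothesis pT0 : forall v t, 0 <= pTgV v t.
Hypothesis pT1 : forall v, \sum_t pTgV v t = 1.

Local Notation Om := (Omega1 Q U X Y Yh Z V T).
Local Notation P := (joint1 W pQU pXgU pVg pTgV).

Definition rQ (o : Om) : Q := o.1.1.1.1.1.
Definition rU (o : Om) : U := o.1.1.1.1.2.
Definition rX (o : Om) : X := o.1.1.1.2.
Definition rY (o : Om) : Y := o.1.1.2.1.1.
Definition rYh (o : Om) : Yh := o.1.1.2.1.2.
Definition rZ (o : Om) : Z := o.1.1.2.2.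
Definition rV (o : Om) : V := o.1.2.
Definition rT (o : Om) : T := o.2.
Definition rS (o : Om) : Q * U * X := o.1.1.1.

Lemma jointE o : P o =
  pQU (rQ o, rU o) * pXgU (rU o) (rX o) * W (rX o) (o.1.1.2) * pTgV (rV o) (rT o) *
  pVg (rU o, rX o, rYh o) (rV o).
Proof. by case: o => [[[[[q u] x] yyz] v] t]. Qed.

Lemma joint_ge0 o : 0 <= P o.
Proof. by rewrite jointE !mulr_ge0. Qed.

(** The block scheme is instantiated with sequences of triples (Q,U,X) as its input and of pairs
    (V,T) as its post-feedback variable. *)
Definition input_law (s : Q * U * X) : R := pQU s.1 * pXgU s.1.2 s.2.
Definition aux_law (s : Q * U * X) (y : Yh) (v : V * T) : R :=
  pTgV v.1 v.2 * pVg (s.1.2, s.2, y) v.1.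

Lemma input_law_ge0 s : 0 <= input_law s. Proof. by rewrite mulr_ge0. Qed.
Lemma aux_law_ge0 s y v : 0 <= aux_law s y v. Proof. by rewrite mulr_ge0. Qed.

Lemma input_law_sum : \sum_s input_law s = 1.
Proof.
rewrite sum_pair -[RHS]pQU1; apply: eq_bigr => qu _.
by rewrite /input_law /= -mulr_sumr pX1 mulr1.
Qed.

Lemma aux_law_sum s y : \sum_v aux_law s y v = 1.
Proof.
rewrite sum_pair -[RHS](pV1 (s.1.2, s.2, y)); apply: eq_bigr => v _.
by rewrite /aux_law /= -mulr_suml pT1 mul1r.
Qed.

Lemma joint_factor s w v : P (s, w, v.1, v.2) = input_law s * W s.2 w * aux_law s w.1.2 v.
Proof. by case: s => [[q u] x]; rewrite jointE /input_law /aux_law /= /rU /rX /rYh /rV /rT /rQ /=; ring. Qed.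

Lemma joint_sum : \sum_o P o = 1.
Proof.
rewrite sum_pair sum_pair.
have hr : \sum_s \sum_w \sum_v P (s, w, v.1, v.2) = 1.
  rewrite -[RHS]input_law_sum; apply: eq_bigr => s _.
  rewrite -[RHS]mulr1 -(W1 s.2) mulr_sumr; apply: eq_bigr => w _.
  rewrite -[RHS]mulr1 -(aux_law_sum s w.1.2) mulr_sumr; apply: eq_bigr => v _.
  exact: joint_factor.
rewrite -[RHS]hr sum_pair; apply: eq_bigr => s _; apply: eq_bigr => w _.
by rewrite sum_pair.
Qed.

Variable n : nat.
Local Notation vn T := {ffun 'I_n -> T}.
Local Notation Pn := (@iid R Om P n).
Local Notation Wn := (block_channel W (n := n)).

Definition seq_input (s : vn (Q * U * X)) : R := iid input_law s.
Definition seq_aux (s : vn (Q * U * X)) (y : vn Yh) (v : vn (V * T)) : R :=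
  \prod_i aux_law (s i) (y i) (v i).
Definition seq_x (s : vn (Q * U * X)) : vn X := vmap snd s.

Local Notation Blk := (vn (Q * U * X) * (vn Y * vn Yh * vn Z) * vn (V * T))%type.

Definition pack (o : Blk) : vn Om :=
  [ffun i => (o.1.1 i, (o.1.2.1.1 i, o.1.2.1.2 i, o.1.2.2 i), (o.2 i).1, (o.2 i).2)].
Definition unpack (o : vn Om) : Blk :=
  (vec rS o, (vec rY o, vec rYh o, vec rZ o), vec (fun o => (rV o, rT o)) o).

Lemma packK : cancel pack unpack.
Proof.
move=> [[s [[y yh] z]] v]; rewrite /unpack.
congr (_, (_, _, _), _); apply/ffunP => i; rewrite !ffunE //=.
by rewrite /rV /rT /= -surjective_pairing.
Qed.

Lemma unpackK : cancel unpack pack.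
Proof.
move=> o; apply/ffunP => i; rewrite !ffunE /= ?ffunE.
by case: (o i) => [[[[[q u] x] [[y yh] z]] v] t].
Qed.

Lemma law_pack o : law (blaw Wn seq_input seq_x seq_aux) pack o = Pn o.
Proof.
rewrite (law_bij _ _ packK unpackK) /blaw /seq_input /seq_aux /block_channel /iid -!big_split.
apply: eq_bigr => i _; rewrite /seq_x !ffunE /= ?ffunE -joint_factor.
by case: (o i) => [[[[[q u] x] [[y yh] z]] v] t].
Qed.

Lemma iid_joint_ge0 o : 0 <= Pn o.
Proof. by apply: iid_ge0; apply: joint_ge0. Qed.

Lemma law_iid_input s : law Pn (@vec _ _ rS n) s = seq_input s.
Proof.
rewrite law_iid /seq_input /iid; apply: eq_bigr => i _.
rewrite /law big_mkcond sum_pair sum_pair sum_pair (bigD1 (s i)) //= [X in _ + X]big1 ?addr0; last first.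
  by move=> s' hs; rewrite big1 // => w _; rewrite big1 // => v _; rewrite big1 // => t _; rewrite /rS /= (negbTE hs).
rewrite -[RHS]mulr1 -(W1 (s i).2) mulr_sumr; apply: eq_bigr => w _.
rewrite -[RHS]mulr1 -(aux_law_sum (s i) w.1.2) mulr_sumr sum_pair; apply: eq_bigr => v _.
apply: eq_bigr => t _; rewrite /rS /= eqxx; exact: (joint_factor (s i) w (v, t)).
Qed.

(* G and F: hashes agreed upon in advance; B: bin indices, carried by the input
   hashes for Q and U and sent to the next block for T and V; K: keys. *)
Variables GQ BQ GU BU KU FT BT FV BV KV : finType.
Variables (B : finZmodType) (iB : BQ * BU -> B) (emb : BT * BV -> B) (bme : B -> BT * BV).
Hypothesis iB_bij : bijective iB.
Hypothesis embK : cancel emb bme.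
Hypothesis GQ_gt0 : (0 < #|GQ|)%N.
Hypothesis GU_gt0 : (0 < #|GU|)%N.
Hypothesis FT_gt0 : (0 < #|FT|)%N.
Hypothesis FV_gt0 : (0 < #|FV|)%N.
Hypothesis BQ_gt0 : (0 < #|BQ|)%N.
Hypothesis BU_gt0 : (0 < #|BU|)%N.
Hypothesis KU_gt0 : (0 < #|KU|)%N.
Hypothesis BT_gt0 : (0 < #|BT|)%N.
Hypothesis BV_gt0 : (0 < #|BV|)%N.
Hypothesis KV_gt0 : (0 < #|KV|)%N.

(** In this condition and the next three, the requirements on one hash are averaged as a sum, so
    that one choice of the hash meets all of them; each sum has at most three terms, hence the
    common bound [3 * d]. *)
Definition public_ok d :=
  exists dec : {ffun vn Q -> GQ * BQ} -> vn Y -> GQ -> vn Q,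
  avg (fun h : {ffun vn Q -> GQ * BQ} =>
    dev Pn (fun o => h (vec rQ o)) (@vec _ _ (fun=> tt) n) +
    \sum_(o | dec h (vec rY o) (h (vec rQ o)).1 != vec rQ o) Pn o) <= 3 * d.

(** In the last term Eve is granted [Q^n] and [T^n], of which all hashes of [Q] and [T] are
    functions; this produces the loss I(U;Z|Q) + I(U;T|Q,Z). *)
Definition input_ok d :=
  exists dec : {ffun vn U -> GU * BU * KU} -> vn (Q * Y) -> GU -> vn U,
  avg (fun h : {ffun vn U -> GU * BU * KU} =>
    dev Pn (fun o => (h (vec rU o)).1) (@vec _ _ rQ n) +
    \sum_(o | dec h (vec (fun o => (rQ o, rY o)) o) (h (vec rU o)).1.1 != vec rU o) Pn o +
    dev Pn (fun o => h (vec rU o)) (@vec _ _ (fun o => (rZ o, rQ o, rT o)) n)) <= 3 * d.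

(** [FT] is imposed on Alice, so it must be nearly uniform given all that she knows when [T] is
    drawn; [BT] is the part that Bob receives through the next block. *)
Definition helper_ok d :=
  exists dec : {ffun vn T -> FT * BT} -> vn (U * Y) -> FT * BT -> vn T,
  avg (fun h : {ffun vn T -> FT * BT} =>
    dev Pn (fun o => (h (vec rT o)).1) (@vec _ _ (fun o => (rS o, rYh o)) n) +
    \sum_(o | dec h (vec (fun o => (rU o, rY o)) o) (h (vec rT o)) != vec rT o) Pn o) <= 3 * d.

(** In the last term Eve is granted [U^n] as well, so that this key can be stacked on the one from
    [U]. *)
Definition source_ok d :=
  exists dec : {ffun vn V -> FV * BV * KV} -> vn (T * (U * Y)) -> FV * BV -> vn V,
  avg (fun h : {ffun vn V -> FV * BV * KV} =>
    dev Pn (fun o => (h (vec rV o)).1.1) (@vec _ _ (fun o => (rT o, (rS o, rYh o))) n) +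
    \sum_(o | dec h (vec (fun o => (rT o, (rU o, rY o))) o) (h (vec rV o)).1 != vec rV o) Pn o +
    dev Pn (fun o => h (vec rV o)) (@vec _ _ (fun o => (rU o, (rZ o, rQ o, rT o))) n)) <= 3 * d.

(** Four decoding errors of at most [3 * d] each give [12 * d]; so does the key deviation, which is
    twice the sum of two terms of at most [3 * d]. *)
Lemma scheme_of_hashes d :
  public_ok d -> input_ok d -> helper_ok d -> source_ok d ->
  has_block_scheme Wn (KU * KV)%type (12 * d).
Proof.
have P0 := iid_joint_ge0.
case=> decQ; case/exists_le_avg.
  by rewrite card_ffun expn_gt0 card_prod muln_gt0 GQ_gt0 BQ_gt0.
move=> hQ hQle; case=> decU; case/exists_le_avg.
  by rewrite card_ffun expn_gt0 !card_prod !muln_gt0 GU_gt0 BU_gt0 KU_gt0.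
move=> hU hUle; case=> decT; case/exists_le_avg.
  by rewrite card_ffun expn_gt0 card_prod muln_gt0 FT_gt0 BT_gt0.
move=> hT hTle; case=> decV; case/exists_le_avg.
  by rewrite card_ffun expn_gt0 !card_prod !muln_gt0 FV_gt0 BV_gt0 KV_gt0.
move=> hV hVle.
set a1 := dev _ _ _ in hQle; set e1 := \sum_(o | _) _ in hQle.
set a2 := dev _ _ _ in hUle; set e2 := \sum_(o | _) _ in hUle; set a5 := dev _ _ _ in hUle.
set a3 := dev _ _ _ in hTle; set e3 := \sum_(o | _) _ in hTle.
set a4 := dev _ _ _ in hVle; set e4 := \sum_(o | _) _ in hVle; set a6 := dev _ _ _ in hVle.
have a1_0 : 0 <= a1 by apply: dev_ge0.
have a2_0 : 0 <= a2 by apply: dev_ge0.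
have a3_0 : 0 <= a3 by apply: dev_ge0.
have a4_0 : 0 <= a4 by apply: dev_ge0.
have a5_0 : 0 <= a5 by apply: dev_ge0.
have a6_0 : 0 <= a6 by apply: dev_ge0.
have e1_0 : 0 <= e1 by apply: sumr_ge0 => o _; apply: P0.
have e2_0 : 0 <= e2 by apply: sumr_ge0 => o _; apply: P0.
have e3_0 : 0 <= e3 by apply: sumr_ge0 => o _; apply: P0.
have e4_0 : 0 <= e4 by apply: sumr_ge0 => o _; apply: P0.
have d0 : 0 <= d by lra.
pose q (s : vn (Q * U * X)) : vn Q := vmap (fun x : Q * U * X => x.1.1) s.
pose u (s : vn (Q * U * X)) : vn U := vmap (fun x : Q * U * X => x.1.2) s.
pose v1 (v : vn (V * T)) : vn V := vmap fst v.
pose t1 (v : vn (V * T)) : vn T := vmap snd v.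
pose g (s : vn (Q * U * X)) := ((hQ (q s)).1, (hU (u s)).1.1).
pose be (s : vn (Q * U * X)) := iB ((hQ (q s)).2, (hU (u s)).1.2).
pose f (v : vn (V * T)) := ((hT (t1 v)).1, (hV (v1 v)).1.1).
pose b (v : vn (V * T)) := emb ((hT (t1 v)).2, (hV (v1 v)).1.2).
pose kap (s : vn (Q * U * X)) (v : vn (V * T)) := ((hU (u s)).2, (hV (v1 v)).2).
(* Successive decoding in the order Q, U, T, V, each decoder using the previous outputs. Only the
   last two need the bin index from the next block. *)
pose dQ (y : vn Y) (gg : GQ * GU) := decQ hQ y gg.1.
pose dU (y : vn Y) (gg : GQ * GU) := decU hU (vzip (dQ y gg) y) gg.2.
pose dT (y : vn Y) (gg : GQ * GU) (ff : FT * FV) (bb : B) := decT hT (vzip (dU y gg) y) (ff.1, (bme bb).1).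
pose dV (y : vn Y) (gg : GQ * GU) (ff : FT * FV) (bb : B) :=
  decV hV (vzip (dT y gg ff bb) (vzip (dU y gg) y)) (ff.2, (bme bb).2).
pose dec1 (y : vn Y) (gg : GQ * GU) := iB ((hQ (dQ y gg)).2, (hU (dU y gg)).1.2).
pose dec2 (y : vn Y) (gg : GQ * GU) (ff : FT * FV) (bb : B) := ((hU (dU y gg)).2, (hV (dV y gg ff bb)).2).

have qE o : q (vec rS o) = vec rQ o by rewrite /q vec_vmap.
have uE o : u (vec rS o) = vec rU o by rewrite /u vec_vmap.
have v1E o : v1 (vec (fun o => (rV o, rT o)) o) = vec rV o by rewrite /v1 vec_vmap.
have t1E o : t1 (vec (fun o => (rV o, rT o)) o) = vec rT o by rewrite /t1 vec_vmap.
pose Q1 o := (hQ (vec rQ o)); pose U1 o := hU (vec rU o).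
pose T1 o := (hT (vec rT o)); pose V1 o := hV (vec rV o).
have blkE (o : Blk) : [/\ q o.1.1 = vec rQ (pack o), u o.1.1 = vec rU (pack o),
    v1 o.2 = vec rV (pack o), t1 o.2 = vec rT (pack o) & o.1.2 = (vec rY (pack o), vec rYh (pack o), vec rZ (pack o))].
  have h := packK o; rewrite -[X in q X.1.1]h -[X in u X.1.1]h -[X in v1 X.2]h -[X in t1 X.2]h -[X in X.1.2]h.
  by rewrite /unpack /= qE uE v1E t1E.
exists (vn (Q * U * X)), (vn (V * T)), (GQ * GU)%type, (FT * FV)%type, B.
exists seq_input, seq_x, seq_aux, g, be, f, b, kap, dec1, dec2.
split.
- split; first by move=> s; apply: iid_ge0; apply: input_law_ge0.
  by apply: sum_iid; apply: input_law_sum.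
- split; first by move=> s y v; apply: prodr_ge0 => i _; apply: aux_law_ge0.
  move=> s y; rewrite /seq_aux -(bigA_distr_bigA (fun i => aux_law (s i) (y i))).
  by apply: big1 => i _; apply: aux_law_sum.
- by rewrite card_prod muln_gt0 GQ_gt0.
- by rewrite card_prod muln_gt0 FT_gt0.
have hE12 : \sum_(o | (dec1 (vec rY o) ((Q1 o).1, (U1 o).1.1) != iB ((Q1 o).2, (U1 o).1.2))) Pn o <= e1 + e2.
  apply: err_le2 => // o; rewrite !negbK => /eqP h1 /eqP h2.
  by rewrite /dec1 /dU /dQ /= h1 vec_vzip h2.
have hE1234 : \sum_(o | (dec2 (vec rY o) ((Q1 o).1, (U1 o).1.1) ((T1 o).1, (V1 o).1.1)
     (emb ((T1 o).2, (V1 o).1.2)) != ((U1 o).2, (V1 o).2))) Pn o <= (e1 + e2) + (e3 + e4).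
  pose E1 o := decQ hQ (vec rY o) (hQ (vec rQ o)).1 != vec rQ o.
  pose E2 o := decU hU (vec (fun o => (rQ o, rY o)) o) (hU (vec rU o)).1.1 != vec rU o.
  pose E3 o := decT hT (vec (fun o => (rU o, rY o)) o) (hT (vec rT o)) != vec rT o.
  pose E4 o := decV hV (vec (fun o => (rT o, (rU o, rY o))) o) (hV (vec rV o)).1 != vec rV o.
  apply: (@le_trans _ _ (\sum_(o | E1 o || E2 o) Pn o + \sum_(o | E3 o || E4 o) Pn o)); last first.
    by apply: lerD; apply: err_le2 => // o h1 h2; rewrite negb_or h1 h2.
  apply: err_le2 => // o; rewrite !negb_or !negbK => /andP[/eqP h1 /eqP h2] /andP[/eqP h3 /eqP h4].
  rewrite /dec2 /dV /dT /dU /dQ /= embK h1 vec_vzip h2 vec_vzip -!surjective_pairing h3 vec_vzip.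
  by rewrite h4.
split.
- apply: (@le_trans _ _ (a1 + a2)); last by lra.
  rewrite -(dev_push _ _ law_iid_input).
  pose pi (k : (GQ * BQ) * (GU * BU)) : (GQ * GU) * B := ((k.1.1, k.2.1), iB (k.1.2, k.2.2)).
  have hpi : bijective pi.
    case: iB_bij => iB' k1 k2.
    exists (fun x : (GQ * GU) * B => ((x.1.1, (iB' x.2).1), (x.1.2, (iB' x.2).2))) => [[[? ?] [? ?]]|[[? ?] ?]]; rewrite /pi /=.
      by rewrite k1.
    by rewrite -surjective_pairing k2.
  rewrite -(eq_dev (P := Pn) (K := pi \o (fun o => (Q1 o, (U1 o).1))) (B := fun _ => tt) (fun _ => erefl) _ (fun _ => erefl)); last first.
    by move=> o; rewrite /= /g /be /pi qE uE.
  apply: le_trans (dev_balanced _ _ _ (balanced_bij R hpi)) _.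
  apply: le_trans (dev_chain _ _ _ _) _; rewrite addrC; apply: lerD.
    exact: (@dev_coarse_eq _ _ _ _ _ Pn _ _ _ (fun _ => tt)).
  exact: (@dev_coarse_eq _ _ _ _ _ Pn _ _ _ (fun q => (hQ q, tt))).
- apply: (@le_trans _ _ (a3 + a4)); last by lra.
  pose SY (o : vn Om) := (vec rS o, vec rYh o).
  rewrite (@eq_dev _ _ _ _ _ _ _ ((fun o => ((T1 o).1, (V1 o).1.1)) \o pack) _ (SY \o pack) (fun _ => erefl)); first last.
  + by move=> o; rewrite -[o in LHS]packK.
  + by move=> o; have [_ _ h3 h4 _] := blkE o; rewrite /= /f h3 h4.
  rewrite (dev_push _ _ law_pack).
  apply: le_trans (dev_chain _ _ _ _) _; rewrite addrC; apply: lerD.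
    apply: (@dev_coarse_eq _ _ _ _ _ Pn _ _ _ (fun p => (vmap fst p, vmap snd p))) => o.
    by rewrite !vec_vmap.
  apply: (@dev_coarse_eq _ _ _ _ _ Pn _ _ _ (fun p => ((hT (vmap fst p)).1, (vmap (fun x => x.2.1) p, vmap (fun x => x.2.2) p)))) => o.
  by rewrite !vec_vmap.
- apply: (@le_trans _ _ (e1 + e2)); last by lra.
  apply: le_trans hE12.
  rewrite -(sum_push _ law_pack) le_eqVlt; apply/orP; left; apply/eqP.
  by apply: eq_bigl => o; have [h1 h2 _ _ ->] := blkE o; rewrite /g /be h1 h2.
- apply: (@le_trans _ _ ((e1 + e2) + (e3 + e4))); last by lra.
  apply: le_trans hE1234.
  rewrite -(sum_push _ law_pack) le_eqVlt; apply/orP; left; apply/eqP.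
  by apply: eq_bigl => o; have [h1 h2 h3 h4 ->] := blkE o; rewrite /g /f /b /kap h1 h2 h3 h4.
apply: (@le_trans _ _ (2 * (a5 + a6))); last by lra.
(* Eve's enlarged view: the public hashes of [U] and [V] together with [Z^n], [Q^n], [T^n]. Every
   public quantity of the specification is a function of it. *)
pose E (o : vn Om) := ((U1 o).1, (V1 o).1, vec (fun o => (rZ o, rQ o, rT o)) o).
pose phi (e : (GU * BU) * (FV * BV) * vn (Z * Q * T)) :=
  (((hQ (vmap (fun x => x.1.2) e.2)).1, e.1.1.1),
   iB ((hQ (vmap (fun x => x.1.2) e.2)).2, e.1.1.2),
   ((hT (vmap snd e.2)).1, e.1.2.1), emb ((hT (vmap snd e.2)).2, e.1.2.2), vmap (fun x => x.1.1) e.2).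
rewrite (@eq_dev _ _ _ _ _ _ _ ((fun o => ((U1 o).2, (V1 o).2)) \o pack) _ ((phi \o E) \o pack) (fun _ => erefl)); first last.
- move=> o; have [h1 h2 h3 h4 h5] := blkE o.
  by rewrite /= /g /be /f /b h1 h2 h3 h4 h5 /phi /= !vec_vmap.
- by move=> o; have [h1 h2 h3 h4 h5] := blkE o; rewrite /= /kap h2 h3.
rewrite (dev_push _ _ law_pack).
apply: le_trans (dev_coarse _ _ _ _) _.
have hK : (0 < #|{: KU * KV}|)%N by rewrite card_prod muln_gt0 KU_gt0.
pose chi (c : vn (U * (Z * Q * T))) := (hU (vmap fst c), vmap snd c).
apply: le_trans (@dev_two_layers _ _ _ _ _ _ _ _ Pn (fun o => (U1 o).1) (fun o => (U1 o).2)
  (fun o => (V1 o).1) (fun o => (V1 o).2) (@vec _ _ (fun o => (rZ o, rQ o, rT o)) n)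
  (@vec _ _ (fun o => (rU o, (rZ o, rQ o, rT o))) n) chi hK _) _.
  by move=> o; rewrite /chi !vec_vmap -surjective_pairing.
rewrite ler_pM2l // le_eqVlt; apply/orP; left; apply/eqP; congr (_ + _);
  by apply: eq_dev => // o; rewrite -surjective_pairing.
Qed.

End Scheme.

Ltac unfold_rvs := rewrite /rQ /rU /rX /rY /rYh /rZ /rV /rT /rS.

(** Never zero, so that hash ranges are inhabited even at negative rates; rounding loses at most a
    factor of 2. *)
Definition sz (n : nat) (rho : R) : nat := maxn 1 (Num.truncn (pw2 (n%:R * rho))).

Lemma sz_gt0 n rho : (0 < sz n rho)%N.
Proof. by rewrite /sz leq_max. Qed.

Lemma card_sz_gt0 n rho : (0 < #|{: 'I_(sz n rho)}|)%N.
Proof. by rewrite card_ord sz_gt0. Qed.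

Lemma truncn_pw2_le x : (Num.truncn (pw2 x))%:R <= pw2 x.
Proof. by rewrite truncn_le // ltW ?pw2_gt0. Qed.

Lemma sz_le n rho : sz n rho = 1%N \/ (sz n rho)%:R <= pw2 (n%:R * rho).
Proof.
rewrite /sz; case: (leqP 1 (Num.truncn (pw2 (n%:R * rho)))) => h.
  by right; apply: truncn_pw2_le.
by left.
Qed.

Lemma sz_le_pw2 n rho x : rho <= x -> 0 <= x -> (sz n rho)%:R <= pw2 (n%:R * x).
Proof.
move=> hx h0; have h1 : n%:R * rho <= n%:R * x by apply: ler_wpM2l.
case: (sz_le n rho) => [->|h]; last by apply: le_trans h _; rewrite ler_pw2.
by rewrite -[1%:R]pw20 ler_pw2 mulr_ge0.
Qed.

Lemma sz_ge n rho : pw2 (n%:R * rho) <= 2 * (sz n rho)%:R.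
Proof.
apply: ltW; apply: lt_le_trans (truncnS_gt _) _.
rewrite -natrM ler_nat /sz; set t := Num.truncn _; lia.
Qed.

Lemma sz0 n : sz n 0 = 1%N.
Proof. by rewrite /sz mulr0 pw20 truncn1 maxnn. Qed.

Lemma two_le_pw2 x : 1 <= x -> 2 <= pw2 x.
Proof. by move=> h; have -> : 2 = pw2 1; [rewrite /pw2 Rpower_1 //; apply/RltP|rewrite ler_pw2]. Qed.

Lemma four_le_pw2 x : 2 <= x -> 4 <= pw2 x.
Proof.
move=> h; have -> : x = x / 2 + x / 2 by rewrite -splitr.
have h2 : 2 <= pw2 (x / 2) by apply: two_le_pw2; lra.
rewrite pw2D; nra.
Qed.

(** * Hash rates that suffice for long blocks *)

Section Rates.
Variables Q U X Y Yh Z V T : finType.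
Variable W : X -> Y * Yh * Z -> R.
Variables (pQU : Q * U -> R) (pXgU : U -> X -> R) (pVg : U * X * Yh -> V -> R) (pTgV : V -> T -> R).
Hypothesis W0 : forall x w, 0 <= W x w.
Hypothesis W1 : forall x, \sum_w W x w = 1.
Hypothesis pQU0 : forall p, 0 <= pQU p.
Hypothesis pQU1 : \sum_p pQU p = 1.
Hypothesis pX0 : forall u x, 0 <= pXgU u x.
Hypothesis pX1 : forall u, \sum_x pXgU u x = 1.
Hypothesis pV0 : forall c v, 0 <= pVg c v.
Hypothesis pV1 : forall c, \sum_v pVg c v = 1.
Hypothesis pT0 : forall v t, 0 <= pTgV v t.
Hypothesis pT1 : forall v, \sum_t pTgV v t = 1.

Local Notation P := (joint1 W pQU pXgU pVg pTgV).
Local Notation H A B := (cond_ent P A B).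

Let P0 : forall o, 0 <= P o.
Proof. exact: joint_ge0. Qed.
Let P1 : \sum_o P o = 1.
Proof. exact: joint_sum. Qed.

(** A rate slack [e] absorbs the roundings of up to two alphabets, a factor of 4, as soon as [n * e]
    reaches 2. *)
Lemma pw2_sep n (e a b : R) : 2 <= n%:R * e -> a + e <= b -> 4 * pw2 (n%:R * a) <= pw2 (n%:R * b).
Proof.
move=> hn hab; apply: (@le_trans _ _ (pw2 (n%:R * e) * pw2 (n%:R * a))).
  by apply: ler_wpM2r; [exact/ltW/pw2_gt0|exact: four_le_pw2].
by rewrite -pw2D ler_pw2 -mulrDr; apply: ler_wpM2l => //; rewrite addrC.
Qed.

Lemma sz_sep n (e a b : R) : 2 <= n%:R * e -> a + e <= b -> pw2 (n%:R * a) <= (sz n b)%:R.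
Proof.
move=> hn hab; have h1 := pw2_sep hn hab; have h2 := sz_ge n b.
have h3 := pw2_gt0 (n%:R * a); lra.
Qed.

Lemma sz2_sep n (e a b c : R) : 2 <= n%:R * e -> a + e <= b + c ->
  pw2 (n%:R * a) <= (sz n b)%:R * (sz n c)%:R.
Proof.
move=> hn hab; have h1 := pw2_sep hn hab; have h2 := sz_ge n b; have h3 := sz_ge n c.
have h4 : pw2 (n%:R * (b + c)) <= (2 * (sz n b)%:R) * (2 * (sz n c)%:R).
  by rewrite mulrDr pw2D; apply: ler_pM => //; exact/ltW/pw2_gt0.
nra.
Qed.

Lemma large_n (e : R) : 0 < e -> exists n0 : nat, forall n : nat, (n0 <= n)%N -> 2 <= n%:R * e.
Proof.
move=> he; have [n0 h0] := exists_nat_ge (2 / e); exists n0 => n hn.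
by rewrite -ler_pdivrMr //; apply: le_trans h0 _; rewrite ler_nat.
Qed.

Lemma ev_public e gQ bQ : 0 < e -> 0 <= gQ -> 0 <= bQ ->
  H (@rQ _ _ _ _ _ _ _ _) (@rY _ _ _ _ _ _ _ _) + e <= gQ ->
  gQ + bQ <= H (@rQ _ _ _ _ _ _ _ _) (fun=> tt) - e ->
  forall d, 0 < d -> exists n0 : nat, forall n : nat, (n0 <= n)%N ->
    public_ok W pQU pXgU pVg pTgV n 'I_(sz n gQ) 'I_(sz n bQ) d.
Proof.
move=> he hg hb h1 h2 d hd; have he2 : 0 < e / 2 by rewrite divr_gt0.
have [n1 hn1] := asym_dev (@rQ Q U X Y Yh Z V T) (fun=> tt) P0 P1 he hd.
have [n2 hn2] := asym_err (@rQ Q U X Y Yh Z V T) (@rY _ _ _ _ _ _ _ _) P0 P1 he2 hd.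
have [n3 hn3] := large_n he2.
exists (maxn n1 (maxn n2 n3)) => n; rewrite !geq_max => /and3P[/hn1 {}hn1 /hn2 {}hn2 /hn3 {}hn3].
have hG := card_sz_gt0 n gQ; have hB := card_sz_gt0 n bQ.
have hGB : (0 < #|{: 'I_(sz n gQ) * 'I_(sz n bQ)}|)%N by rewrite card_prod muln_gt0 hG.
have [|dec hdec] := hn2 _ _ _ hGB (balanced_fst R hB).
  by rewrite card_ord; apply: sz_sep hn3 _; lra.
exists dec; rewrite avgD.
apply: (@le_trans _ _ (d + d)); last by lra.
apply: lerD hdec; apply: (hn1 _ _ (fun x => x)) => //; first exact: balanced_id.
 right; rewrite card_prod !card_ord natrM; apply: (@le_trans _ _ (pw2 (n%:R * gQ) * pw2 (n%:R * bQ))).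
  by apply: ler_pM; rewrite ?ler0n // sz_le_pw2.
by rewrite -pw2D ler_pw2 -mulrDr ler_wpM2l.
Qed.

Lemma ev_input e gU bU kU : 0 < e -> 0 <= gU -> 0 <= bU -> 0 <= kU ->
  H (@rU _ _ _ _ _ _ _ _) (fun o => (rQ o, rY o)) + e <= gU ->
  gU + bU <= H (@rU _ _ _ _ _ _ _ _) (@rQ _ _ _ _ _ _ _ _) - e ->
  gU + bU + kU <= H (@rU _ _ _ _ _ _ _ _) (fun o => (rZ o, rQ o, rT o)) - e ->
  forall d, 0 < d -> exists n0 : nat, forall n : nat, (n0 <= n)%N ->
    input_ok W pQU pXgU pVg pTgV n 'I_(sz n gU) 'I_(sz n bU) 'I_(sz n kU) d.
Proof.
move=> he hg hb hk h1 h2 h3 d hd; have he2 : 0 < e / 2 by rewrite divr_gt0.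
have [n1 hn1] := asym_dev (@rU Q U X Y Yh Z V T) (@rQ _ _ _ _ _ _ _ _) P0 P1 he hd.
have [n2 hn2] := asym_err (@rU Q U X Y Yh Z V T) (fun o => (rQ o, rY o)) P0 P1 he2 hd.
have [n3 hn3] := asym_dev (@rU Q U X Y Yh Z V T) (fun o => (rZ o, rQ o, rT o)) P0 P1 he hd.
have [n4 hn4] := large_n he2.
exists (maxn (maxn n1 n2) (maxn n3 n4)) => n.
rewrite !geq_max => /andP[/andP[/hn1 {}hn1 /hn2 {}hn2] /andP[/hn3 {}hn3 /hn4 {}hn4]].
have hG := card_sz_gt0 n gU; have hB := card_sz_gt0 n bU; have hK := card_sz_gt0 n kU.
have hGBK : (0 < #|{: 'I_(sz n gU) * 'I_(sz n bU) * 'I_(sz n kU)}|)%N by rewrite !card_prod !muln_gt0 hG hB.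
have [|dec hdec] := hn2 _ _ (fst \o fst) hGBK (balanced_comp (balanced_fst R hK) (balanced_fst R hB)).
  by rewrite card_ord; apply: sz_sep hn4 _; lra.
exists dec; rewrite avgD avgD.
have hszGB : (sz n gU)%:R * (sz n bU)%:R <= pw2 (n%:R * (gU + bU)) :> R.
  by rewrite mulrDr pw2D; apply: ler_pM; rewrite ?ler0n // sz_le_pw2.
apply: (@le_trans _ _ (d + d + d)); last by lra.
apply: lerD; first apply: lerD hdec.
  apply: (hn1 _ _ fst) => //; first exact: balanced_fst.
  right; rewrite card_prod !card_ord natrM; apply: le_trans hszGB _.
  by rewrite ler_pw2 ler_wpM2l.
apply: (hn3 _ _ (fun x => x)) => //; first exact: balanced_id.
 right; rewrite !card_prod !card_ord !natrM; apply: (@le_trans _ _ (pw2 (n%:R * (gU + bU)) * pw2 (n%:R * kU))).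
  by apply: ler_pM => //; rewrite ?mulr_ge0 ?ler0n // sz_le_pw2.
by rewrite -pw2D ler_pw2 -mulrDr ler_wpM2l.
Qed.

Lemma ev_helper e fT bT : 0 < e -> 0 <= bT ->
  fT <= H (@rT _ _ _ _ _ _ _ _) (fun o => (rS o, rYh o)) - e ->
  H (@rT _ _ _ _ _ _ _ _) (fun o => (rU o, rY o)) + e <= fT + bT ->
  forall d, 0 < d -> exists n0 : nat, forall n : nat, (n0 <= n)%N ->
    helper_ok W pQU pXgU pVg pTgV n 'I_(sz n fT) 'I_(sz n bT) d.
Proof.
move=> he hb h1 h2 d hd; have he2 : 0 < e / 2 by rewrite divr_gt0.
have [n1 hn1] := asym_dev (@rT Q U X Y Yh Z V T) (fun o => (rS o, rYh o)) P0 P1 he hd.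
have [n2 hn2] := asym_err (@rT Q U X Y Yh Z V T) (fun o => (rU o, rY o)) P0 P1 he2 hd.
have [n3 hn3] := large_n he2.
exists (maxn n1 (maxn n2 n3)) => n; rewrite !geq_max => /and3P[/hn1 {}hn1 /hn2 {}hn2 /hn3 {}hn3].
have hG := card_sz_gt0 n fT; have hB := card_sz_gt0 n bT.
have hGB : (0 < #|{: 'I_(sz n fT) * 'I_(sz n bT)}|)%N by rewrite card_prod muln_gt0 hG.
have [|dec hdec] := hn2 ('I_(sz n fT) * 'I_(sz n bT))%type ('I_(sz n fT) * 'I_(sz n bT))%type (fun x => x) hGB (@balanced_id R _).
  rewrite card_prod !card_ord natrM; apply: sz2_sep hn3 _; lra.
exists dec; rewrite avgD.
apply: (@le_trans _ _ (d + d)); last by lra.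
apply: lerD hdec; apply: (hn1 _ _ fst) => //; first exact: balanced_fst.
rewrite card_ord; case: (sz_le n fT) => h; [by left|right].
by apply: le_trans h _; rewrite ler_pw2 ler_wpM2l.
Qed.

(** The rate [fV] may be negative, in which case its alphabet is larger than [pw2 (n%:R * fV)]; the
    non-negative [fV'] replaces it where the total size must be bounded from above. *)
Lemma ev_source e fV bV kV fV' : 0 < e -> 0 <= bV -> 0 <= kV -> fV <= fV' -> 0 <= fV' ->
  fV <= H (@rV _ _ _ _ _ _ _ _) (fun o => (rT o, (rS o, rYh o))) - e ->
  H (@rV _ _ _ _ _ _ _ _) (fun o => (rT o, (rU o, rY o))) + e <= fV + bV ->
  fV' + bV + kV <= H (@rV _ _ _ _ _ _ _ _) (fun o => (rU o, (rZ o, rQ o, rT o))) - e ->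
  forall d, 0 < d -> exists n0 : nat, forall n : nat, (n0 <= n)%N ->
    source_ok W pQU pXgU pVg pTgV n 'I_(sz n fV) 'I_(sz n bV) 'I_(sz n kV) d.
Proof.
move=> he hb hk hf hf0 h1 h2 h3 d hd; have he2 : 0 < e / 2 by rewrite divr_gt0.
have [n1 hn1] := asym_dev (@rV Q U X Y Yh Z V T) (fun o => (rT o, (rS o, rYh o))) P0 P1 he hd.
have [n2 hn2] := asym_err (@rV Q U X Y Yh Z V T) (fun o => (rT o, (rU o, rY o))) P0 P1 he2 hd.
have [n3 hn3] := asym_dev (@rV Q U X Y Yh Z V T) (fun o => (rU o, (rZ o, rQ o, rT o))) P0 P1 he hd.
have [n4 hn4] := large_n he2.
exists (maxn (maxn n1 n2) (maxn n3 n4)) => n.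
rewrite !geq_max => /andP[/andP[/hn1 {}hn1 /hn2 {}hn2] /andP[/hn3 {}hn3 /hn4 {}hn4]].
have hG := card_sz_gt0 n fV; have hB := card_sz_gt0 n bV; have hK := card_sz_gt0 n kV.
have hGBK : (0 < #|{: 'I_(sz n fV) * 'I_(sz n bV) * 'I_(sz n kV)}|)%N by rewrite !card_prod !muln_gt0 hG hB.
have [|dec hdec] := hn2 _ _ fst hGBK (balanced_fst R hK).
  rewrite card_prod !card_ord natrM; apply: sz2_sep hn4 _; lra.
exists dec; rewrite avgD avgD.
apply: (@le_trans _ _ (d + d + d)); last by lra.
apply: lerD; first apply: lerD hdec.
  apply: (hn1 _ _ (fst \o fst)) => //; first exact: balanced_comp (balanced_fst R hK) (balanced_fst R hB).
  rewrite card_ord; case: (sz_le n fV) => h; [by left|right].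
  by apply: le_trans h _; rewrite ler_pw2 ler_wpM2l.
apply: (hn3 _ _ (fun x => x)) => //; first exact: balanced_id.
 right; rewrite !card_prod !card_ord !natrM.
apply: (@le_trans _ _ (pw2 (n%:R * fV') * pw2 (n%:R * bV) * pw2 (n%:R * kV))).
  apply: ler_pM; rewrite ?mulr_ge0 ?ler0n ?sz_le_pw2 //.
  by apply: ler_pM; rewrite ?ler0n // sz_le_pw2.
by rewrite -!pw2D ler_pw2 -!mulrDr ler_wpM2l.
Qed.

(** For the extreme perturbation in which [Q] reveals [U] always: nothing is hashed from [U], and
    all its alphabets are singletons. *)
Lemma ev_input_determined (phi : Q -> U) :
  (forall o, P o != 0 -> rU o = phi (rQ o)) ->
  forall d, 0 < d -> forall n : nat,
    input_ok W pQU pXgU pVg pTgV n 'I_(sz n 0) 'I_(sz n 0) 'I_(sz n 0) d.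
Proof.
move=> hphi d hd n.
have hc : #|{: 'I_(sz n 0)}| = 1%N by rewrite card_ord sz0.
have [|dec hdec] := @err_determined R _ _ {ffun 'I_n -> Q * Y} ('I_(sz n 0) * 'I_(sz n 0) * 'I_(sz n 0))%type _
   (@iid R _ P n) (@vec _ _ (@rU Q U X Y Yh Z V T) n) (@vec _ _ (fun o => (rQ o, rY o)) n) (fst \o fst) (@vmap _ _ (fun p : Q * Y => phi p.1) n).
  move=> o ho; rewrite vec_vmap; apply/ffunP => i; rewrite !ffunE; apply: hphi.
  by apply: contraNneq ho => h; rewrite /iid (bigD1 i) //= h mul0r.
exists dec; rewrite avgD avgD.
rewrite (eq_avg (g := fun=> 0)) => [|h]; last by apply: dev_card1; rewrite card_prod hc.
rewrite [X in _ + X](eq_avg (g := fun=> 0)) => [|h]; last by apply: dev_card1; rewrite !card_prod hc.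
rewrite avg_const ?card_ffun ?expn_gt0 ?card_prod ?hc // addr0 add0r.
by apply: le_trans hdec _; rewrite mulr_ge0 // ltW.
Qed.

Lemma ev_helper_trivial (t0 : T) : (forall o, P o != 0 -> rT o = t0) ->
  forall d, 0 < d -> forall n : nat,
  helper_ok W pQU pXgU pVg pTgV n 'I_(sz n 0) 'I_(sz n 0) d.
Proof.
move=> hT d hd n.
have hc : #|{: 'I_(sz n 0)}| = 1%N by rewrite card_ord sz0.
have [|dec hdec] := @err_determined R _ _ {ffun 'I_n -> U * Y} ('I_(sz n 0) * 'I_(sz n 0))%type _
   (@iid R _ P n) (@vec _ _ (@rT Q U X Y Yh Z V T) n) (@vec _ _ (fun o => (rU o, rY o)) n) (fun x => x) (fun=> [ffun=> t0]).
  move=> o ho; apply/ffunP => i; rewrite !ffunE; apply: hT.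
  by apply: contraNneq ho => h; rewrite /iid (bigD1 i) //= h mul0r.
exists dec; rewrite avgD.
rewrite (eq_avg (g := fun=> 0)) => [|h]; last by apply: dev_card1.
rewrite avg_const ?card_ffun ?expn_gt0 ?card_prod ?hc // add0r.
by apply: le_trans hdec _; rewrite mulr_ge0 // ltW.
Qed.

Lemma ev_source_trivial (v0 : V) : (forall o, P o != 0 -> rV o = v0) ->
  forall d, 0 < d -> forall n : nat,
  source_ok W pQU pXgU pVg pTgV n 'I_(sz n 0) 'I_(sz n 0) 'I_(sz n 0) d.
Proof.
move=> hV d hd n.
have hc : #|{: 'I_(sz n 0)}| = 1%N by rewrite card_ord sz0.
have [|dec hdec] := @err_determined R _ _ {ffun 'I_n -> T * (U * Y)} ('I_(sz n 0) * 'I_(sz n 0) * 'I_(sz n 0))%type _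
   (@iid R _ P n) (@vec _ _ (@rV Q U X Y Yh Z V T) n) (@vec _ _ (fun o => (rT o, (rU o, rY o))) n) fst (fun=> [ffun=> v0]).
  move=> o ho; apply/ffunP => i; rewrite !ffunE; apply: hV.
  by apply: contraNneq ho => h; rewrite /iid (bigD1 i) //= h mul0r.
exists dec; rewrite avgD avgD.
rewrite (eq_avg (g := fun=> 0)) => [|h]; last by apply: dev_card1.
rewrite [X in _ + X](eq_avg (g := fun=> 0)) => [|h]; last by apply: dev_card1; rewrite !card_prod hc.
rewrite avg_const ?card_ffun ?expn_gt0 ?card_prod ?hc // addr0 add0r.
by apply: le_trans hdec _; rewrite mulr_ge0 // ltW.
Qed.

(** What links the layers is that the bin indices of (T,V) must fit into the carrying hashes of
    (Q,U), with [e] to spare for rounding, unless there is nothing to carry. *)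
Lemma block_rate_of_ev e gQ bQ gU bU kU fT bT fV bV kV :
  0 < e -> 0 <= bT -> 0 <= bV -> 0 <= kU -> 0 <= kV ->
  (bT = 0 /\ bV = 0) \/ bT + bV + e <= bQ + bU ->
  (forall d, 0 < d -> exists n0 : nat, forall n : nat, (n0 <= n)%N ->
    public_ok W pQU pXgU pVg pTgV n 'I_(sz n gQ) 'I_(sz n bQ) d) ->
  (forall d, 0 < d -> exists n0 : nat, forall n : nat, (n0 <= n)%N ->
    input_ok W pQU pXgU pVg pTgV n 'I_(sz n gU) 'I_(sz n bU) 'I_(sz n kU) d) ->
  (forall d, 0 < d -> exists n0 : nat, forall n : nat, (n0 <= n)%N ->
    helper_ok W pQU pXgU pVg pTgV n 'I_(sz n fT) 'I_(sz n bT) d) ->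
  (forall d, 0 < d -> exists n0 : nat, forall n : nat, (n0 <= n)%N ->
    source_ok W pQU pXgU pVg pTgV n 'I_(sz n fV) 'I_(sz n bV) 'I_(sz n kV) d) ->
  block_rate W (kU + kV).
Proof.
move=> he hbT hbV hkU hkV hb hQ hU hT hV d hd.
have hd12 : 0 < d / 12 by rewrite divr_gt0.
have [n1 hn1] := hQ _ hd12; have [n2 hn2] := hU _ hd12.
have [n3 hn3] := hT _ hd12; have [n4 hn4] := hV _ hd12.
have [n5 hn5] := large_n he.
exists (maxn (maxn n1 n2) (maxn n3 (maxn n4 n5))) => n' hn'.
set n := n'.+1; have : (maxn (maxn n1 n2) (maxn n3 (maxn n4 n5)) <= n)%N by apply: leqW.
rewrite !geq_max => /andP[/andP[/hn1 {}hQ /hn2 {}hU] /and3P[/hn3 {}hT /hn4 {}hV /hn5 {}hn5]].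
exists ('I_(sz n kU) * 'I_(sz n kV))%type; split.
- rewrite card_prod !card_ord natrM mulrDr pw2D.
  apply: le_trans (ler_pM _ _ (sz_ge n kU) (sz_ge n kV)) _; rewrite ?(ltW (pw2_gt0 _)) //.
  by rewrite le_eqVlt; apply/orP; left; apply/eqP; ring.
- rewrite card_prod !card_ord natrM mulrDr pw2D.
  by apply: ler_pM; rewrite ?ler0n // sz_le_pw2.
have -> : d = 12 * (d / 12) by field.
set BQ := 'I_(sz n bQ) in hQ *; set BU := 'I_(sz n bU) in hU *.
set BT := 'I_(sz n bT) in hT *; set BV := 'I_(sz n bV) in hV *.
have hBB : (0 < #|{: BQ * BU}|)%N by rewrite card_prod muln_gt0 !card_sz_gt0.
have hcast : #|{: BQ * BU}| = #|{: BQ * BU}|.-1.+1 by rewrite prednK.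
(* The carrier is enumerated as a cyclic group, in which the uniform shift can be added. *)
pose iB (x : BQ * BU) : 'I_(#|{: BQ * BU}|.-1.+1) := cast_ord hcast (enum_rank x).
have iB_bij : bijective iB.
  exists (fun y => enum_val (cast_ord (esym hcast) y)) => y; rewrite /iB.
    by rewrite cast_ordK enum_rankK.
  by rewrite enum_valK cast_ordKV.
have hle : (#|{: BT * BV}| <= #|{: BQ * BU}|.-1.+1)%N.
  rewrite -hcast !card_prod !card_ord.
  case: hb => [[-> ->]|hb]; first by rewrite !sz0 muln_gt0 !sz_gt0.
  rewrite -(ler_nat R) !natrM; apply: (@le_trans _ _ (pw2 (n%:R * (bT + bV)))).
    by rewrite mulrDr pw2D; apply: ler_pM; rewrite ?ler0n // sz_le_pw2.
  exact: sz2_sep hn5 hb.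
have hBT : (0 < #|{: BT * BV}|)%N by rewrite card_prod muln_gt0 !card_sz_gt0.
have [x0 _] : exists x : BT * BV, true by move/card_gt0P: hBT => [x _]; exists x.
pose emb (x : BT * BV) : 'I_(#|{: BQ * BU}|.-1.+1) := widen_ord hle (enum_rank x).
pose bme (y : 'I_(#|{: BQ * BU}|.-1.+1)) : BT * BV := odflt x0 [pick x | emb x == y].
have embK : cancel emb bme.
  move=> x; rewrite /bme; case: pickP => [x' /eqP h|/(_ x)]; last by rewrite eqxx.
  by apply: enum_rank_inj; apply: val_inj; move/(congr1 val): h.
apply: (scheme_of_hashes W0 W1 pQU0 pQU1 pX0 pX1 pV0 pV1 pT0 pT1 iB_bij embK _ _ _ _ _ _ _ _ _ _ hQ hU hT hV);
  exact: card_sz_gt0.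
Qed.

End Rates.

(** * Conditional entropy *)

Lemma lg_sub1_eq x : 0 < x -> lg x = (x - 1) / ln 2 -> x = 1.
Proof.
move=> hx /(congr1 (fun y => y * ln 2)); rewrite mulfVK ?ln2_neq0 // mulfVK ?ln2_neq0 // => h.
apply/eqP/negPn/negP => hx1.
have hln : ln x <> 0.
  by rewrite h => /eqP; rewrite subr_eq0 (negbTE hx1).
have := exp_ineq1 _ hln; rewrite exp_ln; last exact/RltP.
by rewrite h => /RltP; rewrite RplusE R1E addrC subrK ltxx.
Qed.

Section CondEnt.
Implicit Types O TA TB TC : finType.

Lemma cond_ent_pushE O O' TA TB (P : O -> R) (P' : O' -> R) (h : O' -> O) (A : O -> TA) (B : O -> TB) :
  (forall o, law P' h o = P o) ->
  cond_ent P' (fun o => A (h o)) (fun o => B (h o)) = cond_ent P A B.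
Proof.
move=> hP; rewrite /cond_ent -(ent_push (fun o => (A o, B o)) hP) -(ent_push B hP).
by congr (_ - _); apply: eq_ent.
Qed.

Section Ineq.
Variables (O TA TB TC : finType) (P : O -> R) (A : O -> TA) (B : O -> TB) (C : O -> TC) (phi : TB -> TC).
Hypothesis P0 : forall o, 0 <= P o.
Hypothesis P1 : \sum_o P o = 1.
Hypothesis hC : forall o, C o = phi (B o).

Let p a b := law P (fun o => (A o, B o)) (a, b).
Let q b := law P B b.
Let r a c := law P (fun o => (A o, C o)) (a, c).
Let s c := law P C c.

Let p0 a b : 0 <= p a b. Proof. exact: law_ge0. Qed.
Let q0 b : 0 <= q b. Proof. exact: law_ge0. Qed.
Let r0 a b : 0 <= r a b. Proof. exact: law_ge0. Qed.
Let s0 b : 0 <= s b. Proof. exact: law_ge0. Qed.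

Let qE b : q b = \sum_a p a b. Proof. by rewrite /q -(law_fst P A). Qed.
Let sE c : s c = \sum_a r a c. Proof. by rewrite /s -(law_fst P A). Qed.

Let rE a c : r a c = \sum_(b | phi b == c) p a b.
Proof.
rewrite /r /p /law (partition_big B (fun b => phi b == c)) /=; last first.
  by move=> o; rewrite xpair_eqE hC => /andP[].
apply: eq_bigr => b /eqP hb; apply: eq_bigl => o; rewrite !xpair_eqE hC.
by case: (eqVneq (B o) b) => [->|]; rewrite ?hb ?eqxx ?andbF ?andbT.
Qed.

Let pq a b : p a b <= q b. Proof. exact: law_pair_le. Qed.

Let pr a b : p a b <= r a (phi b).
Proof. by rewrite rE (bigD1 b) //= lerDl sumr_ge0. Qed.

Let rs a c : r a c <= s c. Proof. exact: law_pair_le. Qed.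

Let gap a b := p a b * (lg (p a b) - lg (q b) - (lg (r a (phi b)) - lg (s (phi b)))).

Let gapE : cond_ent P A C - cond_ent P A B = \sum_b \sum_a gap a b.
Proof.
have e1 : ent P (fun o => (A o, B o)) = - \sum_b \sum_a p a b * lg (p a b).
  rewrite entE sum_pair exchange_big; congr (- _); apply: eq_bigr => b _; apply: eq_bigr => a _.
  by rewrite (xlgE (p0 a b)).
have e2 : ent P B = - \sum_b \sum_a p a b * lg (q b).
  rewrite entE; congr (- _); apply: eq_bigr => b _.
  by rewrite -mulr_suml -qE (xlgE (q0 b)).
have e3 : ent P (fun o => (A o, C o)) = - \sum_b \sum_a p a b * lg (r a (phi b)).
  rewrite entE sum_pair; congr (- _); rewrite exchange_big [RHS](partition_big phi predT) //=.
  apply: eq_bigr => c _; rewrite [RHS]exchange_big /=; apply: eq_bigr => a _.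
  rewrite (xlgE (r0 a c)) {1}rE mulr_suml; apply: eq_bigr => b /eqP <- //.
have e4 : ent P C = - \sum_b \sum_a p a b * lg (s (phi b)).
  rewrite entE; congr (- _); rewrite [RHS](partition_big phi predT) //=.
  apply: eq_bigr => c _; rewrite (xlgE (s0 c)) {1}sE mulr_suml [RHS]exchange_big /=.
  apply: eq_bigr => a _; rewrite rE mulr_suml; apply: eq_bigr => b /eqP <- //.
rewrite /cond_ent e1 e2 e3 e4 /gap.
under [RHS]eq_bigr => b _.
  under eq_bigr do rewrite !mulrBr.
  rewrite !sumrB.
over.
rewrite !sumrB; ring.
Qed.

Let x a b := q b * r a (phi b) / (p a b * s (phi b)).

(** From [lg x <= (x - 1) / ln 2], an equality only at [x = 1]. These lower bounds have a
    non-negative sum by [low_sum], so a vanishing gap forces each of them to be attained. *)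
Let gap_ge a b : (p a b - (if 0 < p a b then q b * r a (phi b) / s (phi b) else 0)) / ln 2 <= gap a b
  /\ (gap a b = (p a b - (if 0 < p a b then q b * r a (phi b) / s (phi b) else 0)) / ln 2 ->
      p a b != 0 -> p a b * s (phi b) = q b * r a (phi b)).
Proof.
rewrite /gap; case: ifP => h; last first.
  have -> : p a b = 0 by apply/le_anti; rewrite p0 leNgt h.
  by rewrite subr0 !mul0r eqxx.
have hq : 0 < q b by apply: lt_le_trans h (pq a b).
have hr : 0 < r a (phi b) by apply: lt_le_trans h (pr a b).
have hs : 0 < s (phi b) by apply: lt_le_trans hr (rs a (phi b)).
have hx : 0 < x a b by rewrite divr_gt0 // mulr_gt0.
have hlg : lg (p a b) - lg (q b) - (lg (r a (phi b)) - lg (s (phi b))) = - lg (x a b).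
  by rewrite /x !lgM ?invr_gt0 ?mulr_gt0 // lgV ?mulr_gt0 // lgM //; ring.
have hpx : p a b - q b * r a (phi b) / s (phi b) = p a b * (1 - x a b).
  by rewrite /x; field; rewrite !gt_eqF.
rewrite hlg hpx -mulrA; split.
  apply: ler_wpM2l => //; rewrite lerNr -mulNr opprB; exact: lg_sub1.
move=> /(mulfI (lt0r_neq0 h)) /(congr1 -%R); rewrite opprK -mulNr opprB => hh _.
have := lg_sub1_eq hx hh; rewrite /x => /(congr1 (fun y => y * (p a b * s (phi b)))).
by rewrite mulfVK ?mul1r // gt_eqF // mulr_gt0.
Qed.

Let low_sum : 0 <= \sum_b \sum_a (p a b - (if 0 < p a b then q b * r a (phi b) / s (phi b) else 0)) / ln 2.
Proof.
apply: sumr_ge0 => b _; rewrite -mulr_suml; apply: divr_ge0; last exact/ltW/ln2_gt0.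
rewrite sumrB -qE subr_ge0.
apply: (@le_trans _ _ (\sum_a q b * r a (phi b) / s (phi b))).
  apply: ler_sum => a _; case: ifP => // _; by rewrite divr_ge0 // mulr_ge0.
rewrite -mulr_suml -mulr_sumr -sE.
have [->|hs] := eqVneq (s (phi b)) 0; first by rewrite mulr0 mul0r.
by rewrite mulfK.
Qed.

Lemma cond_ent_le : cond_ent P A B <= cond_ent P A C.
Proof.
rewrite -subr_ge0 gapE; apply: le_trans low_sum _.
by apply: ler_sum => b _; apply: ler_sum => a _; case: (gap_ge a b).
Qed.

(** The conclusion is the Markov chain A - C - B, obtained only at pairs of positive probability,
    since other terms of the gap carry no information. *)
Lemma cond_ent_le_eq : cond_ent P A C <= cond_ent P A B -> forall a b,
  law P (fun o => (A o, B o)) (a, b) != 0 ->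
  law P (fun o => (A o, B o)) (a, b) * law P C (phi b) =
  law P B b * law P (fun o => (A o, C o)) (a, phi b).
Proof.
rewrite -subr_le0 gapE => hle a b hab.
have [_ h] := gap_ge a b; apply: h => //; apply/eqP.
set low := fun a b => (p a b - (if 0 < p a b then q b * r a (phi b) / s (phi b) else 0)) / ln 2.
have hd a' b' : 0 <= gap a' b' - low a' b' by rewrite subr_ge0; case: (gap_ge a' b').
have hsum : \sum_b' \sum_a' (gap a' b' - low a' b') <= 0.
  under eq_bigr do rewrite sumrB.
  rewrite sumrB subr_le0; apply: le_trans hle low_sum.
rewrite -subr_eq0; apply/eqP/le_anti; rewrite hd andbT.
apply: le_trans hsum; rewrite (bigD1 b) //= (bigD1 a) //= -addrA lerDl addr_ge0 //.
  by apply: sumr_ge0.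
by apply: sumr_ge0 => b' _; apply: sumr_ge0.
Qed.

Lemma cond_ent_ge0 : 0 <= cond_ent P A B.
Proof.
rewrite /cond_ent !entE sum_pair exchange_big /= opprK addrC subr_ge0.
apply: ler_sum => b _; rewrite -/(q b) (xlgE (q0 b)) {1}qE mulr_suml; apply: ler_sum => a _.
rewrite -/(p a b) (xlgE (p0 a b)).
have [h|h] := ltP 0 (p a b); first by rewrite ler_pM2l // lg_le.
have -> : p a b = 0 by apply/le_anti; rewrite p0 h.
by rewrite !mul0r.
Qed.

End Ineq.

Lemma xlgM x y : 0 <= x -> 0 <= y -> xlg (x * y) = x * xlg y + y * xlg x.
Proof.
move=> hx hy; have [->|h1] := eqVneq x 0; first by rewrite mul0r xlg0 mul0r mulr0 addr0.
have [->|h2] := eqVneq y 0; first by rewrite mulr0 xlg0 mulr0 mul0r addr0.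
have hx0 : 0 < x by rewrite lt_neqAle eq_sym h1.
have hy0 : 0 < y by rewrite lt_neqAle eq_sym h2.
rewrite !xlgE ?mulr_ge0 // lgM //; ring.
Qed.

(** The right-hand side does not mention [B]: once the conditioning determines [phi], through which
    [A] depends on the rest, any refinement leaves the entropy unchanged. *)
Lemma cond_ent_markov (O1 O2 TA TB TC : finType) (p : O1 -> R) (k : TC -> O2 -> R)
    (phi : O1 -> TC) (A : O2 -> TA) (B : O1 -> TB) (psi : TB -> TC) :
  (forall x, 0 <= p x) -> (forall c y, 0 <= k c y) -> (forall c, \sum_y k c y = 1) ->
  (forall x, phi x = psi (B x)) ->
  cond_ent (fun o : O1 * O2 => p o.1 * k (phi o.1) o.2) (fun o => A o.2) (fun o => B o.1) =
  - \sum_c law p phi c * \sum_a xlg (law (k c) A a).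
Proof.
move=> p0 k0 k1 hphi; set P := (fun o : O1 * O2 => _).
have hB b : law P (fun o => B o.1) b = law p B b.
  rewrite /law big_mkcond sum_pair [RHS]big_mkcond; apply: eq_bigr => x _ /=.
  case: ifP => _; last by rewrite big1.
  by rewrite /P /= -mulr_sumr k1 mulr1.
have hAB a b : law P (fun o => (A o.2, B o.1)) (a, b) = law p B b * law (k (psi b)) A a.
  rewrite /law big_mkcond sum_pair mulr_suml [RHS]big_mkcond; apply: eq_bigr => x _ /=.
  case: eqP => [hb|hb]; last first.
    by rewrite big1 // => y _; rewrite xpair_eqE (negbTE (introN eqP hb)) andbF.
  rewrite mulr_sumr [RHS]big_mkcond; apply: eq_bigr => y _.
  by rewrite xpair_eqE hb eqxx andbT /P /= hphi hb.
have hk c : \sum_a law (k c) A a = 1 by rewrite law_total.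
rewrite /cond_ent !entE sum_pair exchange_big /=.
rewrite (eq_bigr (fun b => xlg (law p B b) + law p B b * \sum_a xlg (law (k (psi b)) A a))); last first.
  move=> b _; under eq_bigr do rewrite hAB xlgM ?law_ge0 //.
  by rewrite big_split /= -mulr_sumr -mulr_suml hk mul1r addrC.
rewrite big_split /= (eq_bigr (fun b => xlg (law p B b)) (fun b _ => congr1 xlg (hB b))) opprK opprD addrAC addNr add0r.
congr (- _).
rewrite (sum_law p B (fun b => \sum_a xlg (law (k (psi b)) A a))).
rewrite (sum_law p phi (fun c => \sum_a xlg (law (k c) A a))).
by apply: eq_bigr => x _; rewrite hphi.
Qed.

Lemma cond_ent_markov_eq (O O1 O2 TA TB TB' TC : finType) (P : O -> R) (x : O -> O1) (y : O -> O2)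
    (p : O1 -> R) (k : TC -> O2 -> R) (phi : O1 -> TC) (A : O2 -> TA)
    (B : O1 -> TB) (psi : TB -> TC) (B' : O1 -> TB') (psi' : TB' -> TC) :
  (forall x, 0 <= p x) -> (forall c y, 0 <= k c y) -> (forall c, \sum_y k c y = 1) ->
  (forall z, law P (fun o => (x o, y o)) z = p z.1 * k (phi z.1) z.2) ->
  (forall a, phi a = psi (B a)) -> (forall a, phi a = psi' (B' a)) ->
  cond_ent P (fun o => A (y o)) (fun o => B (x o)) =
  cond_ent P (fun o => A (y o)) (fun o => B' (x o)).
Proof.
move=> p0 k0 k1 hP h1 h2.
rewrite (cond_ent_pushE (fun z => A z.2) (fun z => B z.1) hP).
rewrite (cond_ent_pushE (fun z => A z.2) (fun z => B' z.1) hP).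
by rewrite (cond_ent_markov A p0 k0 k1 h1) (cond_ent_markov A p0 k0 k1 h2).
Qed.

(** Entropy depends only on the partition that a variable induces. In this form any regrouping of
    tuples is settled by [congruence]. *)
Lemma ent_equiv O TA TB (P : O -> R) (A : O -> TA) (B : O -> TB) :
  (forall o o', A o = A o' <-> B o = B o') -> ent P A = ent P B.
Proof.
move=> h; case: (pickP (fun _ : O => true)) => [o0 _|h0]; last first.
  rewrite !entE !big1 // => a _; rewrite /law big_pred0 ?xlg0 // => o; by have := h0 o.
pose f (b : TB) := A (odflt o0 [pick o | B o == b]).
pose g (a : TA) := B (odflt o0 [pick o | A o == a]).
apply: (@ent_cancel _ _ _ _ _ _ f g) => o; rewrite /f /g; case: pickP => [o' /eqP /h //|/(_ o)];
  by rewrite eqxx.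
Qed.

Definition hbin (l : R) : R := - (xlg l + xlg (1 - l)).

Lemma law_mixture O O' TA (P : O -> R) (P' : O' -> R) (h1 h2 : O -> O') l (A : O' -> TA) a :
  (forall o, P' o = (1 - l) * law P h1 o + l * law P h2 o) ->
  law P' A a = (1 - l) * law P (A \o h1) a + l * law P (A \o h2) a.
Proof.
move=> hP; rewrite (law_comp P h1 A) (law_comp P h2 A) !mulr_sumr -big_split.
by apply: eq_bigr.
Qed.

(** [sep] expresses that [A] shows which component was drawn, so the entropy [hbin l] of the draw is
    added. *)
Lemma ent_mixture O O' TA (P : O -> R) (P' : O' -> R) (h1 h2 : O -> O') l (A : O' -> TA) (sep : TA -> bool) :
  (forall o, 0 <= P o) -> \sum_o P o = 1 -> 0 <= l <= 1 ->
  (forall o, P' o = (1 - l) * law P h1 o + l * law P h2 o) ->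
  (forall o, ~~ sep (A (h1 o))) -> (forall o, sep (A (h2 o))) ->
  ent P' A = (1 - l) * ent P (A \o h1) + l * ent P (A \o h2) + hbin l.
Proof.
move=> P0 P1 /andP[l0 l1] hP hs1 hs2.
have l1' : 0 <= 1 - l by rewrite subr_ge0.
have z1 a : sep a -> law P (A \o h1) a = 0.
  move=> ha; rewrite /law big1 // => o /eqP /= ho; by have := hs1 o; rewrite ho ha.
have z2 a : ~~ sep a -> law P (A \o h2) a = 0.
  move=> ha; rewrite /law big1 // => o /eqP /= ho; by have := hs2 o; rewrite ho (negbTE ha).
have hterm a : xlg (law P' A a) = (1 - l) * xlg (law P (A \o h1) a) + law P (A \o h1) a * xlg (1 - l)
   + (l * xlg (law P (A \o h2) a) + law P (A \o h2) a * xlg l).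
  rewrite (law_mixture _ _ hP); case: (boolP (sep a)) => ha.
    by rewrite (z1 a ha) mulr0 add0r xlg0 mulr0 mul0r !add0r xlgM ?law_ge0.
  by rewrite (z2 a ha) mulr0 addr0 xlg0 mulr0 mul0r !addr0 xlgM ?law_ge0.
rewrite !entE (eq_bigr _ (fun a _ => hterm a)) !big_split /= -!mulr_sumr -!mulr_suml !law_total P1 /hbin.
ring.
Qed.

Lemma ent_mixture_same O O' TA (P : O -> R) (P' : O' -> R) (h1 h2 : O -> O') l (A : O' -> TA) :
  (forall o, P' o = (1 - l) * law P h1 o + l * law P h2 o) ->
  (forall o, A (h2 o) = A (h1 o)) ->
  ent P' A = ent P (A \o h1).
Proof.
move=> hP hA; rewrite !entE; congr (- _); apply: eq_bigr => a _; congr xlg.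
rewrite (law_mixture _ _ hP) (@eq_law _ _ _ P P (A \o h2) (A \o h1)) //.
by rewrite -mulrDl subrK mul1r.
Qed.

End CondEnt.

Lemma cmi_cond_entE (O TA TB TC : finType) (P : O -> R) (A : O -> TA) (B : O -> TB) (C : O -> TC) :
  cmi P A B C = cond_ent P A C - cond_ent P A (fun o => (B o, C o)).
Proof.
rewrite /cmi /cond_ent !RminusE !RplusE.
have -> : ent P (fun o => (A o, (B o, C o))) = ent P (fun o => (A o, B o, C o)).
  by apply: ent_equiv => ? ?; split; congruence.
move: (ent P _) (ent P _) (ent P _) (ent P _) => a b c d; ring.
Qed.

(** * Achievable block rates *)

Ltac reorder_ent A B := have -> : A = B by apply: ent_equiv => ? ?; unfold_rvs; split; congruence.

Ltac same_info := apply: ent_equiv => ? ?; unfold_rvs; split; congruence.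

Section Identities.
Variables Q U X Y Yh Z V T : finType.
Variable W : X -> Y * Yh * Z -> R.
Variables (pQU : Q * U -> R) (pXgU : U -> X -> R) (pVg : U * X * Yh -> V -> R) (pTgV : V -> T -> R).
Hypothesis W0 : forall x w, 0 <= W x w.
Hypothesis W1 : forall x, \sum_w W x w = 1.
Hypothesis pQU0 : forall p, 0 <= pQU p.
Hypothesis pQU1 : \sum_p pQU p = 1.
Hypothesis pX0 : forall u x, 0 <= pXgU u x.
Hypothesis pX1 : forall u, \sum_x pXgU u x = 1.
Hypothesis pV0 : forall c v, 0 <= pVg c v.
Hypothesis pV1 : forall c, \sum_v pVg c v = 1.
Hypothesis pT0 : forall v t, 0 <= pTgV v t.
Hypothesis pT1 : forall v, \sum_t pTgV v t = 1.

Local Notation Om := (Omega1 Q U X Y Yh Z V T).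
Local Notation P := (joint1 W pQU pXgU pVg pTgV).
Local Notation H A B := (cond_ent P A B).
Local Notation rQ := (@rQ Q U X Y Yh Z V T).
Local Notation rU := (@rU Q U X Y Yh Z V T).
Local Notation rX := (@rX Q U X Y Yh Z V T).
Local Notation rY := (@rY Q U X Y Yh Z V T).
Local Notation rYh := (@rYh Q U X Y Yh Z V T).
Local Notation rZ := (@rZ Q U X Y Yh Z V T).
Local Notation rV := (@rV Q U X Y Yh Z V T).
Local Notation rT := (@rT Q U X Y Yh Z V T).
Local Notation rS := (@rS Q U X Y Yh Z V T).

Let P0 : forall o, 0 <= P o.
Proof. exact: joint_ge0. Qed.
Let P1 : \sum_o P o = 1.
Proof. exact: joint_sum. Qed.

(** The Markov chains of the joint law, here and in the next two lemmas: [T] depends on what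
    precedes it through [V], the pair (V,T) through (U,X,Yh), and all that follows [Q] and [U]
    through [U]. *)
Lemma markov_T (TB TB' : finType) (B : Q * U * X * (Y * Yh * Z) * V -> TB) psi
    (B' : Q * U * X * (Y * Yh * Z) * V -> TB') psi' :
  (forall a, a.2 = psi (B a)) -> (forall a, a.2 = psi' (B' a)) ->
  H rT (fun o => B o.1) = H rT (fun o => B' o.1).
Proof.
move=> h1 h2.
pose p (a : Q * U * X * (Y * Yh * Z) * V) : R :=
  pQU a.1.1.1 * pXgU a.1.1.1.2 a.1.1.2 * W a.1.1.2 a.1.2 * pVg (a.1.1.1.2, a.1.1.2, a.1.2.1.2) a.2.
apply: (@cond_ent_markov_eq _ _ _ _ _ _ _ P fst snd p pTgV snd (fun t => t) B psi B' psi') => //.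
  by move=> a; rewrite /p !mulr_ge0.
move=> z; rewrite (@law_bij _ _ _ _ _ (fun z => z)) //; last by case.
  by case: z => [[[[[q u] x] w] v] t]; rewrite jointE /p; unfold_rvs; rewrite /=; ring.
by case.
Qed.

Lemma markov_VT (TA TB TB' : finType) (A : V * T -> TA) (B : Q * U * X * (Y * Yh * Z) -> TB) psi
    (B' : Q * U * X * (Y * Yh * Z) -> TB') psi' :
  (forall a, (a.1.1.2, a.1.2, a.2.1.2) = psi (B a)) ->
  (forall a, (a.1.1.2, a.1.2, a.2.1.2) = psi' (B' a)) ->
  H (fun o => A (rV o, rT o)) (fun o => B o.1.1) = H (fun o => A (rV o, rT o)) (fun o => B' o.1.1).
Proof.
move=> h1 h2.
pose p (a : Q * U * X * (Y * Yh * Z)) : R := input_law pQU pXgU a.1 * W a.1.2 a.2.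
pose k (c : U * X * Yh) (vt : V * T) : R := pTgV vt.1 vt.2 * pVg c vt.1.
apply: (@cond_ent_markov_eq _ _ _ _ _ _ _ P (fun o => o.1.1) (fun o => (rV o, rT o)) p k
  (fun a => (a.1.1.2, a.1.2, a.2.1.2)) A B psi B' psi') => //.
- by move=> a; rewrite mulr_ge0 // mulr_ge0.
- by move=> c y; rewrite mulr_ge0.
- move=> c; rewrite sum_pair -[RHS](pV1 c); apply: eq_bigr => v _.
  by rewrite /k /= -mulr_suml pT1 mul1r.
move=> z; rewrite (@law_bij _ _ _ _ _ (fun z => (z.1, z.2.1, z.2.2))); first last.
- by case=> [[s w] [v t]].
- by case=> [[[s w] v] t].
by case: z => [[s w] [v t]]; rewrite (joint_factor _ _ _ _ _ s w (v, t)).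
Qed.

Lemma markov_Q (TA TB TB' : finType) (A : X * (Y * Yh * Z) * V * T -> TA) (B : Q * U -> TB) psi
    (B' : Q * U -> TB') psi' :
  (forall a, a.2 = psi (B a)) -> (forall a, a.2 = psi' (B' a)) ->
  H (fun o => A (rX o, o.1.1.2, rV o, rT o)) (fun o => B (rQ o, rU o)) =
  H (fun o => A (rX o, o.1.1.2, rV o, rT o)) (fun o => B' (rQ o, rU o)).
Proof.
move=> h1 h2.
pose k (u : U) (r : X * (Y * Yh * Z) * V * T) : R :=
  pXgU u r.1.1.1 * W r.1.1.1 r.1.1.2 * (pTgV r.1.2 r.2 * pVg (u, r.1.1.1, r.1.1.2.1.2) r.1.2).
apply: (@cond_ent_markov_eq _ _ _ _ _ _ _ P (fun o => (rQ o, rU o)) (fun o => (rX o, o.1.1.2, rV o, rT o)) pQU k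
  snd A B psi B' psi') => //.
- by move=> c y; rewrite !mulr_ge0.
- move=> u; rewrite sum_pair sum_pair sum_pair -[RHS](pX1 u); apply: eq_bigr => x _.
  rewrite -[RHS]mulr1 -(W1 x) mulr_sumr; apply: eq_bigr => w _.
  rewrite -[RHS]mulr1 -(pV1 (u, x, w.1.2)) mulr_sumr; apply: eq_bigr => v _.
  by rewrite /k /= -mulr_sumr -mulr_suml pT1 mul1r.
move=> z; rewrite (@law_bij _ _ _ _ _ (fun z => (z.1.1, z.1.2, z.2.1.1.1, z.2.1.1.2, z.2.1.2, z.2.2))); first last.
- by case=> [[q u] [[[x w] v] t]].
- by case=> [[[[[q u] x] w] v] t].
by case: z => [[q u] [[[x w] v] t]]; rewrite jointE /k; unfold_rvs; rewrite /=; ring.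
Qed.

Lemma mi_condE TA TB (A : Om -> Finite.sort TA) (B : Om -> Finite.sort TB) :
  mi P A B = H A (fun=> tt) - H A B.
Proof.
rewrite /mi /cmi /cond_ent !RminusE !RplusE.
have -> : ent P (fun o => (B o, tt)) = ent P B by same_info.
have -> : ent P (fun o => (A o, B o, tt)) = ent P (fun o => (A o, B o)) by same_info.
move: (ent P _) (ent P _) (ent P _) (ent P _) => a b c d; ring.
Qed.

Lemma cmi_ge0 TA TB TC (A : Om -> Finite.sort TA) (B : Om -> Finite.sort TB) (C : Om -> Finite.sort TC) :
  0 <= cmi P A B C.
Proof.
rewrite cmi_cond_entE subr_ge0.
exact: (@cond_ent_le _ _ _ _ P A (fun o => (B o, C o)) C snd P0 (fun _ => erefl)).
Qed.

(** Chain rule for the Markov chain Q - U - Y. *)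
Lemma mi_UY_split : mi P rU rY = mi P rQ rY + H rU rQ - H rU (fun o => (rQ o, rY o)).
Proof.
have h := @markov_Q Y _ _ (fun r => r.1.1.2.1.1) (fun x => x) snd snd (fun x => x) (fun _ => erefl) (fun _ => erefl).
rewrite !mi_condE; move: h; rewrite /cond_ent.
have -> : ent P (fun o => (rY o, (rQ o, rU o))) = ent P (fun o => (rU o, (rQ o, rY o))) by same_info.
have -> : ent P (fun o => (rQ o, rU o)) = ent P (fun o => (rU o, rQ o)) by same_info.
have -> : ent P (fun o => (rY o, rU o)) = ent P (fun o => (rU o, rY o)) by same_info.
have -> : ent P (fun o => (rU o, tt)) = ent P rU by same_info.
have -> : ent P (fun o => (rQ o, tt)) = ent P rQ by same_info.
move: (ent P _) (ent P _) (ent P _) (ent P _) (ent P _) (ent P _) (ent P _) (ent P _) => *; lra.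
Qed.

(** By the Markov chain from [Q] through [U] to the rest, [Q] may be added to Eve's side at no
    cost. *)
Lemma source_gain :
  cmi P rV rY (fun o => (rU o, rT o)) - cmi P rV rZ (fun o => (rU o, rT o)) =
  H rV (fun o => (rU o, (rZ o, rQ o, rT o))) - H rV (fun o => (rT o, (rU o, rY o))).
Proof.
have h1 := @markov_Q _ _ _ (fun r => (r.1.2, r.2, r.1.1.2.2)) (fun x => x) snd snd (fun x => x) (fun _ => erefl) (fun _ => erefl).
have h2 := @markov_Q _ _ _ (fun r => (r.2, r.1.1.2.2)) (fun x => x) snd snd (fun x => x) (fun _ => erefl) (fun _ => erefl).
rewrite !cmi_cond_entE; move: h1 h2; rewrite /cond_ent /=.
reorder_ent (ent P (fun o => (rV o, rT o, rZ o, (rQ o, rU o)))) (ent P (fun o => (rV o, (rU o, (rZ o, rQ o, rT o))))).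
reorder_ent (ent P (fun o => (rT o, rZ o, (rQ o, rU o)))) (ent P (fun o => (rU o, (rZ o, rQ o, rT o)))).
reorder_ent (ent P (fun o => (rV o, rT o, rZ o, rU o))) (ent P (fun o => (rV o, (rZ o, (rU o, rT o))))).
reorder_ent (ent P (fun o => (rT o, rZ o, rU o))) (ent P (fun o => (rZ o, (rU o, rT o)))).
reorder_ent (ent P (fun o => (rV o, (rY o, (rU o, rT o))))) (ent P (fun o => (rV o, (rT o, (rU o, rY o))))).
reorder_ent (ent P (fun o => (rY o, (rU o, rT o)))) (ent P (fun o => (rT o, (rU o, rY o)))).
by do 20?move: (ent P _); move=> *; lra.
Qed.

(** Chain rule for I(U;Z,T|Q). *)
Lemma leakage_split :
  cmi P rU rZ rQ + cmi P rU rT (fun o => (rQ o, rZ o)) =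
  H rU rQ - H rU (fun o => (rZ o, rQ o, rT o)).
Proof.
rewrite !cmi_cond_entE /cond_ent.
reorder_ent (ent P (fun o => (rU o, (rZ o, rQ o)))) (ent P (fun o => (rU o, (rQ o, rZ o)))).
reorder_ent (ent P (fun o => (rZ o, rQ o))) (ent P (fun o => (rQ o, rZ o))).
reorder_ent (ent P (fun o => (rU o, (rT o, (rQ o, rZ o))))) (ent P (fun o => (rU o, (rZ o, rQ o, rT o)))).
reorder_ent (ent P (fun o => (rT o, (rQ o, rZ o)))) (ent P (fun o => (rZ o, rQ o, rT o))).
by do 20?move: (ent P _); move=> *; lra.
Qed.

(** A Wyner-Ziv rate: what Bob lacks about [T], then [V], minus what can be fixed in advance. [T]
    adds nothing to the left side because it is drawn from [V] alone, and [Y] may be added to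
    (U,X,Yh) because [V] does not depend on it further. *)
Lemma description_rate :
  cmi P rV (fun o => (rX o, rYh o)) (fun o => (rU o, rY o)) =
  H rT (fun o => (rU o, rY o)) + H rV (fun o => (rT o, (rU o, rY o))) -
  (H rT (fun o => (rS o, rYh o)) + H rV (fun o => (rT o, (rS o, rYh o)))).
Proof.
have h1 := @markov_T _ _ (fun a => (a.2, (a.1.1.1.2, a.1.2.1.1))) fst (fun a => (a.2, (a.1.1, a.1.2.1.2))) fst
  (fun _ => erefl) (fun _ => erefl).
have h2 := @markov_VT _ _ _ fst (fun a => (a.1, a.2.1.2)) (fun b => (b.1.1.2, b.1.2, b.2))
   (fun a => (a.1.1.2, a.1.2, a.2.1.2, a.2.1.1)) fst (fun _ => erefl) (fun _ => erefl).
rewrite cmi_cond_entE; move: h1 h2; rewrite /cond_ent /=.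
reorder_ent (ent P (fun o => (rT o, (o.1.2, (o.1.1.1.1.2, o.1.1.2.1.1))))) (ent P (fun o => (rV o, (rT o, (rU o, rY o))))).
reorder_ent (ent P (fun o : Om => (o.1.2, (o.1.1.1.1.2, o.1.1.2.1.1)))) (ent P (fun o => (rV o, (rU o, rY o)))).
reorder_ent (ent P (fun o => (rT o, (o.1.2, (o.1.1.1, o.1.1.2.1.2))))) (ent P (fun o => (rV o, (rT o, (rS o, rYh o))))).
reorder_ent (ent P (fun o : Om => (o.1.2, (o.1.1.1, o.1.1.2.1.2)))) (ent P (fun o => (rV o, (rS o, rYh o)))).
reorder_ent (ent P (fun o => (rV o, (o.1.1.1.1.2, o.1.1.1.2, o.1.1.2.1.2, o.1.1.2.1.1)))) (ent P (fun o => (rV o, ((rX o, rYh o), (rU o, rY o))))).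
reorder_ent (ent P (fun o : Om => (o.1.1.1.1.2, o.1.1.1.2, o.1.1.2.1.2, o.1.1.2.1.1))) (ent P (fun o => ((rX o, rYh o), (rU o, rY o)))).
by do 20?move: (ent P _); move=> *; lra.
Qed.

Lemma helper_rate_le : H rT (fun o => (rS o, rYh o)) <= H rT (fun o => (rU o, rY o)).
Proof.
have -> : H rT (fun o => (rS o, rYh o)) = H rT (fun o => ((rS o, rYh o), rY o)).
  exact: (@markov_VT _ _ _ snd (fun a => (a.1, a.2.1.2)) (fun b => (b.1.1.2, b.1.2, b.2))
   (fun a => ((a.1, a.2.1.2), a.2.1.1)) (fun b => (b.1.1.1.2, b.1.1.2, b.1.2)) (fun _ => erefl) (fun _ => erefl)).
exact: (@cond_ent_le _ _ _ _ P rT (fun o => ((rS o, rYh o), rY o)) (fun o => (rU o, rY o)) (fun b => (b.1.1.1.2, b.2)) P0 (fun _ => erefl)).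
Qed.

Lemma source_rate_le : H rV (fun o => (rT o, (rS o, rYh o))) <= H rV (fun o => (rT o, (rU o, rY o))).
Proof.
have -> : H rV (fun o => (rT o, (rS o, rYh o))) = H rV (fun o => (rT o, ((rS o, rYh o), rY o))).
  have h1 := @markov_VT _ _ _ snd (fun a => (a.1, a.2.1.2)) (fun b => (b.1.1.2, b.1.2, b.2))
   (fun a => ((a.1, a.2.1.2), a.2.1.1)) (fun b => (b.1.1.1.2, b.1.1.2, b.1.2)) (fun _ => erefl) (fun _ => erefl).
  have h2 := @markov_VT _ _ _ (fun x => x) (fun a => (a.1, a.2.1.2)) (fun b => (b.1.1.2, b.1.2, b.2))
   (fun a => ((a.1, a.2.1.2), a.2.1.1)) (fun b => (b.1.1.1.2, b.1.1.2, b.1.2)) (fun _ => erefl) (fun _ => erefl).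
  move: h1 h2; rewrite /cond_ent /=.
  reorder_ent (ent P (fun o => ((rV o, rT o), (o.1.1.1, o.1.1.2.1.2)))) (ent P (fun o => (rV o, (rT o, (rS o, rYh o))))).
  reorder_ent (ent P (fun o => (rT o, (o.1.1.1, o.1.1.2.1.2)))) (ent P (fun o => (rT o, (rS o, rYh o)))).
  reorder_ent (ent P (fun o => ((rV o, rT o), ((o.1.1.1, o.1.1.2.1.2), o.1.1.2.1.1)))) (ent P (fun o => (rV o, (rT o, ((rS o, rYh o), rY o))))).
  reorder_ent (ent P (fun o => (rT o, ((o.1.1.1, o.1.1.2.1.2), o.1.1.2.1.1)))) (ent P (fun o => (rT o, ((rS o, rYh o), rY o)))).
  by do 20?move: (ent P _); move=> *; lra.
exact: (@cond_ent_le _ _ _ _ P rV (fun o => (rT o, ((rS o, rYh o), rY o))) (fun o => (rT o, (rU o, rY o))) (fun b => (b.1, (b.2.1.1.1.2, b.2.2))) P0 (fun _ => erefl)).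
Qed.

Definition gain : R := cmi P rV rY (fun o => (rU o, rT o)) - cmi P rV rZ (fun o => (rU o, rT o)).
Definition bin_rate : R := cmi P rV (fun o => (rX o, rYh o)) (fun o => (rU o, rY o)).
Definition leakage : R := cmi P rU rZ rQ + cmi P rU rT (fun o => (rQ o, rZ o)).

Lemma leakage_ge0 : 0 <= leakage.
Proof. by rewrite addr_ge0 // cmi_ge0. Qed.

(** The fixed hashes have rates [e] below the entropies given (S,Yh); the bins lift the totals to
    [e] above the entropies given Bob's side, hence [2 * e] in each. The key from [V] takes what is
    left up to [e] below Eve's uncertainty, hence [gain - 3 * e]. *)
Lemma ev_generic_source e : 0 < e -> 3 * e <= gain ->
  exists fT bT fV bV kV : R, [/\ 0 <= bT, 0 <= bV, bT + bV = bin_rate + 4 * e, kV = gain - 3 * e &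
  (forall d, 0 < d -> exists n0 : nat, forall n : nat, (n0 <= n)%N ->
    helper_ok W pQU pXgU pVg pTgV n 'I_(sz n fT) 'I_(sz n bT) d) /\
  (forall d, 0 < d -> exists n0 : nat, forall n : nat, (n0 <= n)%N ->
    source_ok W pQU pXgU pVg pTgV n 'I_(sz n fV) 'I_(sz n bV) 'I_(sz n kV) d)].
Proof.
move=> he hg.
have h1 := helper_rate_le; have h2 := source_rate_le.
have h3 := description_rate; have h4 := source_gain.
have h5 : 0 <= H rV (fun o => (rT o, (rS o, rYh o))) by apply: cond_ent_ge0.
rewrite -/bin_rate in h3; rewrite -/gain in h4.
exists (H rT (fun o => (rS o, rYh o)) - e), (H rT (fun o => (rU o, rY o)) - H rT (fun o => (rS o, rYh o)) + 2 * e).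
exists (H rV (fun o => (rT o, (rS o, rYh o))) - e),
  (H rV (fun o => (rT o, (rU o, rY o))) - H rV (fun o => (rT o, (rS o, rYh o))) + 2 * e), (gain - 3 * e).
split; [lra|lra|lra|by []|split].
  apply: (ev_helper W0 W1 pQU0 pQU1 pX0 pX1 pV0 pV1 pT0 pT1 he); lra.
by apply: (ev_source W0 W1 pQU0 pQU1 pX0 pX1 pV0 pV1 pT0 pT1 (fV' := H rV (fun o => (rT o, (rS o, rYh o)))) he); lra.
Qed.

Lemma rate_generic eps : 0 < eps -> 0 < mi P rQ rY -> bin_rate < mi P rU rY -> 0 < gain ->
  0 < mi P rU rY - Num.max (mi P rQ rY) bin_rate - leakage ->
  exists Rk, [/\ 0 <= Rk, block_rate W Rk &
    gain + (mi P rU rY - Num.max (mi P rQ rY) bin_rate - leakage) - eps < Rk].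
Proof.
move=> heps hQ hb hg hbr.
set br := mi P rU rY - _ - leakage in hbr *.
(* Every loss below is a small multiple of [e], the total being [12 * e]; the divisor 20 leaves
   room. *)
pose e := Num.min (Num.min (mi P rQ rY) (mi P rU rY - bin_rate)) (Num.min gain (Num.min br eps)) / 20.
have he : 0 < e by rewrite divr_gt0 // !lt_min hQ hg hbr heps subr_gt0 hb.
have he20 : 20 * e = Num.min (Num.min (mi P rQ rY) (mi P rU rY - bin_rate)) (Num.min gain (Num.min br eps)).
  by rewrite /e; field.
have [he1 he2 he3 he4 he5] : [/\ 20 * e <= mi P rQ rY, 20 * e <= mi P rU rY - bin_rate, 20 * e <= gain, 20 * e <= br & 20 * e <= eps].
  by rewrite he20; split; rewrite !ge_min lexx ?orbT.
have hle1 : br <= mi P rU rY - mi P rQ rY - leakage by rewrite /br lerB // lerB // le_max lexx.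
have hle2 : br <= mi P rU rY - bin_rate - leakage by rewrite /br lerB // lerB // le_max lexx orbT.
have hL := leakage_ge0; have hb0 : 0 <= bin_rate by apply: cmi_ge0.
have hsplit := mi_UY_split; have hleak := leakage_split; rewrite -/leakage in hleak.
have hQc := mi_condE rQ rY.
have hHQY : 0 <= H rQ rY by apply: cond_ent_ge0.
have hHUQY : 0 <= H rU (fun o => (rQ o, rY o)) by apply: cond_ent_ge0.
have [|fT [bT [fV [bV [kV [hbT hbV hbb hkV [hT hV]]]]]]] := @ev_generic_source e he; first lra.
(* The bin index is put into the hash of [Q] as far as I(Q;Y) permits, and only the overflow uses
   the hash of [U], at the expense of the key. This is the origin of the maximum of I(Q;Y) and the
   bin rate. *)
have [bQ [bU [hbQ0 hbU0 hbQU hbQ [hbU1 hbU2]]]] : exists bQ bU : R, [/\ 0 <= bQ, 0 <= bU,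
   bQ + bU = bin_rate + 5 * e, bQ <= mi P rQ rY - 2 * e &
   bU <= mi P rU rY - mi P rQ rY - 2 * e /\
   bU <= mi P rU rY - mi P rQ rY - leakage - br + 7 * e].
  case: (lerP (bin_rate + 5 * e) (mi P rQ rY - 2 * e)) => h.
    by exists (bin_rate + 5 * e), 0; split; lra.
  by exists (mi P rQ rY - 2 * e), (bin_rate + 5 * e - (mi P rQ rY - 2 * e)); split; lra.
(* Eve's uncertainty about [U], less the hash that Bob needs, the overflow [bU] and a slack of [e]
   on either side. *)
pose kU := H rU (fun o => (rZ o, rQ o, rT o)) - H rU (fun o => (rQ o, rY o)) - 2 * e - bU.
have hkU : br - 9 * e <= kU by rewrite /kU; lra.
exists (kU + kV); split; [lra| |lra].
apply: (block_rate_of_ev W0 W1 pQU0 pQU1 pX0 pX1 pV0 pV1 pT0 pT1 he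
  (gQ := H rQ rY + e) (bQ := bQ) (gU := H rU (fun o => (rQ o, rY o)) + e) (bU := bU)
  hbT hbV _ _ _ _ _ hT hV).
- lra.
- lra.
- right; lra.
- apply: (ev_public W0 W1 pQU0 pQU1 pX0 pX1 pV0 pV1 pT0 pT1 he); lra.
- by apply: (ev_input W0 W1 pQU0 pQU1 pX0 pX1 pV0 pV1 pT0 pT1 he); rewrite /kU; lra.
Qed.

Lemma rate_no_source eps (v0 : V) (t0 : T) : 0 < eps -> 0 < mi P rQ rY ->
  (forall o, P o != 0 -> rV o = v0) -> (forall o, P o != 0 -> rT o = t0) ->
  0 < mi P rU rY - mi P rQ rY - leakage ->
  exists Rk, [/\ 0 <= Rk, block_rate W Rk & mi P rU rY - mi P rQ rY - leakage - eps < Rk].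
Proof.
move=> heps hQ hv0 ht0 hbr.
set br := _ - leakage in hbr *.
pose e := Num.min (mi P rQ rY) (Num.min br eps) / 20.
have he : 0 < e by rewrite divr_gt0 // !lt_min hQ hbr heps.
have he20 : 20 * e = Num.min (mi P rQ rY) (Num.min br eps) by rewrite /e; field.
have [he1 he4 he5] : [/\ 20 * e <= mi P rQ rY, 20 * e <= br & 20 * e <= eps].
  by rewrite he20; split; rewrite !ge_min lexx ?orbT.
have hL := leakage_ge0.
have hsplit := mi_UY_split; have hleak := leakage_split; rewrite -/leakage in hleak.
have hQc := mi_condE rQ rY.
have hHQY : 0 <= H rQ rY by apply: cond_ent_ge0.
have hHUQY : 0 <= H rU (fun o => (rQ o, rY o)) by apply: cond_ent_ge0.
pose kU := H rU (fun o => (rZ o, rQ o, rT o)) - H rU (fun o => (rQ o, rY o)) - 2 * e.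
have hkU : br - 2 * e <= kU by rewrite /kU /br; lra.
exists (kU + 0); split; [lra| |lra].
apply: (block_rate_of_ev W0 W1 pQU0 pQU1 pX0 pX1 pV0 pV1 pT0 pT1 he
  (gQ := H rQ rY + e) (bQ := 0) (gU := H rU (fun o => (rQ o, rY o)) + e) (bU := 0)
  (fT := 0) (bT := 0) (fV := 0) (bV := 0)) => //.
- lra.
- by left.
- apply: (ev_public W0 W1 pQU0 pQU1 pX0 pX1 pV0 pV1 pT0 pT1 he); lra.
- by apply: (ev_input W0 W1 pQU0 pQU1 pX0 pX1 pV0 pV1 pT0 pT1 he); rewrite /kU /br in hbr he4 *; lra.
- by move=> d hd; exists 0%N => n _; apply: ev_helper_trivial ht0 _ hd _.
- by move=> d hd; exists 0%N => n _; apply: ev_source_trivial hv0 _ hd _.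
Qed.

Lemma rate_no_input eps (phi : Q -> U) : 0 < eps ->
  (forall o, P o != 0 -> rU o = phi (rQ o)) -> bin_rate < mi P rQ rY -> 0 < gain ->
  exists Rk, [/\ 0 <= Rk, block_rate W Rk & gain - eps < Rk].
Proof.
move=> heps hphi hb hg.
pose e := Num.min (mi P rQ rY - bin_rate) (Num.min gain eps) / 20.
have he : 0 < e by rewrite divr_gt0 // !lt_min hg heps subr_gt0 hb.
have he20 : 20 * e = Num.min (mi P rQ rY - bin_rate) (Num.min gain eps) by rewrite /e; field.
have [he1 he4 he5] : [/\ 20 * e <= mi P rQ rY - bin_rate, 20 * e <= gain & 20 * e <= eps].
  by rewrite he20; split; rewrite !ge_min lexx ?orbT.
have hb0 : 0 <= bin_rate by apply: cmi_ge0.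
have hQc := mi_condE rQ rY.
have hHQY : 0 <= H rQ rY by apply: cond_ent_ge0.
have [|fT [bT [fV [bV [kV [hbT hbV hbb hkV [hT hV]]]]]]] := @ev_generic_source e he; first lra.
exists (0 + kV); split; [lra| |lra].
apply: (block_rate_of_ev W0 W1 pQU0 pQU1 pX0 pX1 pV0 pV1 pT0 pT1 he
  (gQ := H rQ rY + e) (bQ := bin_rate + 5 * e) (gU := 0) (bU := 0) hbT hbV _ _ _ _ _ hT hV) => //.
- lra.
- right; lra.
- apply: (ev_public W0 W1 pQU0 pQU1 pX0 pX1 pV0 pV1 pT0 pT1 he); lra.
- by move=> d hd; exists 0%N => n _; apply: ev_input_determined hphi _ hd _.
Qed.

End Identities.

(** * Perturbing the auxiliary variables *)

(** The entropy of the draw, visible in [B], occurs in both terms and cancels. *)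
Lemma cond_ent_mixture (O O' TA TB : finType) (P : O -> R) (P' : O' -> R) (h1 h2 : O -> O') l (A : O' -> TA) (B : O' -> TB) (sep : TB -> bool) :
  (forall o, 0 <= P o) -> \sum_o P o = 1 -> 0 <= l <= 1 ->
  (forall o, P' o = (1 - l) * law P h1 o + l * law P h2 o) ->
  (forall o, ~~ sep (B (h1 o))) -> (forall o, sep (B (h2 o))) ->
  cond_ent P' A B = (1 - l) * cond_ent P (A \o h1) (B \o h1) + l * cond_ent P (A \o h2) (B \o h2).
Proof.
move=> P0 P1 hl hP hs1 hs2; rewrite /cond_ent.
rewrite (ent_mixture P0 P1 hl hP hs1 hs2).
rewrite (@ent_mixture _ _ _ _ _ _ _ _ (fun o => (A o, B o)) (fun p => sep p.2) P0 P1 hl hP) //.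
rewrite /comp; do 6?move: (ent P _); move: (hbin l) => *; ring.
Qed.

Lemma cond_ent_mixture_same (O O' TA TB : finType) (P : O -> R) (P' : O' -> R) (h1 h2 : O -> O') l (A : O' -> TA) (B : O' -> TB) :
  (forall o, P' o = (1 - l) * law P h1 o + l * law P h2 o) ->
  (forall o, A (h2 o) = A (h1 o)) -> (forall o, B (h2 o) = B (h1 o)) ->
  cond_ent P' A B = cond_ent P (A \o h1) (B \o h1).
Proof.
move=> hP hA hB; rewrite /cond_ent (ent_mixture_same hP hB).
by rewrite (@ent_mixture_same _ _ _ _ _ _ _ _ (fun o => (A o, B o)) hP) // => o; rewrite hA hB.
Qed.

Lemma cond_ent_equiv (O TA TA' TB TB' : finType) (P : O -> R) (A : O -> TA) (A' : O -> TA') (B : O -> TB) (B' : O -> TB') :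
  (forall o o', A o = A o' <-> A' o = A' o') -> (forall o o', B o = B o' <-> B' o = B' o') ->
  cond_ent P A B = cond_ent P A' B'.
Proof.
move=> hA hB; rewrite /cond_ent (ent_equiv _ hB); congr (_ - _); apply: ent_equiv => o o'.
by split=> -[/hA -> /hB ->].
Qed.

Lemma cond_ent_determined (O TA TB : finType) (P : O -> R) (A : O -> TA) (B : O -> TB) :
  (forall o o', B o = B o' -> A o = A o') -> cond_ent P A B = 0.
Proof.
move=> h; rewrite /cond_ent (@ent_equiv _ _ _ P (fun o => (A o, B o)) B) ?subrr // => o o'.
by split=> [[]//|hB]; rewrite (h _ _ hB) hB.
Qed.

Lemma cmiC (O TA TB TC : finType) (P : O -> R) (A : O -> TA) (B : O -> TB) (C : O -> TC) :
  cmi P A B C = cmi P B A C.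
Proof.
rewrite /cmi !RminusE !RplusE.
have -> : ent P (fun o => (B o, A o, C o)) = ent P (fun o => (A o, B o, C o)).
  by apply: ent_equiv => ? ?; split; congruence.
move: (ent P _) (ent P _) (ent P _) (ent P _) => a b c d; ring.
Qed.

Lemma law_injective (O O' : finType) (P : O -> R) (h : O -> O') (g : O' -> O) o :
  cancel h g -> law P h o = if h (g o) == o then P (g o) else 0.
Proof.
move=> hg; rewrite /law; case: eqP => e; last first.
  by rewrite big1 // => o' /eqP ho'; case: e; rewrite -ho' hg.
rewrite (bigD1 (g o)) ?e //= big1 ?addr0 // => o' /andP[/eqP <-].
by rewrite hg eqxx.
Qed.

Lemma sum_option (I : finType) (F : option I -> R) : \sum_o F o = F None + \sum_i F (Some i).
Proof.
rewrite (bigD1 None) //=; congr (_ + _); rewrite (reindex_omap Some (fun x => x)); last by case.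
by apply: eq_bigl => i; rewrite eqxx.
Qed.

Section Blend.
Variables Q U X Y Yh Z V T : finType.
Variable W : X -> Y * Yh * Z -> R.
Variables (pQU : Q * U -> R) (pXgU : U -> X -> R) (pVg : U * X * Yh -> V -> R) (pTgV : V -> T -> R).
Hypothesis W0 : forall x w, 0 <= W x w.
Hypothesis W1 : forall x, \sum_w W x w = 1.
Hypothesis pQU0 : forall p, 0 <= pQU p.
Hypothesis pQU1 : \sum_p pQU p = 1.
Hypothesis pX0 : forall u x, 0 <= pXgU u x.
Hypothesis pX1 : forall u, \sum_x pXgU u x = 1.
Hypothesis pV0 : forall c v, 0 <= pVg c v.
Hypothesis pV1 : forall c, \sum_v pVg c v = 1.
Hypothesis pT0 : forall v t, 0 <= pTgV v t.
Hypothesis pT1 : forall v, \sum_t pTgV v t = 1.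
Variable m : R.
Hypothesis hm : 0 <= m <= 1.

Local Notation Om := (Omega1 Q U X Y Yh Z V T).
Local Notation P := (joint1 W pQU pXgU pVg pTgV).

Let m0 : 0 <= m. Proof. by case/andP: hm. Qed.
Let m1 : 0 <= 1 - m. Proof. by rewrite subr_ge0; case/andP: hm. Qed.
Let hP0 : forall o, 0 <= P o.
Proof. exact: joint_ge0. Qed.
Let hP1 : \sum_o P o = 1.
Proof. exact: joint_sum. Qed.

(* Revealing [U] in [Q] with a small probability makes I(Q;Y) positive at a small
   cost; revealing it always leaves no key to be extracted from the input. *)
Definition reveal (p : Q * option U * U) : R :=
  (if p.1.2 is Some u then if u == p.2 then m else 0 else 1 - m) * pQU (p.1.1, p.2).

Lemma reveal_ge0 p : 0 <= reveal p.
Proof. by rewrite mulr_ge0 //; case: p => [[q [u'|]] u] //=; case: ifP. Qed.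

Lemma reveal_sum : \sum_p reveal p = 1.
Proof.
rewrite sum_pair sum_pair -[RHS]pQU1 sum_pair; apply: eq_bigr => q _; rewrite exchange_big /=.
apply: eq_bigr => u _; rewrite /reveal /= -mulr_suml sum_option /= -big_mkcond /= big_pred1_eq.
by rewrite subrK mul1r.
Qed.

Local Notation P' := (joint1 W reveal pXgU pVg pTgV).
Local Notation Om' := (Omega1 [the finType of (Q * option U)%type] U X Y Yh Z V T).

Definition with_flag (f : U -> option U) (o : Om) : Om' :=
  ((rQ o, f (rU o)), rU o, rX o, o.1.1.2, rV o, rT o).
Definition drop_flag (o : Om') : Om := ((rQ o).1, rU o, rX o, o.1.1.2, rV o, rT o).
Definition hide := with_flag (fun=> None).
Definition show := with_flag Some.

(** The perturbed law is a mixture of two images of the original law, so each information quantity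
    either ignores the flag and is unchanged, or sees it and is interpolated. *)
Let joint_reveal o : P' o = (1 - m) * law P hide o + m * law P show o.
Proof.
rewrite !(law_injective _ _ (g := drop_flag)); try by case=> [[[[[q u] x] w] v] t].
case: o => [[[[[[q f] u] x] w] v] t]; rewrite /hide /show /with_flag /drop_flag !jointE.
unfold_rvs; rewrite /reveal /= !xpair_eqE !eqxx /= !andbT.
case: f => [u'|] /=; last by rewrite mulr0 addr0; ring.
rewrite -[Some u == Some u']/(u == u') [u == u']eq_sym; case: ifP => _; ring.
Qed.

Ltac same_cond := apply: cond_ent_equiv => ? ?; rewrite /comp /hide /show /with_flag; unfold_rvs; rewrite /=; split; congruence.
Ltac reveal_same := rewrite !(cond_ent_mixture_same joint_reveal) //.

Lemma reveal_mi_UY : mi P' (@rU _ _ _ _ _ _ _ _) (@rY _ _ _ _ _ _ _ _) = mi P (@rU _ _ _ _ _ _ _ _) (@rY _ _ _ _ _ _ _ _).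
Proof. by rewrite /mi !cmi_cond_entE; reveal_same. Qed.

Lemma reveal_gain : gain W reveal pXgU pVg pTgV = gain W pQU pXgU pVg pTgV.
Proof. by rewrite /gain !cmi_cond_entE; reveal_same. Qed.

Lemma reveal_bin_rate : bin_rate W reveal pXgU pVg pTgV = bin_rate W pQU pXgU pVg pTgV.
Proof. by rewrite /bin_rate !cmi_cond_entE; reveal_same. Qed.

(** When the flag shows [U], the chain Q - U - Y lets the pair (Q,U) be replaced by [U]. *)
Lemma reveal_mi_QY : mi P' (@rQ _ _ _ _ _ _ _ _) (@rY _ _ _ _ _ _ _ _) =
  (1 - m) * mi P (@rQ _ _ _ _ _ _ _ _) (@rY _ _ _ _ _ _ _ _) + m * mi P (@rU _ _ _ _ _ _ _ _) (@rY _ _ _ _ _ _ _ _).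
Proof.
rewrite /mi ![cmi _ _ (@rY _ _ _ _ _ _ _ _) _]cmiC !cmi_cond_entE.
rewrite (cond_ent_mixture_same joint_reveal) //.
rewrite (@cond_ent_mixture _ _ _ _ _ _ _ _ _ _ _ (fun p => isSome p.1.2) hP0 hP1 hm joint_reveal) //.
have h := @markov_Q _ _ _ _ _ _ _ _ W pQU pXgU pVg pTgV W0 W1 pQU0 pX0 pX1 pV0 pV1 pT0 pT1
  Y _ _ (fun r => r.1.1.2.1.1) (fun x => x) snd snd (fun x => x) (fun _ => erefl) (fun _ => erefl).
rewrite [cond_ent P (_ \o show) _](_ : _ = cond_ent P (@rY _ _ _ _ _ _ _ _) (fun o => (rU o, tt))); last first.
  transitivity (cond_ent P (fun o : Om => o.1.1.2.1.1) (fun o : Om => (rQ o, rU o))); first by same_cond.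
  by rewrite h; same_cond.
rewrite [cond_ent P (_ \o hide) ((fun o => (rQ o, tt)) \o hide)](_ : _ = cond_ent P (@rY _ _ _ _ _ _ _ _) (fun o => (rQ o, tt))); last first.
  by same_cond.
rewrite -[cond_ent P (_ \o hide) _]/(cond_ent P (@rY _ _ _ _ _ _ _ _) (fun=> tt)).
do 6?move: (cond_ent P _ _) => *; ring.
Qed.

Lemma reveal_leakage : leakage W reveal pXgU pVg pTgV = (1 - m) * leakage W pQU pXgU pVg pTgV.
Proof.
rewrite /leakage !leakage_split.
rewrite (@cond_ent_mixture _ _ _ _ _ _ _ _ _ _ _ (fun p => isSome p.2) hP0 hP1 hm joint_reveal) //.
rewrite (@cond_ent_mixture _ _ _ _ _ _ _ _ _ _ _ (fun p => isSome p.1.2.2) hP0 hP1 hm joint_reveal) //.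
rewrite [cond_ent P (_ \o hide) (_ \o hide)](_ : _ = cond_ent P (@rU _ _ _ _ _ _ _ _) (@rQ _ _ _ _ _ _ _ _)); last by same_cond.
rewrite [cond_ent P (_ \o hide) (_ \o hide)](_ : _ = cond_ent P (@rU _ _ _ _ _ _ _ _) (fun o => (rZ o, rQ o, rT o))); last by same_cond.
have d1 : cond_ent P ((@rU _ _ _ _ _ _ _ _) \o show) ((@rQ _ _ _ _ _ _ _ _) \o show) = 0.
  by apply: cond_ent_determined => o o' [].
have d2 : cond_ent P ((@rU _ _ _ _ _ _ _ _) \o show) ((fun o => (rZ o, rQ o, rT o)) \o show) = 0.
  by apply: cond_ent_determined => o o' [].
rewrite d1 d2; do 4?move: (cond_ent P _ _) => *; ring.
Qed.
Lemma reveal_all u0 o : m = 1 -> P' o != 0 -> rU o = odflt u0 (rQ o).2.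
Proof.
move=> hm1; rewrite jointE /reveal /= hm1 subrr; case: (rQ o) => q [u'|] /=.
  by have [->//|_] := eqVneq u' (rU o); rewrite !mul0r eqxx.
by rewrite !mul0r eqxx.
Qed.

End Blend.

Section Erase.
Variables Q U X Y Yh Z V T : finType.
Variable W : X -> Y * Yh * Z -> R.
Variables (pQU : Q * U -> R) (pXgU : U -> X -> R) (pVg : U * X * Yh -> V -> R) (pTgV : V -> T -> R).
Hypothesis W0 : forall x w, 0 <= W x w.
Hypothesis W1 : forall x, \sum_w W x w = 1.
Hypothesis pQU0 : forall p, 0 <= pQU p.
Hypothesis pQU1 : \sum_p pQU p = 1.
Hypothesis pX0 : forall u x, 0 <= pXgU u x.
Hypothesis pX1 : forall u, \sum_x pXgU u x = 1.
Hypothesis pV0 : forall c v, 0 <= pVg c v.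
Hypothesis pV1 : forall c, \sum_v pVg c v = 1.
Hypothesis pT0 : forall v t, 0 <= pTgV v t.
Hypothesis pT1 : forall v, \sum_t pTgV v t = 1.
Variable l : R.
Hypothesis hl : 0 <= l <= 1.

Local Notation Om := (Omega1 Q U X Y Yh Z V T).
Local Notation P := (joint1 W pQU pXgU pVg pTgV).

Let l0 : 0 <= l. Proof. by case/andP: hl. Qed.
Let l1 : 0 <= 1 - l. Proof. by rewrite subr_ge0; case/andP: hl. Qed.
Let hP0 : forall o, 0 <= P o.
Proof. exact: joint_ge0. Qed.
Let hP1 : \sum_o P o = 1.
Proof. exact: joint_sum. Qed.

(* Erasing [V] and [T] with a small probability makes the constraint
   I(V;X,Yh|U,Y) <= I(U;Y) strict whenever I(U;Y) > 0. *)
Definition erase_source (c : U * X * Yh) (v : option V) : R := if v is Some v then l * pVg c v else 1 - l.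
Definition erase_helper (v : option V) (t : option T) : R :=
  match v, t with Some v, Some t => pTgV v t | None, None => 1 | _, _ => 0 end.

Lemma erase_source_ge0 c v : 0 <= erase_source c v.
Proof. by case: v => [v|] //=; rewrite mulr_ge0. Qed.

Lemma erase_source_sum c : \sum_v erase_source c v = 1.
Proof. by rewrite sum_option /= -mulr_sumr pV1 mulr1 subrK. Qed.

Lemma erase_helper_ge0 v t : 0 <= erase_helper v t.
Proof. by case: v t => [v|] [t|] //=. Qed.

Lemma erase_helper_sum v : \sum_t erase_helper v t = 1.
Proof. by case: v => [v|]; rewrite sum_option /= ?pT1 ?add0r // big1 ?addr0 //. Qed.

Local Notation P' := (joint1 W pQU pXgU erase_source erase_helper).
Local Notation Om' := (Omega1 Q U X Y Yh Z [the finType of option V] [the finType of option T]).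

Definition erased (o : Om) : Om' := (rQ o, rU o, rX o, o.1.1.2, None, None).
Definition kept (o : Om) : Om' := (rQ o, rU o, rX o, o.1.1.2, Some (rV o), Some (rT o)).

Let joint_erase o : P' o = (1 - l) * law P erased o + l * law P kept o.
Proof.
case: o => [[[[[q u] x] w] v] t].
have hk : law P kept (q, u, x, w, v, t) = if (v, t) is (Some v, Some t) then P (q, u, x, w, v, t) else 0.
  case: v t => [v|] [t|]; rewrite /law /kept; try by rewrite big_pred0 // => o; rewrite !xpair_eqE /= ?andbF.
  rewrite (bigD1 (q, u, x, w, v, t)) /=; last by rewrite /rQ /rU /rX /rV /rT /= eqxx.
  rewrite big1 ?addr0 // => -[[[[[q' u'] x'] w'] v'] t'] /andP[/eqP]; unfold_rvs => /= -[-> -> -> -> -> ->].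
  by rewrite eqxx.
have he : law P erased (q, u, x, w, v, t) = if (v, t) is (None, None) then input_law pQU pXgU (q, u, x) * W x w else 0.
  case: v t {hk} => [v|] [t|]; rewrite /law /erased; try by rewrite big_pred0 // => o; rewrite !xpair_eqE /= ?andbF.
  transitivity (\sum_(v : V * T) P (q, u, x, w, v.1, v.2)).
    rewrite big_mkcond sum_pair sum_pair (bigD1 (q, u, x, w)) //= [X in _ + X]big1 ?addr0; last first.
      move=> [[[q' u'] x'] w'] hne; rewrite big1 // => v _; rewrite big1 // => t _; unfold_rvs => /=.
      by rewrite !xpair_eqE /= !andbT -!xpair_eqE (negbTE hne).
    by rewrite sum_pair; apply: eq_bigr => v _; apply: eq_bigr => t _; unfold_rvs; rewrite /= eqxx.
  rewrite -[RHS]mulr1 -(aux_law_sum pV1 pT1 (q, u, x) w.1.2) mulr_sumr.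
  by apply: eq_bigr => a _; rewrite joint_factor.
rewrite hk he jointE; unfold_rvs; rewrite /input_law /erase_source /erase_helper /=.
case: v t {hk he} => [v|] [t|]; rewrite ?RmultE; ring.
Qed.

Ltac same_cond := apply: cond_ent_equiv => ? ?; rewrite /comp /erased /kept; unfold_rvs; rewrite /=; split; congruence.

Ltac erase_same := rewrite !(cond_ent_mixture_same joint_erase) //.

Lemma erase_mi_UY : mi P' (@rU _ _ _ _ _ _ _ _) (@rY _ _ _ _ _ _ _ _) = mi P (@rU _ _ _ _ _ _ _ _) (@rY _ _ _ _ _ _ _ _).
Proof. by rewrite /mi !cmi_cond_entE; erase_same. Qed.

Lemma erase_mi_QY : mi P' (@rQ _ _ _ _ _ _ _ _) (@rY _ _ _ _ _ _ _ _) = mi P (@rQ _ _ _ _ _ _ _ _) (@rY _ _ _ _ _ _ _ _).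
Proof. by rewrite /mi !cmi_cond_entE; erase_same. Qed.

Lemma erase_none o : l = 0 -> P' o != 0 -> rV o = None /\ rT o = None.
Proof.
move=> hl0; rewrite jointE /erase_source /erase_helper.
by case: (rV o) (rT o) => [v|] [t|] //; rewrite ?hl0 ?mul0r ?mulr0 ?mul0r ?eqxx.
Qed.

(** For a conditioning that shows the erasure. On the erased component [B'] is constant, so that
    component contributes no information. *)
Let cmi_erase (TA TB TC : finType) (A : Om -> TA) (B : Om -> TB) (C : Om -> TC)
   (A' : Om' -> TA) (TB' TC' : finType) (B' : Om' -> TB') (C' : Om' -> TC') (sep : TC' -> bool) :
  (forall o, A' (erased o) = A o) -> (forall o, A' (kept o) = A o) ->
  (forall o o', B' (kept o) = B' (kept o') <-> B o = B o') ->
  (forall o o', C' (kept o) = C' (kept o') <-> C o = C o') ->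
  (forall o o', B' (erased o) = B' (erased o')) -> 
  (forall o, ~~ sep (C' (erased o))) -> (forall o, sep (C' (kept o))) ->
  cmi P' A' B' C' = l * cmi P A B C.
Proof.
move=> hA1 hA2 hB hC hB0 hs1 hs2; rewrite !cmi_cond_entE.
rewrite (cond_ent_mixture _ hP0 hP1 hl joint_erase hs1 hs2).
rewrite (@cond_ent_mixture _ _ _ _ _ _ _ _ _ _ _ (fun p => sep p.2) hP0 hP1 hl joint_erase) //.
have -> : cond_ent P (A' \o erased) ((fun o => (B' o, C' o)) \o erased) = cond_ent P (A' \o erased) (C' \o erased).
  by apply: cond_ent_equiv => // o o'; rewrite /comp /= (hB0 o o'); split=> [[]|->].
have -> : cond_ent P (A' \o kept) ((fun o => (B' o, C' o)) \o kept) = cond_ent P A (fun o => (B o, C o)).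
  apply: cond_ent_equiv => o o'; rewrite /comp /= ?hA2; first by split.
  by case: (hB o o') => ? ?; case: (hC o o') => ? ?; split=> -[e1 e2]; congr pair; auto.
have -> : cond_ent P (A' \o kept) (C' \o kept) = cond_ent P A C.
  by apply: cond_ent_equiv => o o'; rewrite /comp /= ?hA2; [split|apply: hC].
by do 4?move: (cond_ent P _ _) => *; ring.
Qed.

Lemma erase_gain : gain W pQU pXgU erase_source erase_helper = l * gain W pQU pXgU pVg pTgV.
Proof.
rewrite /gain ![cmi _ (@rV _ _ _ _ _ _ _ _) _ _]cmiC mulrBr.
by congr (_ - _); apply: (@cmi_erase _ _ _ _ _ _ _ _ _ _ _ (fun p => isSome p.2)) => // o o';
  rewrite /kept; unfold_rvs; split => /=; congruence.
Qed.

(** For a conditioning unaffected by the erasure: the erasure is then visible in [B'] itself, and as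
    it is independent of [A] and [C], it conveys nothing about [A]. *)
Let cmi_erase_no_sep (TA TB TC : finType) (A : Om -> TA) (B : Om -> TB) (C : Om -> TC)
   (A' : Om' -> TA) (TB' : finType) (B' : Om' -> TB') (C' : Om' -> TC) (sep : TB' -> bool) :
  (forall o, A' (erased o) = A o) -> (forall o, A' (kept o) = A o) ->
  (forall o, C' (erased o) = C o) -> (forall o, C' (kept o) = C o) ->
  (forall o o', B' (kept o) = B' (kept o') <-> B o = B o') ->
  (forall o o', B' (erased o) = B' (erased o')) -> 
  (forall o, ~~ sep (B' (erased o))) -> (forall o, sep (B' (kept o))) ->
  cmi P' A' B' C' = l * cmi P A B C.
Proof.
move=> hA1 hA2 hC1 hC2 hB hB0 hs1 hs2; rewrite !cmi_cond_entE.
rewrite (cond_ent_mixture_same joint_erase) //; try by move=> o; rewrite ?hA1 ?hA2 ?hC1 ?hC2.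
rewrite (@cond_ent_mixture _ _ _ _ _ _ _ _ _ _ _ (fun p => sep p.1) hP0 hP1 hl joint_erase) //.
have -> : cond_ent P (A' \o erased) ((fun o => (B' o, C' o)) \o erased) = cond_ent P A C.
  by apply: cond_ent_equiv => o o'; rewrite /comp /= ?hA1 // (hB0 o o') !hC1; split=> [[]|->].
have -> : cond_ent P (A' \o kept) ((fun o => (B' o, C' o)) \o kept) = cond_ent P A (fun o => (B o, C o)).
  apply: cond_ent_equiv => o o'; rewrite /comp /= ?hA2 ?hC2; first by split.
  by split=> -[e1 e2]; congr pair => //; case: (hB o o'); auto.
have -> : cond_ent P (A' \o erased) (C' \o erased) = cond_ent P A C.
  by apply: cond_ent_equiv => o o'; rewrite /comp /= ?hA1 ?hC1; split.
by do 4?move: (cond_ent P _ _) => *; ring.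
Qed.

Lemma erase_bin_rate : bin_rate W pQU pXgU erase_source erase_helper = l * bin_rate W pQU pXgU pVg pTgV.
Proof.
rewrite /bin_rate ![cmi _ (@rV _ _ _ _ _ _ _ _) _ _]cmiC.
by apply: (@cmi_erase_no_sep _ _ _ _ _ _ _ _ _ _ isSome) => // o o';
  rewrite /kept; unfold_rvs; split => /=; congruence.
Qed.

Lemma erase_leakage_le : leakage W pQU pXgU erase_source erase_helper <= leakage W pQU pXgU pVg pTgV.
Proof.
rewrite /leakage; apply: lerD.
  by rewrite !cmi_cond_entE; erase_same.
rewrite (@cmi_erase_no_sep _ _ _ (@rU _ _ _ _ _ _ _ _) (@rT _ _ _ _ _ _ _ _) (fun o => (rQ o, rZ o)) _ _ _ _ isSome) //; last first.
  by move=> o o'; rewrite /kept; unfold_rvs; split => /=; congruence.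
by rewrite ler_piMl ?cmi_ge0 //; case/andP: hl.
Qed.

End Erase.

(** * The case of a vanishing bin rate *)

Lemma achievable_of_tv (X Y Yh Z : finType) (W : X -> Y * Yh * Z -> R) Rk :
  (forall x w, 0 <= W x w) -> (forall x, \sum_w W x w = 1) -> 0 <= Rk ->
  (forall d, 0 < d -> exists n0 : nat, forall n : nat, (n0 <= n)%N ->
    exists K : finType, [/\ #|K|%:R <= pw2 (n%:R * Rk), pw2 (n%:R * Rk) <= 4 * #|K|%:R & tv_code W n K 0 d]) ->
  SK_achievable W Rk.
Proof.
move=> W0 W1 hRk h eps' /RltP heps'; set eps : R := eps'; have heps : 0 < eps by [].
pose d := eps / (2 * (Rk + 2)).
have hRk2 : 0 < Rk + 2 by rewrite ltr_wpDl.
have hd : 0 < d by rewrite divr_gt0 // mulr_gt0.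
have hdE : d * (Rk + 2) = eps / 2 by rewrite /d; field; rewrite gt_eqF.
have [n0 hn0] := h d hd; have [n1 hn1] := exists_nat_ge (4 / eps).
exists (maxn 1 (maxn n0 n1)) => n; rewrite !geq_max => /and3P[hn hnn0 hnn1].
have [K [hK1 hK2 htv]] := hn0 n hnn0.
have hn2 : 4 / eps <= n%:R :> R by apply: le_trans hn1 _; rewrite ler_nat.
have hn3 : 4 <= eps * n%:R by move: hn2; rewrite ler_pdivrMr // mulrC.
have hn4 : 1 <= n%:R :> R by rewrite ler1n.
set nr : R := n%:R in hK1 hK2 hn3 hn4.
have hKr : 0 < #|K|%:R :> R by have := pw2_gt0 (nr * Rk); lra.
have hlg1 : lg #|K|%:R <= nr * Rk by rewrite -[leRHS]lg_pw2; apply: lg_le.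
have hlg2 : nr * Rk - 2 <= lg #|K|%:R.
  have h4 : lg (4 : R) = 2.
    have -> : (4 : R) = pw2 (2%:R * 1); last by rewrite lg_pw2 mulr1.
    rewrite pw2Mn /pw2 Rpower_1 ?expr2; last by apply/RltP.
    by ring.
  have : lg (pw2 (nr * Rk)) <= lg (4 * #|K|%:R) by apply: lg_le => //; apply: pw2_gt0.
  by rewrite lg_pw2 lgM // h4; lra.
have hb : d * (lg #|K|%:R + 2) <= eps / 2 * nr.
  rewrite -hdE -mulrA; apply: ler_wpM2l; first exact: ltW.
  nra.
apply: (good_SK_of_tv W0 W1 hn _ hK1 htv).
- by move: hKr; rewrite ltr0n.
- exact: ltW.
- by apply: le_trans hb _; rewrite ler_wpM2r //; lra.
- apply: le_trans (lerD _ hb) (_ : eps / 2 * nr + _ <= _); last by rewrite -mulrDl -splitr.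
  by rewrite -/nr; lra.
Qed.

Lemma achievable_zero (X Y Yh Z : finType) (W : X -> Y * Yh * Z -> R) (x0 : X) :
  (forall x w, 0 <= W x w) -> (forall x, \sum_w W x w = 1) -> SK_achievable W 0.
Proof.
move=> W0 W1; apply: achievable_of_tv => // d hd; exists 0%N => n _.
exists unit; rewrite mulr0 pw20 card_unit; split=> //; first by rewrite mulr1; lra.
exists unit, (fun=> 1), (fun _ _ _ => x0), (fun _ _ => tt), (fun=> tt); split => //.
- by rewrite big_const card_unit /= addr0.
- by rewrite big_pred0.
rewrite dev_card1 ?card_unit //; first exact: ltW.
Qed.

Lemma dev_mixture (A O TK TB : finType) (p : A -> R) (f : A -> O -> R) (K : A -> O -> TK) (B : O -> TB) :
  (forall a, 0 <= p a) ->
  dev (fun z : A * O => p z.1 * f z.1 z.2) (fun z => K z.1 z.2) (fun z => (z.1, B z.2)) =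
  \sum_a p a * dev (f a) (K a) B.
Proof.
move=> p0; rewrite /dev.
under [RHS]eq_bigr do rewrite mulr_sumr.
rewrite [RHS]exchange_big; apply: eq_bigr => k _; rewrite sum_pair; apply: eq_bigr => a _.
rewrite mulr_sumr; apply: eq_bigr => b _.
rewrite -[in RHS](ger0_norm (p0 a)) -normrM; congr `|_|.
have lawE (T : finType) (C : A -> O -> T) c : law (fun z : A * O => p z.1 * f z.1 z.2) (fun z => (z.1, C z.1 z.2)) (a, c) = p a * law (f a) (C a) c.
  rewrite /law mulr_sumr big_mkcond sum_pair (bigD1 a) //= [X in _ + X]big1 ?addr0.
    by rewrite [RHS]big_mkcond; apply: eq_bigr => o _; rewrite xpair_eqE eqxx.
  by move=> a' /negbTE ha; rewrite big1 // => o _; rewrite xpair_eqE ha.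
rewrite mulrBr mulrA; congr (_ - _ / _); last exact: lawE.
rewrite -(lawE _ (fun a o => (K a o, B o))); apply: eq_bigl => -[a' o]; rewrite !xpair_eqE /=.
by case: (a' == a); rewrite ?andbT ?andbF // andbC.
Qed.

(** The chosen point has positive probability, because error-free decoding is known only on the
    support. *)
Lemma exists_le_mean (A : finType) (p f : A -> R) d : (forall a, 0 <= p a) -> \sum_a p a = 1 ->
  \sum_a p a * f a <= d -> exists2 a, p a != 0 & f a <= d.
Proof.
move=> p0 p1 hd; apply/exists_inP; apply: contraT; rewrite negb_exists_in => /forall_inP h.
have hlt a : p a != 0 -> d < f a by move=> ha; rewrite ltNge; apply: h.
have [a ha] : exists a, p a != 0.
  apply/existsP; apply: contraT; rewrite negb_exists => /forallP h0.
  move: p1; rewrite big1 => [/eqP|a _]; first by rewrite eq_sym oner_eq0.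
  by apply/eqP; rewrite -[_ == _]negbK; apply: h0.
have : \sum_a p a * d < \sum_a p a * f a.
  rewrite (bigD1 a) //= [ltRHS](bigD1 a) //= ltr_leD ?ltr_pM2l ?lt0r ?ha ?p0 ?hlt //.
  apply: ler_sum => b _; have [->|hb] := eqVneq (p b) 0; first by rewrite !mul0r.
  by rewrite ler_wpM2l // ltW // hlt.
by rewrite -mulr_suml p1 mul1r ltNge hd.
Qed.

Section NoBinning.
Variables Q U X Y Yh Z V T : finType.
Variable W : X -> Y * Yh * Z -> R.
Variables (pQU : Q * U -> R) (pXgU : U -> X -> R) (pVg : U * X * Yh -> V -> R) (pTgV : V -> T -> R).
Hypothesis W0 : forall x w, 0 <= W x w.
Hypothesis W1 : forall x, \sum_w W x w = 1.
Hypothesis pQU0 : forall p, 0 <= pQU p.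
Hypothesis pQU1 : \sum_p pQU p = 1.
Hypothesis pX0 : forall u x, 0 <= pXgU u x.
Hypothesis pX1 : forall u, \sum_x pXgU u x = 1.
Hypothesis pV0 : forall c v, 0 <= pVg c v.
Hypothesis pV1 : forall c, \sum_v pVg c v = 1.
Hypothesis pT0 : forall v t, 0 <= pTgV v t.
Hypothesis pT1 : forall v, \sum_t pTgV v t = 1.

Local Notation Om := (Omega1 Q U X Y Yh Z V T).
Local Notation P := (joint1 W pQU pXgU pVg pTgV).
Local Notation H A B := (cond_ent P A B).
Local Notation rQ := (@rQ Q U X Y Yh Z V T).
Local Notation rU := (@rU Q U X Y Yh Z V T).
Local Notation rX := (@rX Q U X Y Yh Z V T).
Local Notation rY := (@rY Q U X Y Yh Z V T).
Local Notation rYh := (@rYh Q U X Y Yh Z V T).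
Local Notation rZ := (@rZ Q U X Y Yh Z V T).
Local Notation rV := (@rV Q U X Y Yh Z V T).
Local Notation rT := (@rT Q U X Y Yh Z V T).

Let hP0 : forall o, 0 <= P o.
Proof. exact: joint_ge0. Qed.
Let hP1 : \sum_o P o = 1.
Proof. exact: joint_sum. Qed.

Definition front_law (r : Q * U * X * (Y * Yh * Z)) : R := input_law pQU pXgU r.1 * W r.1.2 r.2.

Lemma law_front (TB : finType) (B : Q * U * X * (Y * Yh * Z) -> TB) b :
  law P (fun o => B o.1.1) b = \sum_(r | B r == b) front_law r.
Proof.
rewrite /law big_mkcond sum_pair sum_pair [RHS]big_mkcond; apply: eq_bigr => r _ /=.
case: ifP => _; last by rewrite big1 // => v _; rewrite big1.
rewrite -[RHS]mulr1 -(aux_law_sum pV1 pT1 r.1 r.2.1.2) mulr_sumr sum_pair.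
by apply: eq_bigr => v _; apply: eq_bigr => t _; case: r => s w; exact: (joint_factor _ _ _ _ _ s w (v, t)).
Qed.

Lemma law_front_source (TB : finType) (B : Q * U * X * (Y * Yh * Z) -> TB) v b :
  law P (fun o => (rV o, B o.1.1)) (v, b) =
  \sum_(r | B r == b) front_law r * pVg (r.1.1.2, r.1.2, r.2.1.2) v.
Proof.
rewrite /law big_mkcond sum_pair sum_pair [RHS]big_mkcond; apply: eq_bigr => r _ /=.
rewrite (bigD1 v) //= [X in _ + X]big1 ?addr0; last first.
  by move=> v' /negbTE hv; rewrite big1 // => t _; rewrite /rV /= xpair_eqE hv.
case: ifP => hb; last by rewrite big1 // => t _; rewrite xpair_eqE hb andbF.
rewrite -[RHS]mulr1 -(pT1 v) mulr_sumr; apply: eq_bigr => t _.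
rewrite /rV /= xpair_eqE hb eqxx /=.
by case: r {hb} => s w; rewrite -[LHS]/(P (s, w, (v, t).1, (v, t).2)) joint_factor /front_law /aux_law /=; ring.
Qed.

(* Alice computes this from (U, X, Yh); when I(V;X,Yh|U,Y) = 0 Bob obtains it from
   (U, Y), which yields a key without binning. *)
Definition rep (c : U * X * Yh) : X * Yh :=
  odflt (c.1.2, c.2) [pick j | [forall v, pVg (c.1.1, j.1, j.2) v == pVg c v]].

Lemma rep_law c v : pVg (c.1.1, (rep c).1, (rep c).2) v = pVg c v.
Proof.
rewrite /rep; case: pickP => [j /forallP h|_] /=; first exact/eqP.
by case: c => [[]].
Qed.

Definition rJ (o : Om) : X * Yh := rep (rU o, rX o, rYh o).

(** A vanishing bin rate is equality in [cond_ent_le], which compares the two laws of [V] only where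
    the left one is positive. This already gives [<=] everywhere, and both laws have total mass
    one. *)
Lemma law_source o : P o != 0 -> bin_rate W pQU pXgU pVg pTgV = 0 -> forall v,
  pVg (rU o, rX o, rYh o) v =
  law P (fun o => (rV o, (rU o, rY o))) (v, (rU o, rY o)) / law P (fun o => (rU o, rY o)) (rU o, rY o).
Proof.
move=> ho hb v.
set b := ((rX o, rYh o), (rU o, rY o)); set c := (rU o, rY o).
set lb := law P (fun o => ((rX o, rYh o), (rU o, rY o))) b.
pose g v' := law P (fun o => (rV o, (rU o, rY o))) (v', c) / law P (fun o => (rU o, rY o)) c.
rewrite -/(g v).
have lb0 : 0 < lb.
  apply: lt_le_trans (_ : P o <= _); first by rewrite lt0r ho hP0.
  by rewrite /lb /law (bigD1 o) //= lerDl sumr_ge0.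
have lc0 : 0 < law P (fun o => (rU o, rY o)) c.
  apply: lt_le_trans (_ : P o <= _); first by rewrite lt0r ho hP0.
  by rewrite /law (bigD1 o) //= lerDl sumr_ge0.
have hV v' : law P (fun o => (rV o, ((rX o, rYh o), (rU o, rY o)))) (v', b) = lb * pVg (rU o, rX o, rYh o) v'.
  rewrite /lb (@law_front _ (fun r => ((r.1.2, r.2.1.2), (r.1.1.2, r.2.1.1)))) (@law_front_source _ (fun r => ((r.1.2, r.2.1.2), (r.1.1.2, r.2.1.1)))) mulr_suml.
  by apply: eq_bigr => r /eqP[<- <- <- _].
have hle v' : pVg (rU o, rX o, rYh o) v' <= g v'.
  have [->|hv] := eqVneq (pVg (rU o, rX o, rYh o) v') 0; first by rewrite divr_ge0 ?law_ge0.
  have := @cond_ent_le_eq _ _ _ _ P rV (fun o => ((rX o, rYh o), (rU o, rY o))) (fun o => (rU o, rY o)) snd hP0 (fun _ => erefl) _ v' b.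
  rewrite hV mulf_neq0 ?(gt_eqF lb0) // => h.
  have {}h : lb * pVg (rU o, rX o, rYh o) v' * law P (fun o => (rU o, rY o)) c = lb * law P (fun o => (rV o, (rU o, rY o))) (v', c).
    apply: h => //; rewrite -subr_le0; move: hb; rewrite /bin_rate cmi_cond_entE => ->; exact: lexx.
  rewrite /g ler_pdivlMr //; move: h; rewrite -mulrA => /(mulfI (lt0r_neq0 lb0)) ->; exact: lexx.
have hsum : \sum_v' (g v' - pVg (rU o, rX o, rYh o) v') = 0.
  rewrite sumrB pV1 /g -mulr_suml.
  have -> : \sum_i law P (fun o => (rV o, (rU o, rY o))) (i, c) = law P (fun o => (rU o, rY o)) c.
    exact: law_fst.
  by rewrite divff ?subrr // gt_eqF.
move/eqP: hsum; rewrite psumr_eq0 => [/allP/(_ v (mem_index_enum v))|v' _]; last by rewrite subr_ge0.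
by rewrite subr_eq0 => /eqP.
Qed.

(** Alice and Bob search for the first symbol pair inducing the same law of [V]; by [law_source]
    their search predicates coincide, hence so do the results of [pick]. *)
Lemma rep_determined (x0 : X) (y0 : Yh) : bin_rate W pQU pXgU pVg pTgV = 0 ->
  exists dec : U * Y -> X * Yh, forall o, P o != 0 -> rJ o = dec (rU o, rY o).
Proof.
move=> hb.
exists (fun c => odflt (x0, y0) [pick j | [forall v, pVg (c.1, j.1, j.2) v ==
  law P (fun o => (rV o, (rU o, rY o))) (v, c) / law P (fun o => (rU o, rY o)) c]]) => o ho.
rewrite /rJ /rep.
set p1 := (X in [pick j | X j]); set p2 := (X in odflt (x0, y0) [pick j | X j]).
have hp : p1 =1 p2.
  move=> j; apply: eq_forallb => v; congr (_ == _); exact: law_source.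
rewrite (eq_pick hp); case: pickP => // h0.
have := hp (rX o, rYh o); rewrite h0 /p1 /= => /negbT/negP[]; by apply/forallP => v.
Qed.

(** [rep] preserves the law of [V] by [rep_law], so (U,J) takes the place of (U,X,Yh) in the Markov
    chain. *)
Lemma markov_rep (TA TB TB' : finType) (A : V * T -> TA) (B : Q * U * X * (Y * Yh * Z) -> TB) psi
    (B' : Q * U * X * (Y * Yh * Z) -> TB') psi' :
  (forall a, (a.1.1.2, rep (a.1.1.2, a.1.2, a.2.1.2)) = psi (B a)) ->
  (forall a, (a.1.1.2, rep (a.1.1.2, a.1.2, a.2.1.2)) = psi' (B' a)) ->
  H (fun o => A (rV o, rT o)) (fun o => B o.1.1) = H (fun o => A (rV o, rT o)) (fun o => B' o.1.1).
Proof.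
move=> h1 h2.
pose p (a : Q * U * X * (Y * Yh * Z)) : R := input_law pQU pXgU a.1 * W a.1.2 a.2.
pose k (c : U * (X * Yh)) (vt : V * T) : R := pTgV vt.1 vt.2 * pVg (c.1, c.2.1, c.2.2) vt.1.
apply: (@cond_ent_markov_eq _ _ _ _ _ _ _ P (fun o => o.1.1) (fun o => (rV o, rT o)) p k
  (fun a => (a.1.1.2, rep (a.1.1.2, a.1.2, a.2.1.2))) A B psi B' psi') => //.
- by move=> a; rewrite mulr_ge0 // mulr_ge0.
- by move=> c y; rewrite mulr_ge0.
- move=> c; rewrite sum_pair -[RHS](pV1 (c.1, c.2.1, c.2.2)); apply: eq_bigr => v _.
  by rewrite /k /= -mulr_suml pT1 mul1r.
move=> z; rewrite (@law_bij _ _ _ _ _ (fun z => (z.1, z.2.1, z.2.2))); first last.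
- by case=> [[s w] [v t]].
- by case=> [[[s w] v] t].
case: z => [[s w] [v t]]; rewrite (joint_factor _ _ _ _ _ s w (v, t)) /k /p /aux_law.
by rewrite -(rep_law (s.1.2, s.2, w.1.2)).
Qed.

(** The gain is H(V|Z,U,T) - H(V|Y,U,T). Conditioning the second term on everything before [V] and
    [T] makes it at least H(V|T,U,Z,J), by the Markov property of [J]. What remains is I(V;J|Z,U,T),
    which is at most H(J|U,Z). *)
Lemma gain_le_rep : gain W pQU pXgU pVg pTgV <= H rJ (fun o => (rU o, rZ o)).
Proof.
have -> : gain W pQU pXgU pVg pTgV = H rV (fun o => (rZ o, (rU o, rT o))) - H rV (fun o => (rY o, (rU o, rT o))).
  by rewrite /gain !cmi_cond_entE; do 3?move: (cond_ent P _ _) => *; ring.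
have h1 : H rV (fun o => (rT o, o.1.1)) <= H rV (fun o => (rY o, (rU o, rT o))).
  exact: (@cond_ent_le _ _ _ _ P rV (fun o => (rT o, o.1.1)) (fun o => (rY o, (rU o, rT o)))
    (fun b => (b.2.2.1.1, (b.2.1.1.2, b.1))) hP0 (fun _ => erefl)).
have h2 : H rV (fun o => (rT o, o.1.1)) = H rV (fun o => (rT o, (rU o, rZ o, rJ o))).
  have e1 := @markov_rep _ _ _ snd (fun x => x) (fun a => (a.1.1.2, rep (a.1.1.2, a.1.2, a.2.1.2)))
   (fun a => (a.1.1.2, a.2.2, rep (a.1.1.2, a.1.2, a.2.1.2))) (fun b => (b.1.1, b.2)) (fun _ => erefl) (fun _ => erefl).
  have e2 := @markov_rep _ _ _ (fun x => x) (fun x => x) (fun a => (a.1.1.2, rep (a.1.1.2, a.1.2, a.2.1.2)))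
   (fun a => (a.1.1.2, a.2.2, rep (a.1.1.2, a.1.2, a.2.1.2))) (fun b => (b.1.1, b.2)) (fun _ => erefl) (fun _ => erefl).
  move: e1 e2; rewrite /cond_ent /=.
  have -> : ent P (fun o : Om => ((rV o, rT o), o.1.1)) = ent P (fun o => (rV o, (rT o, o.1.1))).
    by apply: ent_equiv => ? ?; split; congruence.
  have -> : ent P (fun o : Om => ((rV o, rT o), (o.1.1.1.1.2, o.1.1.2.2, rep (o.1.1.1.1.2, o.1.1.1.2, o.1.1.2.1.2)))) =
     ent P (fun o => (rV o, (rT o, (rU o, rZ o, rJ o)))).
    by apply: ent_equiv => ? ?; rewrite /rJ; unfold_rvs; split; congruence.
  rewrite -[ent P (fun o : Om => (rT o, (o.1.1.1.1.2, o.1.1.2.2, rep (o.1.1.1.1.2, o.1.1.1.2, o.1.1.2.1.2))))]/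
    (ent P (fun o => (rT o, (rU o, rZ o, rJ o)))).
  rewrite -[ent P (fun o : Om => (o.1.1.1.1.2, o.1.1.2.2, rep (o.1.1.1.1.2, o.1.1.1.2, o.1.1.2.1.2)))]/
    (ent P (fun o => (rU o, rZ o, rJ o))).
  by do 8?move: (ent P _); move=> *; lra.
have h3 : H rJ (fun o => (rZ o, (rU o, rT o))) <= H rJ (fun o => (rU o, rZ o)).
  exact: (@cond_ent_le _ _ _ _ P rJ (fun o => (rZ o, (rU o, rT o))) (fun o => (rU o, rZ o))
    (fun b => (b.2.1, b.1)) hP0 (fun _ => erefl)).
have h4 : 0 <= H rJ (fun o => (rV o, (rZ o, (rU o, rT o)))) by apply: cond_ent_ge0.
have h5 : cmi P rV rJ (fun o => (rZ o, (rU o, rT o))) = cmi P rJ rV (fun o => (rZ o, (rU o, rT o))) by rewrite cmiC.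
move: h5; rewrite !cmi_cond_entE.
have -> : H rV (fun o => (rJ o, (rZ o, (rU o, rT o)))) = H rV (fun o => (rT o, (rU o, rZ o, rJ o))).
  by apply: cond_ent_equiv => ? ?; split; congruence.
move: h1 h2 h3 h4; do 8?move: (cond_ent P _ _); move=> *; lra.
Qed.

Lemma law_input_channel n (u : {ffun 'I_n -> U}) x w :
  law (@iid R _ P n) (fun o => (vec rU o, (vec rX o, vec (fun o : Om => o.1.1.2) o))) (u, (x, w)) =
  iid (fun u => \sum_q pQU (q, u)) u *
  cprob W (fun x : {ffun 'I_n -> X} => \prod_i pXgU (u i) (x i)) (fun i x _ => x i) (x, w).
Proof.
pose A (o : Om) := (rU o, (rX o, o.1.1.2)).
transitivity (law (@iid R _ P n) (@vec _ _ A n) [ffun i => (u i, (x i, w i))]).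
  apply: eq_bigl => o; apply/eqP/eqP => [[<- <- <-]|/ffunP h].
    by apply/ffunP => i; rewrite !ffunE.
  by congr (_, (_, _)); apply/ffunP => i; move: (h i); rewrite !ffunE => -[].
rewrite law_iid /iid /cprob /= -!big_split; apply: eq_bigr => i _; rewrite ffunE.
move: (u i) (x i) (w i) => a b c {u x w}.
rewrite (@law_front _ (fun r => (r.1.1.2, (r.1.2, r.2)))).
rewrite (reindex_onto (fun q => (q, a, b, c)) (fun r => r.1.1.1)) /=; last by case=> [[[q u] x] w] /eqP[<- <- <-].
rewrite (eq_bigl predT) => [|q]; last by rewrite !eqxx.
by rewrite mulr_suml; apply: eq_bigr => q _; rewrite /front_law /input_law /= mulrA.
Qed.

(** A sequence [u] is fixed for both users, so Bob computes [J^n] exactly and the code makes no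
    error. Only secrecy is left, and a hash of [J^n] of rate below H(J|U,Z) provides it. *)
Lemma rate_no_binning Rk : bin_rate W pQU pXgU pVg pTgV = 0 -> 0 <= Rk ->
  Rk < gain W pQU pXgU pVg pTgV -> SK_achievable W Rk.
Proof.
move=> hb hRk hgain; have hJ := gain_le_rep.
set g := gain _ _ _ _ _ in hgain hJ; set HJ := H rJ _ in hJ.
have [o0 ho0] : exists o, P o != 0.
  apply/existsP; apply: contraT; rewrite negb_exists => /forallP h0.
  move: hP1; rewrite big1 => [/eqP|a _]; first by rewrite eq_sym oner_eq0.
  by apply/eqP; rewrite -[_ == _]negbK; apply: h0.
have [dec hdec] := rep_determined (rX o0) (rYh o0) hb.
have he : 0 < HJ - Rk by lra.
apply: achievable_of_tv => // d hd.
have [n0 hn0] := asym_dev rJ (fun o => (rU o, rZ o)) hP0 hP1 he hd.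
exists n0 => n hn; exists 'I_(sz n Rk); split.
- by rewrite card_ord sz_le_pw2.
- rewrite card_ord; have := sz_ge n Rk; have : 0 <= (sz n Rk)%:R :> R by []. 
  lra.
have := hn0 n hn 'I_(sz n Rk) 'I_(sz n Rk) (fun x => x).
rewrite card_ord sz_gt0 => /(_ isT (@balanced_id R _)) havg.
case: (exists_le_avg _ (havg _)) => [|| h hdev].
- by rewrite card_ffun card_ord expn_gt0 sz_gt0.
- case: (sz_le n Rk) => [->|h]; [by left|right].
  by apply: le_trans h _; rewrite opprB addrC subrK lexx.
pose pU (u : U) := \sum_q pQU (q, u).
pose px (u : {ffun 'I_n -> U}) (x : {ffun 'I_n -> X}) : R := \prod_i pXgU (u i) (x i).
pose f u := cprob W (px u) (fun i (x : {ffun 'I_n -> X}) _ => x i).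
pose K (u : {ffun 'I_n -> U}) (o : {ffun 'I_n -> X} * {ffun 'I_n -> Y * Yh * Z}) : 'I_(sz n Rk) :=
  h [ffun i => rep (u i, o.1 i, Yhseq o.2 i)].
have hmix : \sum_u iid pU u * dev (f u) (K u) (fun o => Zseq o.2) <= d.
  rewrite -(@dev_mixture _ _ _ _ (@iid R _ pU n) f K (fun o => Zseq o.2)); last first.
    by move=> u; apply: iid_ge0 => a; apply: sumr_ge0.
  rewrite -(@dev_push _ _ _ _ _ _ (@iid R _ P n) (fun o => (vec rU o, (vec rX o, vec (fun o : Om => o.1.1.2) o)))); last first.
    by case=> [u [x w]]; exact: law_input_channel.
  apply: le_trans hdev.
  rewrite -(@eq_dev _ _ _ _ (@iid R _ P n) (@iid R _ P n) (fun o => h (vec rJ o)) _ (fun o => (vec rU o, vec rZ o)) _ (fun _ => erefl)) //; last first.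
  - by move=> o /=; congr (_, _); apply/ffunP => i; rewrite !ffunE.
  - by move=> o /=; congr (h _); apply/ffunP => i; rewrite !ffunE.
  apply: (@dev_coarse_eq R _ _ _ _ (@iid R _ P n) (fun o => h (vec rJ o)) (@vec _ _ (fun o => (rU o, rZ o)) n)
    (fun o => (vec rU o, vec rZ o))
    (fun b : {ffun 'I_n -> U * Z} => ([ffun i => (b i).1], [ffun i => (b i).2]) : {ffun 'I_n -> U} * {ffun 'I_n -> Z})) => o.
  by congr (_, _); apply/ffunP => i; rewrite !ffunE.
have pU1 : \sum_u pU u = 1 by rewrite -[RHS]pQU1 sum_pair exchange_big.
have hiid0 (u : {ffun 'I_n -> U}) : 0 <= iid pU u by apply: iid_ge0 => a; apply: sumr_ge0.
(* Eve's view included [U^n], so the deviation is a mean over [u] and some [u] in the support does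
   at least as well. *)
have [u hu hud] := exists_le_mean hiid0 (sum_iid n pU1) hmix.
exists {ffun 'I_n -> X}, (px u), (fun i (x : {ffun 'I_n -> X}) _ => x i),
  (fun (x : {ffun 'I_n -> X}) (y : {ffun 'I_n -> Yh}) => h [ffun i => rep (u i, x i, y i)]),
  (fun y : {ffun 'I_n -> Y} => h [ffun i => dec (u i, y i)]).
split=> //.
- by move=> x; apply: prodr_ge0.
- by rewrite /px -(bigA_distr_bigA (fun i x => pXgU (u i) x)) big1.
rewrite big1 // => -[x w]; apply: contraNeq => hne; apply/eqP; congr (h _).
apply/ffunP => i; rewrite !ffunE /=.
move: hne; rewrite /cprob /= mulf_eq0 negb_or => /andP[/prodf_neq0 /(_ i isT) hx /prodf_neq0 /(_ i isT) hw].
move/prodf_neq0: hu => /(_ i isT) hu.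
have [q hq] : exists q, pQU (q, u i) != 0.
  apply/existsP; apply: contraNT hu; rewrite negb_exists => /forallP h0.
  by rewrite /pU big1 // => q _; apply/eqP; rewrite -[_ == _]negbK; apply: h0.
have ex1 (A : finType) (p : A -> R) : \sum_a p a = 1 -> exists a, p a != 0.
  move=> p1; apply/existsP; apply: contraT; rewrite negb_exists => /forallP h0.
  move: p1; rewrite big1 => [/eqP|a _]; first by rewrite eq_sym oner_eq0.
  by apply/eqP; rewrite -[_ == _]negbK; apply: h0.
have [v hv] := ex1 _ _ (pV1 (u i, x i, (w i).1.2)).
have [t ht] := ex1 _ _ (pT1 v).
by have := hdec (q, u i, x i, w i, v, t); rewrite jointE !mulf_neq0 // => /(_ isT).
Qed.

End NoBinning.

(** * Choosing the perturbation *)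

Section Capacity.
Variables Q U X Y Yh Z V T : finType.
Variable W : X -> Y * Yh * Z -> R.
Variables (pQU : Q * U -> R) (pXgU : U -> X -> R) (pVg : U * X * Yh -> V -> R) (pTgV : V -> T -> R).
Hypothesis W0 : forall x w, 0 <= W x w.
Hypothesis W1 : forall x, \sum_w W x w = 1.
Hypothesis pQU0 : forall p, 0 <= pQU p.
Hypothesis pQU1 : \sum_p pQU p = 1.
Hypothesis pX0 : forall u x, 0 <= pXgU u x.
Hypothesis pX1 : forall u, \sum_x pXgU u x = 1.
Hypothesis pV0 : forall c v, 0 <= pVg c v.
Hypothesis pV1 : forall c, \sum_v pVg c v = 1.
Hypothesis pT0 : forall v t, 0 <= pTgV v t.
Hypothesis pT1 : forall v, \sum_t pTgV v t = 1.

Local Notation Om := (Omega1 Q U X Y Yh Z V T).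
Local Notation P := (joint1 W pQU pXgU pVg pTgV).
Local Notation miUY := (mi P (@rU Q U X Y Yh Z V T) (@rY Q U X Y Yh Z V T)).
Local Notation miQY := (mi P (@rQ Q U X Y Yh Z V T) (@rY Q U X Y Yh Z V T)).
Local Notation bin := (bin_rate W pQU pXgU pVg pTgV).
Local Notation gain := (gain W pQU pXgU pVg pTgV).
Local Notation leak := (leakage W pQU pXgU pVg pTgV).

Let miUY_ge0 : 0 <= miUY. Proof. by apply: cmi_ge0. Qed.
Let miQY_ge0 : 0 <= miQY. Proof. by apply: cmi_ge0. Qed.
Let bin_ge0 : 0 <= bin. Proof. by apply: cmi_ge0. Qed.
Let leak_ge0 : 0 <= leak. Proof. exact: leakage_ge0. Qed.

(** With (V,T) always erased there is no bin index to carry. Revealing [U] with probability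
    [m = d / miUY] makes I(Q;Y) positive and costs at most [d]. *)
Lemma capacity_no_source eps : 0 < eps -> 0 < miUY -> 0 < miUY - miQY - leak ->
  exists Rk, [/\ 0 <= Rk, block_rate W Rk & miUY - miQY - leak - eps < Rk].
Proof.
move=> heps hU hbr; have hL := leak_ge0; have hQ := miQY_ge0.
pose d := Num.min (miUY - miQY - leak) eps / 2.
have hd : 0 < d by rewrite divr_gt0 // lt_min hbr heps.
have hd2 : 2 * d = Num.min (miUY - miQY - leak) eps by rewrite /d; field.
have [hd3 hd4] : 2 * d <= miUY - miQY - leak /\ 2 * d <= eps by rewrite hd2 !ge_min !lexx ?orbT.
pose m := d / miUY.
have hm0 : 0 < m by rewrite divr_gt0.
have hmU : m * miUY = d by rewrite /m mulfVK // gt_eqF.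
have hm1 : m <= 1 by rewrite ler_pdivrMr // mul1r; lra.
have hm : 0 <= m <= 1 by rewrite ltW.
have h0 : (fun l : R => 0 <= l <= 1) 0 by rewrite lexx ler01.
have eV0 := @erase_source_ge0 _ _ _ _ _ pV0 _ h0.
have eV1 := @erase_source_sum _ _ _ _ _ pV1 0.
have eT0 := @erase_helper_ge0 _ _ _ pT0.
have eT1 := @erase_helper_sum _ _ _ pT1.
have rQ0 := @reveal_ge0 _ _ _ pQU0 _ hm.
have rQ1 := @reveal_sum _ _ _ pQU1 m.
have eQ := reveal_mi_QY W0 W1 pQU0 pQU1 pX0 pX1 eV0 eV1 eT0 eT1 hm.
have eU := reveal_mi_UY W pQU pXgU (erase_source pVg 0) (erase_helper pTgV) m.
have eL := reveal_leakage W0 W1 pQU0 pQU1 pX0 pX1 eV0 eV1 eT0 eT1 hm.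
have eL0 := erase_leakage_le W0 W1 pQU0 pQU1 pX0 pX1 pV0 pV1 pT0 pT1 h0.
have eLge := leakage_ge0 W0 pQU0 pX0 eV0 eT0.
rewrite (erase_mi_QY W pQU pXgU pV1 pT1) (erase_mi_UY W pQU pXgU pV1 pT1) in eQ.
rewrite (erase_mi_UY W pQU pXgU pV1 pT1) in eU.
set L' := leakage _ pQU _ (erase_source _ _) _ in eL eL0 eLge.
have hmQ : 0 <= m * miQY by rewrite mulr_ge0 // ltW.
have hmL : 0 <= m * L' by rewrite mulr_ge0 // ltW.
have := @rate_no_source _ _ _ _ _ _ _ _ W _ pXgU _ _ W0 W1 rQ0 rQ1 pX0 pX1 eV0 eV1 eT0 eT1 (eps / 2) None None.
rewrite eQ eU eL => h; have {h}[|||||Rk [h1 h2 h3]] := h.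
- by rewrite divr_gt0.
- have : 0 <= (1 - m) * miQY by rewrite mulr_ge0 // subr_ge0.
  have : 0 < m * miUY by rewrite mulr_gt0.
  lra.
- by move=> o /(erase_none erefl)[].
- by move=> o /(erase_none erefl)[].
- lra.
by exists Rk; split => //; lra.
Qed.

(** With [U] always revealed, I(Q;Y) becomes I(U;Y), the largest room for the bin index; erasing
    with probability [d] makes the fit strict and costs [d * gain]. *)
Lemma capacity_no_input eps : 0 < eps -> 0 < miUY -> bin <= miUY -> 0 < gain ->
  exists Rk, [/\ 0 <= Rk, block_rate W Rk & gain - eps < Rk].
Proof.
move=> heps hU hb hg.
pose d := Num.min (1 / 2) (eps / (2 * gain)).
have hd : 0 < d by rewrite lt_min !divr_gt0 // mulr_gt0.
have [hd1 hd2] : d <= 1 / 2 /\ d <= eps / (2 * gain) by rewrite !ge_min !lexx ?orbT.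
have hdg : d * gain <= eps / 2.
  apply: le_trans (ler_wpM2r (ltW hg) hd2) _; rewrite le_eqVlt; apply/orP; left; apply/eqP.
  by field; rewrite gt_eqF.
have hl : 0 <= 1 - d <= 1 by apply/andP; split; lra.
have h1 : (fun l : R => 0 <= l <= 1) 1 by rewrite ler01 lexx.
have eV0 := @erase_source_ge0 _ _ _ _ _ pV0 _ hl.
have eV1 := @erase_source_sum _ _ _ _ _ pV1 (1 - d).
have eT0 := @erase_helper_ge0 _ _ _ pT0.
have eT1 := @erase_helper_sum _ _ _ pT1.
have rQ0 := @reveal_ge0 _ _ _ pQU0 _ h1.
have rQ1 := @reveal_sum _ _ _ pQU1 1.
have eQ := reveal_mi_QY W0 W1 pQU0 pQU1 pX0 pX1 eV0 eV1 eT0 eT1 h1.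
have eG := reveal_gain W pQU pXgU (erase_source pVg (1 - d)) (erase_helper pTgV) 1.
have eB := reveal_bin_rate W pQU pXgU (erase_source pVg (1 - d)) (erase_helper pTgV) 1.
rewrite (erase_mi_QY W pQU pXgU pV1 pT1) (erase_mi_UY W pQU pXgU pV1 pT1) subrr mul0r add0r mul1r in eQ.
rewrite (erase_gain W0 W1 pQU0 pQU1 pX0 pX1 pV0 pV1 pT0 pT1 hl) in eG.
rewrite (erase_bin_rate W0 W1 pQU0 pQU1 pX0 pX1 pV0 pV1 pT0 pT1 hl) in eB.
have [u0] : exists u : U, true.
  case: (pickP (fun _ : Q * U => true)) => [[_ u] _|h]; first by exists u.
  by move: pQU1; rewrite big_pred0 // => /eqP; rewrite eq_sym oner_eq0.
move=> _.
have := @rate_no_input _ _ _ _ _ _ _ _ W _ pXgU _ _ W0 W1 rQ0 rQ1 pX0 pX1 eV0 eV1 eT0 eT1 (eps / 2) (fun q => odflt u0 q.2).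
rewrite eQ eG eB => h; have {h}[||||Rk [hR1 hR2 hR3]] := h.
- by rewrite divr_gt0.
- by move=> o; apply: reveal_all.
- have : 0 < d * miUY by rewrite mulr_gt0.
  have : 0 <= d * bin by rewrite mulr_ge0 // ltW.
  have : (1 - d) * bin <= (1 - d) * miUY by apply: ler_wpM2l => //; lra.
  lra.
- by rewrite mulr_gt0 //; lra.
by exists Rk; split => //; lra.
Qed.

(** Both perturbations at once. The losses are [eps / 4] from erasing, at most [c <= eps / 2] from
    revealing, and [eps / 4] from [rate_generic]. *)
Lemma capacity_generic eps : 0 < eps -> 0 < miUY -> bin <= miUY -> 0 < gain ->
  0 < miUY - Num.max miQY bin - leak ->
  exists Rk, [/\ 0 <= Rk, block_rate W Rk & gain + (miUY - Num.max miQY bin - leak) - eps < Rk].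
Proof.
move=> heps hU hb hg hbr; set br := _ - leak in hbr *; have hL := leak_ge0; have hQ := miQY_ge0.
pose d := Num.min (1 / 2) (eps / (4 * gain)).
have hd : 0 < d by rewrite lt_min !divr_gt0 // mulr_gt0.
have [hd1 hd2] : d <= 1 / 2 /\ d <= eps / (4 * gain) by rewrite !ge_min !lexx ?orbT.
have hdg : d * gain <= eps / 4.
  apply: le_trans (ler_wpM2r (ltW hg) hd2) _; rewrite le_eqVlt; apply/orP; left; apply/eqP.
  by field; rewrite gt_eqF.
have hl : 0 <= 1 - d <= 1 by apply/andP; split; lra.
pose c := Num.min br eps / 2.
have hc : 0 < c by rewrite divr_gt0 // lt_min hbr heps.
have hc2 : 2 * c = Num.min br eps by rewrite /c; field.
have [hc3 hc4] : 2 * c <= br /\ 2 * c <= eps by rewrite hc2 !ge_min !lexx ?orbT.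
have hmax1 : miQY <= Num.max miQY bin by rewrite le_max lexx.
have hmax2 : bin <= Num.max miQY bin by rewrite le_max lexx orbT.
have hbrE : br = miUY - Num.max miQY bin - leak by [].
pose m := c / miUY.
have hm0 : 0 < m by rewrite divr_gt0.
have hmU : m * miUY = c by rewrite /m mulfVK // gt_eqF.
have hm1 : m <= 1 by rewrite ler_pdivrMr // mul1r; lra.
have hm : 0 <= m <= 1 by rewrite ltW.
have eV0 := @erase_source_ge0 _ _ _ _ _ pV0 _ hl.
have eV1 := @erase_source_sum _ _ _ _ _ pV1 (1 - d).
have eT0 := @erase_helper_ge0 _ _ _ pT0.
have eT1 := @erase_helper_sum _ _ _ pT1.
have rQ0 := @reveal_ge0 _ _ _ pQU0 _ hm.
have rQ1 := @reveal_sum _ _ _ pQU1 m.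
have eQ := reveal_mi_QY W0 W1 pQU0 pQU1 pX0 pX1 eV0 eV1 eT0 eT1 hm.
have eU := reveal_mi_UY W pQU pXgU (erase_source pVg (1 - d)) (erase_helper pTgV) m.
have eL := reveal_leakage W0 W1 pQU0 pQU1 pX0 pX1 eV0 eV1 eT0 eT1 hm.
have eL0 := erase_leakage_le W0 W1 pQU0 pQU1 pX0 pX1 pV0 pV1 pT0 pT1 hl.
have eLge := leakage_ge0 W0 pQU0 pX0 eV0 eT0.
have eG := reveal_gain W pQU pXgU (erase_source pVg (1 - d)) (erase_helper pTgV) m.
have eB := reveal_bin_rate W pQU pXgU (erase_source pVg (1 - d)) (erase_helper pTgV) m.
rewrite (erase_mi_QY W pQU pXgU pV1 pT1) (erase_mi_UY W pQU pXgU pV1 pT1) in eQ.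
rewrite (erase_mi_UY W pQU pXgU pV1 pT1) in eU.
rewrite (erase_gain W0 W1 pQU0 pQU1 pX0 pX1 pV0 pV1 pT0 pT1 hl) in eG.
rewrite (erase_bin_rate W0 W1 pQU0 pQU1 pX0 pX1 pV0 pV1 pT0 pT1 hl) in eB.
set L' := leakage _ pQU _ (erase_source _ _) _ in eL eL0 eLge.
have hmQ : 0 <= m * miQY by rewrite mulr_ge0 // ltW.
have hmL : 0 <= m * L' by rewrite mulr_ge0 // ltW.
have hdb : 0 <= d * bin by rewrite mulr_ge0 // ltW.
have hmax : Num.max ((1 - m) * miQY + m * miUY) ((1 - d) * bin) <= Num.max miQY bin + c.
  by rewrite ge_max; apply/andP; split; lra.
have := @rate_generic _ _ _ _ _ _ _ _ W _ pXgU _ _ W0 W1 rQ0 rQ1 pX0 pX1 eV0 eV1 eT0 eT1 (eps / 4).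
rewrite eQ eG eB eU eL => h; have {h}[|||||Rk [hR1 hR2 hR3]] := h.
- by rewrite divr_gt0.
- have : 0 <= (1 - m) * miQY by rewrite mulr_ge0 // subr_ge0.
  have : 0 < m * miUY by rewrite mulr_gt0.
  lra.
- have : 0 < d * miUY by rewrite mulr_gt0.
  have : (1 - d) * bin <= (1 - d) * miUY by apply: ler_wpM2l => //; lra.
  lra.
- by rewrite mulr_gt0 //; lra.
- lra.
by exists Rk; split => //; lra.
Qed.

Lemma capacity_bound eps : 0 < eps -> bin <= miUY ->
  exists Rk, SK_achievable W Rk /\
    gain + Num.max (miUY - Num.max miQY bin - leak) 0 - eps < Rk.
Proof.
move=> heps hb; set br := miUY - _ - leak.
have x0 : X.
  case: (pickP (fun _ : Om => true)) => [[[[[_ x] _] _] _] _|h]; first exact: x.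
  by exfalso; have := joint_sum W1 pQU1 pX1 pV1 pT1; rewrite big_pred0 // => /eqP; rewrite eq_sym oner_eq0.
have hach Rk : 0 <= Rk -> block_rate W Rk -> SK_achievable W Rk by apply: achievable_of_block_rate.
(* A negative target is exceeded by the rate 0, and afterwards every rate to be produced may be
   taken non-negative. *)
have [hneg|hpos] := ltP (gain + Num.max br 0 - eps) 0.
  by exists 0; split => //; exact: achievable_zero x0 W0 W1.
have hbrE : br <= miUY - miQY - leak by rewrite /br lerB // lerB // le_max lexx.
have hmax0 : 0 <= Num.max miQY bin by rewrite le_max miQY_ge0.
have hbr0 : br <= miUY by rewrite /br; have := leak_ge0; lra.
(* If I(U;Y) = 0 there is no room for a carrier: the constraint forces the bin rate to 0, and the
   second bracket vanishes as well. *)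
have [hU|hU] := ltP 0 miUY; last first.
  have hb0 : bin = 0 by apply/le_anti; rewrite bin_ge0 (le_trans hb).
  have hmax : Num.max br 0 = 0 by apply/max_idPr; lra.
  rewrite hmax in hpos *; exists (gain - eps / 2); split; last lra.
  by apply: (rate_no_binning W0 W1 pQU0 pQU1 pX0 pX1 pV0 pV1 pT0 pT1 hb0); lra.
(* If the gain is not positive, the target being non-negative makes the second bracket positive, and
   the bound improves when (V,T) is erased. *)
have [hg|hg] := ltP 0 gain; last first.
  have [hbr|hbr] : br <= 0 \/ 0 < br by case: ltP; [right|left].
    by move: hpos; rewrite (max_idPr hbr) => ?; exfalso; lra.
  have -> : Num.max br 0 = br by apply/max_idPl/ltW.
  have [|Rk [h1 h2 h3]] := capacity_no_source heps hU; first by apply: lt_le_trans hbrE.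
  by exists Rk; split; [apply: hach|lra].
have [hbr|hbr] : 0 < br \/ br <= 0 by case: ltP; [left|right].
  have -> : Num.max br 0 = br by apply/max_idPl/ltW.
  have [Rk [h1 h2 h3]] := capacity_generic heps hU hb hg hbr.
  by exists Rk; split => //; apply: hach.
have -> : Num.max br 0 = 0 by apply/max_idPr.
rewrite addr0.
have [Rk [h1 h2 h3]] := capacity_no_input heps hU hb hg.
by exists Rk; split => //; apply: hach.
Qed.

End Capacity.

Lemma is_distP (A : finType) (p : A -> R) : is_dist p -> (forall a, 0 <= p a) /\ \sum_a p a = 1.
Proof. by case=> h0 h1; split=> // a; apply/RleP. Qed.

Close Scope ring_scope.
Delimit Scope R_scope with R.
Bind Scope R_scope with Rdefinitions.R.

Theorem theorem2
  (X Y Yh Z : finType) (W : X -> Y * Yh * Z -> R)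
  (HW : forall x : X, is_dist (W x))
  (Q U V T : finType)
  (pQU : Q * U -> R) (pXgU : U -> X -> R)
  (pVg : U * X * Yh -> V -> R) (pTgV : V -> T -> R)
  (HQU : is_dist pQU) (HXgU : forall u, is_dist (pXgU u))
  (HVg : forall uxyh, is_dist (pVg uxyh)) (HTgV : forall v, is_dist (pTgV v)) :
  let P := joint1 W pQU pXgU pVg pTgV in
  let rQ  := fun o : Omega1 Q U X Y Yh Z V T => o.1.1.1.1.1 in
  let rU  := fun o : Omega1 Q U X Y Yh Z V T => o.1.1.1.1.2 in
  let rX  := fun o : Omega1 Q U X Y Yh Z V T => o.1.1.1.2 in
  let rY  := fun o : Omega1 Q U X Y Yh Z V T => o.1.1.2.1.1 in
  let rYh := fun o : Omega1 Q U X Y Yh Z V T => o.1.1.2.1.2 in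
  let rZ  := fun o : Omega1 Q U X Y Yh Z V T => o.1.1.2.2 in
  let rV  := fun o : Omega1 Q U X Y Yh Z V T => o.1.2 in
  let rT  := fun o : Omega1 Q U X Y Yh Z V T => o.2 in
  let rXYh := fun o => (rX o, rYh o) in
  let rUY := fun o => (rU o, rY o) in
  let rUT := fun o => (rU o, rT o) in
  let rQZ := fun o => (rQ o, rZ o) in
  (cmi P rV rXYh rUY <= mi P rU rY)%R ->
  forall eps : R, (0 < eps)%R ->
  exists Rk : R, SK_achievable W Rk /\
    (cmi P rV rY rUT - cmi P rV rZ rUT
     + pos_part (mi P rU rY - Rmax (mi P rQ rY) (cmi P rV rXYh rUY)
                 - cmi P rU rZ rQ - cmi P rU rT rQZ) - eps < Rk)%R.
Proof.
have [pQU0 pQU1] := is_distP HQU.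
move=> P rQ0 rU0 rX0 rY0 rYh0 rZ0 rV0 rT0 rXYh rUY rUT rQZ hb eps /RltP heps.
have [Rk [h1 h2]] := capacity_bound (fun x => (is_distP (HW x)).1) (fun x => (is_distP (HW x)).2) pQU0 pQU1
  (fun u => (is_distP (HXgU u)).1) (fun u => (is_distP (HXgU u)).2)
  (fun c => (is_distP (HVg c)).1) (fun c => (is_distP (HVg c)).2)
  (fun v => (is_distP (HTgV v)).1) (fun v => (is_distP (HTgV v)).2) heps (introT RleP hb).
exists Rk; split=> //; apply/RltP; move: h2.
rewrite /pos_part !RmaxE /leakage !RminusE !RplusE opprD addrA.
exact.
Qed.
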